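(* Let $m\geq 7$ be a prime. Then $$\sum_{n=0}^\infty b_6\left(\frac{mn-5}{24}\right)q^n\in S_{2m-2}(\Gamma_0(3456),\chi_6)_m.$$ In addition, $$\sum_{n=0}^\infty b_6\left(\frac{25n-5}{24}\right)q^n\in S_{48}(\Gamma_0(3456),\chi_6)_5.$$
   Context: $b_6(n)$ is the number of partitions of $n$ with no part divisible by $6$, with $b_6(0)=1$ and $b_6(x)=0$ whenever $x\notin\mathbb{Z}_{\geq 0}$. $\chi_6(n)=\left(\frac{6}{n}\right)$ (Kronecker symbol). For a prime $m$, $S_k(\Gamma_0(N),\chi)_m$ denotes the $\mathbb{F}_m$-vector space obtained by reducing modulo $m$ the $q$-expansions of cusp forms in $S_k(\Gamma_0(N),\chi)$ with integer coefficients; membership means the series is congruent coefficientwise mod $m$ to the $q$-expansion of such a cusp form, $q=e^{2\pi i z}$. *)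

(* Defs.v *)
From HB Require Import structures.
From mathcomp Require Import all_boot all_order all_algebra.
From mathcomp Require Import complex.
From mathcomp Require Import boolp classical_sets reals topology normedtype.
From mathcomp Require Import sequences derive exp trigo.

Set Implicit Arguments.
Unset Strict Implicit.
Unset Printing Implicit Defensive.

Import Order.TTheory GRing.Theory Num.Theory.
Import numFieldNormedType.Exports.

Local Open Scope classical_set_scope.
Local Open Scope ring_scope.
Local Open Scope complex_scope.

(* A partition of n is given by its multiplicities: f i is the number of parts
   equal to i.+1. Parts and multiplicities cannot exceed n. *)
Definition regular_partitions (l n : nat) : {set {ffun 'I_n -> 'I_n.+1}} :=
  [set f : {ffun 'I_n -> 'I_n.+1} |
    (\sum_(i < n) i.+1 * f i == n)%N
    && [forall i : 'I_n, (l %| i.+1)%N ==> (f i == ord0)]].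

Definition b6 (x : rat) : nat :=
  if x \is a Num.nat then #|regular_partitions 6 (Num.truncn x)| else 0%N.

Definition legendre (a : int) (p : nat) : int :=
  if (p %| a)%Z then 0
  else if [exists x : 'I_p, ((x%:Z ^+ 2)%R == a %[mod p])%Z] then 1 else -1.

Definition kronecker_prime (a : int) (p : nat) : int :=
  if p == 2%N then
    if (2 %| a)%Z then 0
    else if ((a %% 8)%Z == 1) || ((a %% 8)%Z == 7) then 1 else -1
  else legendre a p.

Definition kronecker (a n : int) : int :=
  if n == 0 then (if `|a| == 1 then 1 else 0)
  else (if (n < 0) && (a < 0) then -1 else 1) *
       \prod_(p <- primes `|n|%N) kronecker_prime a p ^+ logn p `|n|%N.

Section ModularForms.
Variable R : realType.
Implicit Types (f : R[i] -> R[i]) (z : R[i]) (M : 'M[int]_2).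

Definition upper_half_plane : set R[i] := [set z | 0 < complex.Im z].

Definition cexp z : R[i] :=
  (expR (complex.Re z) * cos (complex.Im z))
  +i* (expR (complex.Re z) * sin (complex.Im z)).

(* e^(2 pi i z / h), the local parameter at a cusp of width h *)
Definition nome (h : nat) z : R[i] := cexp ((pi *+ 2)%:C * 'i * z / h%:R).

Definition has_qexpansion (h : nat) f (a : nat -> R[i]) : Prop :=
  forall z, upper_half_plane z ->
    (series (fun n => a n * nome h z ^+ n) : nat -> R[i]^o) @ \oo
      --> (f z : R[i]^o).

Definition automorphy M z : R[i] := (M 1 0)%:~R * z + (M 1 1)%:~R.

Definition mobius M z : R[i] :=
  ((M 0 0)%:~R * z + (M 0 1)%:~R) / automorphy M z.

Definition slash (k : nat) f M z : R[i] :=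
  automorphy M z ^- k * f (mobius M z).

Definition SL2Z : set 'M[int]_2 := [set M | \det M = 1].

Definition Gamma0 (N : nat) : set 'M[int]_2 :=
  [set M | SL2Z M /\ (N %| (M 1 0)%R)%Z].

(* derivable over the scalar field R[i], i.e. complex differentiable *)
Definition holomorphic_on_H f : Prop :=
  forall z, upper_half_plane z -> derivable (f : R[i]^o -> R[i]^o) z 1.

(* S_k(Gamma_0(N), chi); only the values of f on the upper half plane matter.
   The last clause is vanishing at every cusp: each f |_k M has an expansion
   in positive powers of e^(2 pi i z / h) for some h. *)
Definition cusp_forms (k N : nat) (chi : int -> R[i]) : set (R[i] -> R[i]) :=
  [set f | [/\ holomorphic_on_H f,
      forall M, Gamma0 N M -> forall z, upper_half_plane z ->
        slash k f M z = chi (M 1 1) * f z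
    & forall M, SL2Z M -> exists h : nat, exists a : nat -> R[i],
        [/\ (0 < h)%N, a 0%N = 0 & has_qexpansion h (slash k f M) a]]].

Definition chi6 (d : int) : R[i] := (kronecker 6 d)%:~R.

(* integer sequences whose generating series lies in S_k(Gamma_0(N), chi)_m *)
Definition cusp_forms_mod (m k N : nat) (chi : int -> R[i]) :
    set (nat -> int) :=
  [set c | exists f, exists a : nat -> int,
    [/\ cusp_forms k N chi f,
        has_qexpansion 1 f (fun n => (a n)%:~R)
      & forall n, (c n = a n %[mod m])%Z]].

End ModularForms.

(* Main.v *)
(* Let F = h eta^(4M) with h(t) = eta(6t)/eta(t) and M = p^r, of weight 2M, and let T
   be the Hecke operator T_p for the principal congruence group of level 144, applied
   r times. The form in question is f(z) = (T^r F / eta^4)(24 z), of weight 2M - 2.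

   Congruence: T acts on coefficients as U_p modulo p, and eta^(4M) is congruent to
   eta(M t)^4, which U_p^r turns into eta^4; hence f is congruent to the generating
   series of b_6((M n - 5)/24).

   Modularity: h and eta^4 are expressed through Klein forms at 12-torsion points, on
   which SL_2(Z) acts by the obvious permutation of the points. This reduces to the
   inversion t -> -1/t of the theta function, proved by a Liouville-type uniqueness
   statement for quasi-periodic entire functions. Up to a root of unity, h is invariant
   under the matrices (a, b; c, d) with 24 | b and 144 | c, and the factor is (6/d).

   Cuspidality: at every cusp the exponents of F in powers of q^(1/144) are at least
   24M - 5 and different from 24M. Dividing them by p, r times, leaves exponents at
   least 24 - 5/M and different from 24, that is, larger than 24, the order of eta^4. *)

From HB Require Import structures.
From mathcomp Require Import all_boot all_order all_algebra.
From mathcomp Require Import complex.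
From mathcomp Require Import boolp classical_sets reals topology normedtype.
From mathcomp Require Import sequences derive exp trigo.
From mathcomp Require Import finfield closed_field.
From mathcomp Require Import zify ring lra.
Require Import Defs.

Set Implicit Arguments.
Unset Strict Implicit.
Unset Printing Implicit Defensive.

Import Order.TTheory GRing.Theory Num.Theory.
Import numFieldNormedType.Exports.

Local Open Scope classical_set_scope.
Local Open Scope ring_scope.
Local Open Scope complex_scope.

(** The function [phi], a multiple of theta divided by eta^3, has derivative -2 pi i at 0 for every
    t. Its inversion formula therefore carries the factor t and no square root, and the constant in
    it follows from comparing derivatives. The multipliers of eta^4 and h become integers modulo 6
    and 24, found without Dedekind sums. The Hecke operator is taken for a normal subgroup because
    slashing T_p F by any matrix of SL_2(Z) is then T_p of another slash of F, so that one formula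
    for the coefficients serves at all cusps. The substitution 24 z turns the conditions 24 | b and
    144 | c into the level 24 * 144 = 3456. The bound 24 - 5/M exceeds 23 exactly when M > 5: one
    Hecke step is enough for p >= 7, while p = 5 needs M = 25. The exponent 24 itself is avoided
    because the exponents of h in q^(1/144), at any cusp, are congruent to 6, 7, 10 or 3 modulo 12,
    hence never 0. *)

Section NullSequences.
Variable R : realType.
Implicit Types u v : nat -> R.

Definition tends0 v := forall e, 0 < e -> exists N, forall n, (N <= n)%N -> v n < e.

Lemma tends0_le u v : (forall n, u n <= v n) -> tends0 v -> tends0 u.
Proof.
move=> uv v0 e e0; have [N NP] := v0 e e0.
by exists N => n Nn; apply: le_lt_trans (uv n) (NP n Nn).
Qed.

Lemma tends0D u v : tends0 u -> tends0 v -> tends0 (fun n => u n + v n).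
Proof.
move=> u0 v0 e e0; have e2 : 0 < e / 2 by lra.
have [N NP] := u0 _ e2; have [M MP] := v0 _ e2.
exists (maxn N M) => n; rewrite geq_max => /andP[Nn Mn].
by have := NP n Nn; have := MP n Mn; lra.
Qed.

Lemma tends0Ml (c : R) v : 0 <= c -> tends0 v -> tends0 (fun n => c * v n).
Proof.
move=> c0 v0 e e0.
have c1 : 0 < c + 1 by lra.
have [N NP] := v0 _ (divr_gt0 e0 c1).
exists N => n Nn; have := NP n Nn; rewrite ltr_pdivlMr // => h.
have [vn|vn] := leP (v n) 0; last by nra.
by apply: le_lt_trans e0; rewrite mulr_ge0_le0.
Qed.

Lemma tends0_sub v (s : nat -> nat) : (forall N, exists K, forall n, (K <= n)%N -> (N <= s n)%N) ->
  tends0 v -> tends0 (v \o s).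
Proof.
move=> sP v0 e e0; have [N NP] := v0 e e0; have [K KP] := sP N.
by exists K => n Kn; apply/NP/KP.
Qed.

Lemma tends0_geom (x : R) : 0 <= x < 1 -> tends0 (fun n => x ^+ n).
Proof.
move=> /andP[x0 x1] e e0.
have : x ^+ n @[n --> \oo] --> (0 : R) by apply: cvg_expr; rewrite ger0_norm.
move/cvgrPdist_lt => /(_ e e0) [N _ NP]; exists N => n Nn.
by have := NP n Nn; rewrite /= sub0r normrN ger0_norm // exprn_ge0.
Qed.

(** The supremum of the partial sums is approached within e at some [N], and by monotonicity all
    later partial sums lie in between. *)
Lemma bounded_tail v : (forall n, 0 <= v n) -> (exists B, forall N, \sum_(i < N) v i <= B) ->
  forall e, 0 < e -> exists N, forall n m, (N <= n)%N -> (n <= m)%N ->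
    \sum_(i < m) v i - \sum_(i < n) v i < e.
Proof.
move=> v0 [B BP] e e0.
pose S := range (fun N => \sum_(i < N) v i).
have hS : has_sup S.
  by split; [exists (\sum_(i < 0) v i); exists 0%N | exists B => _ [N _ <-]; exact: BP].
have [_ [N _ <-] NP] := sup_adherent e0 hS.
have mono n m : (n <= m)%N -> \sum_(i < n) v i <= \sum_(i < m) v i.
  move=> nm; rewrite -(subnKC nm) big_split_ord /= lerDl sumr_ge0 //.
exists N => n m Nn nm.
have h1 := mono _ _ Nn.
have : \sum_(i < m) v i <= sup S by apply: sup_upper_bound => //; exists m.
lra.
Qed.

End NullSequences.

(** * Limits of complex sequences and absolutely convergent series *)

Section ComplexSequences.
Variable R : realType.
Local Notation C := R[i].
Implicit Types (x y z l : C) (u v : nat -> C).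

(** The norm of [R[i]] takes its values in [R[i]]; this modulus lives in [R], where [lra] and [nra]
    apply. *)
Definition nm z : R := Num.sqrt (complex.Re z ^+ 2 + complex.Im z ^+ 2).

Lemma nmE z : nm z = ComplexField.Normc.normc z. Proof. by case: z. Qed.
Lemma norm_nm z : `|z| = (nm z)%:C. Proof. exact: normc_def. Qed.
Lemma nm_ge0 z : 0 <= nm z. Proof. exact: sqrtr_ge0. Qed.
Lemma nmM x y : nm (x * y) = nm x * nm y.
Proof. by apply: (@complexI R); rewrite rmorphM /= -!norm_nm normrM. Qed.
Lemma nmD x y : nm (x + y) <= nm x + nm y.
Proof. by rewrite !nmE; apply: le_normcD. Qed.
Lemma nmN x : nm (- x) = nm x.
Proof. by apply: (@complexI R); rewrite -!norm_nm normrN. Qed.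
Lemma nm0 : nm 0 = 0. Proof. by rewrite nmE ComplexField.Normc.normc0. Qed.
Lemma nm1 : nm 1 = 1. Proof. by rewrite nmE ComplexField.Normc.normc1. Qed.
Lemma nm_eq0 x : (nm x == 0) = (x == 0).
Proof.
apply/eqP/eqP => [|->]; last exact: nm0.
by rewrite nmE => /ComplexField.Normc.eq0_normc.
Qed.
Lemma nm_gt0 x : (0 < nm x) = (x != 0).
Proof. by rewrite lt_def nm_eq0 nm_ge0 andbT. Qed.
Lemma nmB x y : nm (x - y) = nm (y - x). Proof. by rewrite -nmN opprB. Qed.
Lemma nmX x n : nm (x ^+ n) = nm x ^+ n.
Proof. by elim: n => [|n IH]; rewrite ?expr0 ?nm1 // !exprS nmM IH. Qed.
Lemma nmV x : nm x^-1 = (nm x)^-1.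
Proof. by rewrite !nmE ComplexField.Normc.normcV. Qed.
Lemma nmR (r : R) : nm r%:C = `|r|.
Proof. by rewrite /nm /= expr0n addr0 sqrtr_sqr. Qed.
Lemma nm_nat n : nm n%:R = n%:R.
Proof. by rewrite -(rmorph_nat (real_complex R)) nmR ger0_norm. Qed.
Lemma nm_Re x : `|complex.Re x| <= nm x.
Proof. by rewrite -sqrtr_sqr /nm ler_sqrt ?addr_ge0 ?sqr_ge0 // lerDl sqr_ge0. Qed.
Lemma nm_Im x : `|complex.Im x| <= nm x.
Proof. by rewrite -sqrtr_sqr /nm ler_sqrt ?addr_ge0 ?sqr_ge0 // lerDr sqr_ge0. Qed.
Lemma nm_le x : nm x <= `|complex.Re x| + `|complex.Im x|.
Proof.
have a0 := normr_ge0 (complex.Re x); have b0 := normr_ge0 (complex.Im x).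
rewrite -[leRHS]ger0_norm ?addr_ge0 // -sqrtr_sqr /nm ler_sqrt ?sqr_ge0 //.
rewrite -(real_normK (num_real (complex.Re x))) -(real_normK (num_real (complex.Im x))).
by nra.
Qed.
Lemma nm_sum I (r : seq I) (P : pred I) (F : I -> C) :
  nm (\sum_(i <- r | P i) F i) <= \sum_(i <- r | P i) nm (F i).
Proof.
elim/big_ind2: _ => [|x a y b xa yb|//]; first by rewrite nm0.
exact: le_trans (nmD _ _) (lerD xa yb).
Qed.
Lemma nmBD x y : nm x <= nm y + nm (x - y).
Proof. by rewrite -{1}(subrK y x) addrC nmD. Qed.

Definition tends u l := tends0 (fun n => nm (u n - l)).

Lemma tends_cst l : tends (fun=> l) l.
Proof. by move=> e e0; exists 0%N => n _; rewrite subrr nm0. Qed.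

Lemma tends_ext u v l : (forall n, u n = v n) -> tends u l -> tends v l.
Proof. by move=> uv ul e /ul[N NP]; exists N => n /NP; rewrite uv. Qed.

Lemma tends_unique u l l' : tends u l -> tends u l' -> l = l'.
Proof.
move=> ul ul'; apply/eqP; rewrite -subr_eq0 -nm_eq0; apply: contraT => h.
have h0 : 0 < nm (l - l') / 2 by rewrite divr_gt0 // lt_def h nm_ge0.
have [N NP] := ul _ h0; have [M MP] := ul' _ h0.
have := NP (maxn N M) (leq_maxl _ _); have := MP (maxn N M) (leq_maxr _ _).
have := nmD (l - u (maxn N M)) (u (maxn N M) - l').
by rewrite addrA subrK (nmB l (u _)); lra.
Qed.

Lemma tendsD u v l l' : tends u l -> tends v l' -> tends (fun n => u n + v n) (l + l').
Proof.
move=> ul vl; apply: tends0_le (tends0D ul vl) => n.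
by rewrite opprD addrACA nmD.
Qed.

Lemma tendsM u v l l' : tends u l -> tends v l' -> tends (fun n => u n * v n) (l * l').
Proof.
move=> ul vl e e0.
have [M MP] := vl 1 ltr01.
have [N NP] := tends0D (tends0Ml (nm_ge0 l) vl)
   (tends0Ml (addr_ge0 (nm_ge0 l') ler01) ul) e0.
exists (maxn N M) => n; rewrite geq_max => /andP[/NP h /MP h'].
have -> : u n * v n - l * l' = l * (v n - l') + (u n - l) * v n by ring.
apply: le_lt_trans (nmD _ _) _; rewrite !nmM; apply: le_lt_trans h.
rewrite lerD2l mulrC ler_wpM2r ?nm_ge0 //.
by have := nmBD (v n) l'; lra.
Qed.

Lemma tendsMl c u l : tends u l -> tends (fun n => c * u n) (c * l).
Proof. by move=> ul; apply: tendsM ul; apply: tends_cst. Qed.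

Lemma tends_sub u l (s : nat -> nat) :
  (forall N, exists K, forall n, (K <= n)%N -> (N <= s n)%N) ->
  tends u l -> tends (u \o s) l.
Proof. by move=> sP; apply: (tends0_sub sP). Qed.

Lemma tends_shift u l k : tends u l -> tends (fun n => u (n + k)%N) l.
Proof. by apply: (tends_sub (s := fun n => (n + k)%N)) => N; exists N => n; lia. Qed.

Lemma tends_sum (I : Type) (r : seq I) (U : I -> nat -> C) (L : I -> C) :
  (forall i, tends (U i) (L i)) ->
  tends (fun n => \sum_(i <- r) U i n) (\sum_(i <- r) L i).
Proof.
move=> h; elim: r => [|i r IH].
  by rewrite big_nil; apply: tends_ext (tends_cst 0) => n; rewrite big_nil.
rewrite big_cons; apply: tends_ext (tendsD (h i) IH) => n; rewrite big_cons //.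
Qed.

Lemma tends_le_nm u l (B : R) : (forall n, nm (u n) <= B) -> tends u l -> nm l <= B.
Proof.
move=> uB ul; rewrite leNgt; apply/negP => Bl.
have lB : 0 < nm l - B by lra.
have [N NP] := ul _ lB.
have := NP N (leqnn _); have := uB N; have := nmBD l (u N).
by rewrite (nmB l); lra.
Qed.

(** Bridge to the filter convergence in [has_qexpansion]. A positive element of [R[i]] has zero
    imaginary part, so the epsilons on both sides correspond. *)
Lemma tendsP u l : tends u l <-> (u : nat -> R[i]^o) @ \oo --> (l : R[i]^o).
Proof.
split=> [ul|/cvgrPdist_lt ul].
  apply/cvgrPdist_lt => e; case: e => a b; rewrite ltcE /= => /andP[/eqP -> a0].
  have [N NP] := ul a a0; exists N => // n Nn /=.
  by rewrite norm_nm ltcE /= eqxx nmB NP.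
move=> e e0; have [|N _ NP] := ul e%:C; first by rewrite ltcE /= eqxx.
by exists N => n /NP; rewrite /= norm_nm ltcE /= nmB => /andP[_].
Qed.

Lemma tends_Re_Im u (a b : R) :
  (complex.Re (u n)) @[n --> \oo] --> a -> (complex.Im (u n)) @[n --> \oo] --> b ->
  tends u (a +i* b).
Proof.
move=> /cvgrPdist_lt ua /cvgrPdist_lt ub e e0.
have e2 : 0 < e / 2 by lra.
have [N _ NP] := ua _ e2; have [M _ MP] := ub _ e2.
exists (maxn N M) => n; rewrite geq_max => /andP[/NP /= h /MP /= h'].
apply: le_lt_trans (nm_le _) _; rewrite /=.
case: (u n) h h' => x y /=; rewrite ![`|_ - x|]distrC ![`|_ - y|]distrC; lra.
Qed.

(** Completeness is only needed in [R]: real and imaginary parts are dominated by the moduli and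
    converge separately. *)
Lemma abs_summable_tends u :
  (exists B, forall N, \sum_(i < N) nm (u i) <= B) ->
  exists l, tends (fun N => \sum_(i < N) u i) l.
Proof.
move=> [B BP].
have aux (f : C -> R) : (forall x, `|f x| <= nm x) -> cvgn (series (fun n => f (u n))).
  move=> fP; apply: normed_cvg.
  apply: (nondecreasing_is_cvgn).
    by apply: nondecreasing_series => n _ _; apply: normr_ge0.
  exists B => _ [n _ <-]; rewrite /normed_series_of seriesEord.
  by apply: le_trans (BP n); apply: ler_sum => i _; apply: fP.
have := aux _ nm_Re; have := aux _ nm_Im.
move=> /cvg_ex [b bP] /cvg_ex [a aP]; exists (a +i* b).
apply: tends_Re_Im.
  rewrite (_ : (fun _ => _) = series (fun n => complex.Re (u n))) //.
  by apply/funext => n; rewrite seriesEord raddf_sum.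
rewrite (_ : (fun _ => _) = series (fun n => complex.Im (u n))) //.
by apply/funext => n; rewrite seriesEord raddf_sum.
Qed.

(** Dominated convergence for series: the tails beyond [N0] are at most e / 4 uniformly in [K], and
    the finitely many terms before it converge one by one. *)
Lemma tannery (A : nat -> nat -> C) (a : nat -> C) (d : nat -> R) (L : nat -> C) l :
  (forall K n, nm (A K n) <= d n) -> (exists B, forall N, \sum_(i < N) d i <= B) ->
  (forall n, tends (fun K => A K n) (a n)) ->
  (forall K, tends (fun N => \sum_(i < N) A K i) (L K)) ->
  tends (fun N => \sum_(i < N) a i) l -> tends L l.
Proof.
move=> Ad dB Aa AL al e e0.
have d0 n : 0 <= d n by apply: le_trans (nm_ge0 _) (Ad 0%N n).
have ad n : nm (a n) <= d n by apply: tends_le_nm (Aa n).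
have e4 : 0 < e / 4 by lra.
have [N0 N0P] := bounded_tail d0 dB e4.
have tail (b : nat -> C) l' : (forall n, nm (b n) <= d n) ->
    tends (fun N => \sum_(i < N) b i) l' -> nm (l' - \sum_(i < N0) b i) <= e / 4.
  move=> bd bl.
  have := tendsD (tends_shift N0 bl) (tends_cst (- \sum_(i < N0) b i)).
  apply: tends_le_nm => n; rewrite addnC big_split_ord /= addrAC subrr add0r.
  apply: le_trans (nm_sum _ _ _) _.
  have := N0P N0 (N0 + n)%N (leqnn _) (leq_addr _ _).
  rewrite big_split_ord /= addrAC subrr add0r => /ltW; apply: le_trans.
  by apply: ler_sum => i _; apply: bd.
have [K KP] := (tends_sum (index_enum 'I_N0) (U := fun i K => A K i) (fun i => Aa i)) _ e4.
exists K => k Kk.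
have h1 := tail _ _ (Ad k) (AL k); have h2 := tail _ _ ad al.
have h3 := KP k Kk.
set x := \sum_(i < N0) A k i in h1 h3 *; set y := \sum_(i < N0) a i in h2 h3 *.
have -> : L k - l = (L k - x) + ((x - y) + (y - l)) by ring.
have := nmD (L k - x) ((x - y) + (y - l)); have := nmD (x - y) (y - l).
rewrite (nmB y l); lra.
Qed.

End ComplexSequences.

(** * Cauchy products and power series *)

Section Convolution.
Variable K : nzRingType.
Implicit Types a b : nat -> K.

Definition conv a b n : K := \sum_(i < n.+1) a i * b (n - i)%N.

Lemma sum_conv a b N :
  \sum_(n < N) conv a b n = \sum_(i < N) \sum_(j < N - i) a i * b j.
Proof.
rewrite /conv; transitivity (\sum_(n < N) \sum_(i < N | (i <= n)%N) a i * b (n - i)%N).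
  by apply: eq_bigr => n _; rewrite (big_ord_widen N (fun i => a i * b (n - i)%N)) //; apply: eq_bigl => i; rewrite ltnS.
rewrite (exchange_big_dep xpredT) //=; apply: eq_bigr => i _.
rewrite -(big_mkord (fun n => (i <= n)%N) (fun n => a i * b (n - i)%N)).
rewrite (@big_cat_nat _ _ _ i) //=; last exact: ltnW.
rewrite big_nat_cond big_pred0 ?add0r; last by move=> n; apply/negbTE; lia.
rewrite -{1}[nat_of_ord i]add0n big_addn.
rewrite -(big_mkord xpredT (fun j => a i * b j)) big_nat_cond [RHS]big_nat_cond.
by apply: congr_big => // n; rewrite ?leq_addl ?addnK ?andbT.
Qed.

End Convolution.

Definition psum (R : realType) (a : nat -> R[i]) (x : R[i]) N : R[i] := \sum_(i < N) a i * x ^+ i.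

(** Total evaluation, 0 if the partial sums diverge. Values are identified through [ev_unique],
    limits recovered through [evP]. *)
HB.lock Definition ev (R : realType) (a : nat -> R[i]) (x : R[i]) : R[i] :=
  xget 0 [set l | tends (psum a x) l].
Arguments ev {R} a x.

Section PowerSeries.
Variable R : realType.
Local Notation C := R[i].
Implicit Types (a b : nat -> C) (r s : R) (x y : C).

(** Absolute convergence at radius [r], stated by bounded partial sums so that no limit has to be
    named. *)
Definition sm a r := exists B, forall N, \sum_(i < N) nm (a i) * r ^+ i <= B.

Lemma ev_unique a x l : tends (psum a x) l -> ev a x = l.
Proof.
by move=> h; rewrite ev.unlock; case: xgetP => [y _ /= yP|/(_ l)//]; apply: tends_unique yP h.
Qed.

Lemma sm_le a r s : 0 <= r <= s -> sm a s -> sm a r.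
Proof.
move=> /andP[r0 rs] [B BP]; exists B => N; apply: le_trans (BP N).
by apply: ler_sum => i _; rewrite ler_wpM2l ?nm_ge0 // lerXn2r // nnegrE (le_trans r0).
Qed.

Lemma sm_dom a b r : 0 <= r -> (forall n, nm (b n) <= nm (a n)) -> sm a r -> sm b r.
Proof.
move=> r0 ab [B BP]; exists B => N; apply: le_trans (BP N).
by apply: ler_sum => i _; rewrite ler_wpM2r // exprn_ge0.
Qed.

Lemma evP a x : sm a (nm x) -> tends (psum a x) (ev a x).
Proof.
move=> [B BP].
have [|l lP] := @abs_summable_tends _ (fun i => a i * x ^+ i).
  by exists B => N; under eq_bigr do rewrite nmM nmX; apply: BP.
by rewrite (ev_unique lP).
Qed.

Lemma sm_geom a r s : 0 <= r < s -> (exists B, forall n, nm (a n) * s ^+ n <= B) -> sm a r.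
Proof.
move=> /andP[r0 rs] [B BP].
have s0 : 0 < s by apply: le_lt_trans rs.
have t0 : 0 <= r / s by rewrite divr_ge0 // ltW.
have t1 : r / s < 1 by rewrite ltr_pdivrMr // mul1r.
have B0 : 0 <= B by apply: le_trans (BP 0%N); rewrite mulr_ge0 ?nm_ge0 ?exprn_ge0 // ltW.
exists (B / (1 - r / s)) => N.
have h : \sum_(i < N) (r / s) ^+ i <= (1 - r / s)^-1.
  have := subrX1 (r / s) N; have := exprn_ge0 N t0.
  move: (_ ^+ N) (\sum_(i < N) _) => w S w0 e.
  rewrite -[leRHS]div1r ler_pdivlMr ?subr_gt0 //; lra.
apply: le_trans (ler_wpM2l B0 h); rewrite mulr_sumr.
apply: ler_sum => i _; rewrite expr_div_n mulrA ler_pdivlMr ?exprn_gt0 //.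
by rewrite mulrAC ler_wpM2r // exprn_ge0.
Qed.

Lemma sm_bound a r : 0 <= r -> sm a r -> exists B, forall n, nm (a n) * r ^+ n <= B.
Proof.
move=> r0 [B BP]; exists B => n; apply: le_trans (BP n.+1).
by rewrite big_ord_recr /= lerDr sumr_ge0 // => i _; rewrite mulr_ge0 ?nm_ge0 ?exprn_ge0.
Qed.

(** For r < t < s the number n (t/s)^n is at most the sum of (t/s)^i over i < n, hence bounded; so n
    |a_n| t^n is bounded, and [sm_geom] concludes. *)
Lemma sm_deriv a r s : 0 <= r < s -> sm a s -> sm (fun n => n%:R * a n) r.
Proof.
move=> /andP[r0 rs] sa.
have [t rt ts] : exists2 t, r < t & t < s by exists ((r + s) / 2); lra.
have s0 : 0 < s by lra. have t0 : 0 < t by lra.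
have [B BP] := sm_bound (ltW s0) sa.
have B0 : 0 <= B by apply: le_trans (BP 0%N); rewrite mulr_ge0 ?nm_ge0 ?exprn_ge0 // ltW.
apply: (@sm_geom _ r t); first by rewrite r0.
exists (B / (1 - t / s)) => n; rewrite nmM nm_nat.
have u0 : 0 <= t / s by rewrite divr_ge0 // ltW.
have u1 : t / s < 1 by rewrite ltr_pdivrMr // mul1r.
have h : n%:R * (t / s) ^+ n <= (1 - t / s)^-1.
  have := subrX1 (t / s) n; have := exprn_ge0 n u0.
  have : n%:R * (t / s) ^+ n <= \sum_(i < n) (t / s) ^+ i.
    rewrite -[n in n%:R]card_ord -sumr_const mulr_suml ler_sum // => i _.
    by rewrite mul1r ler_wiXn2l ?(ltW u1) // ltnW.
  move: (_ ^+ n) (\sum_(i < n) _) => w S h w0 e.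
  apply: (le_trans h); rewrite -[leRHS]div1r ler_pdivlMr ?subr_gt0 //; lra.
apply: le_trans (ler_wpM2l B0 h).
have h' : nm (a n) <= B / s ^+ n by rewrite ler_pdivlMr ?exprn_gt0.
have := ler_wpM2l (mulr_ge0 (ler0n R n) (exprn_ge0 n (ltW t0))) h'.
rewrite expr_div_n; lra.
Qed.

Lemma sm_conv a b r : 0 <= r -> sm a r -> sm b r -> sm (conv a b) r.
Proof.
move=> r0 [A AP] [B BP]; exists (A * B) => N.
pose na i := nm (a i) * r ^+ i; pose nb i := nm (b i) * r ^+ i.
have na0 i : 0 <= na i by rewrite mulr_ge0 ?nm_ge0 ?exprn_ge0.
have nb0 i : 0 <= nb i by rewrite mulr_ge0 ?nm_ge0 ?exprn_ge0.
have A0 : 0 <= A by apply: le_trans (AP 0%N); rewrite big_ord0.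
apply: (@le_trans _ _ (\sum_(n < N) conv na nb n)).
  apply: ler_sum => n _; rewrite /conv.
  apply: le_trans (ler_wpM2r (exprn_ge0 _ r0) (nm_sum _ _ _)) _.
  rewrite mulr_suml ler_sum // => i _; rewrite nmM /na /nb mulrACA -exprD subnKC //.
  by rewrite -ltnS.
rewrite sum_conv; apply: (@le_trans _ _ (\sum_(i < N) na i * B)).
  by apply: ler_sum => i _; rewrite -mulr_sumr ler_wpM2l.
rewrite -mulr_suml ler_wpM2r ?AP //; apply: le_trans (BP 0%N); by rewrite big_ord0.
Qed.

(** The product of the partial sums minus the partial sum of the Cauchy product runs over i, j < N
    with i + j >= N. It is dominated by the same difference for the moduli, which is at most the
    portion of [conv nf ng] between N and 2N. *)
Lemma tends_conv (f g : nat -> C) l l' :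
  (exists B, forall N, \sum_(i < N) nm (f i) <= B) ->
  (exists B, forall N, \sum_(i < N) nm (g i) <= B) ->
  tends (fun N => \sum_(i < N) f i) l -> tends (fun N => \sum_(i < N) g i) l' ->
  tends (fun N => \sum_(i < N) conv f g i) (l * l').
Proof.
move=> [A AP] [B BP] fl gl.
pose nf i := nm (f i); pose ng i := nm (g i).
have nf0 i : 0 <= nf i by apply: nm_ge0.
have ng0 i : 0 <= ng i by apply: nm_ge0.
have A0 : 0 <= A by apply: le_trans (AP 0%N); rewrite big_ord0.
have c0 n : 0 <= conv nf ng n by apply: sumr_ge0 => i _; apply: mulr_ge0.
have cB : exists D, forall N, \sum_(i < N) conv nf ng i <= D.
  exists (A * B) => N; rewrite sum_conv.
  apply: (@le_trans _ _ (\sum_(i < N) nf i * B)).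
    by apply: ler_sum => i _; rewrite -mulr_sumr ler_wpM2l.
  rewrite -mulr_suml ler_wpM2r ?AP //; apply: le_trans (BP 0%N); by rewrite big_ord0.
have split_sum (T : nzRingType) (u v : nat -> T) N :
    (\sum_(i < N) u i) * (\sum_(i < N) v i) - \sum_(i < N) conv u v i =
    \sum_(i < N) \sum_(j < i) u i * v (N - i + j)%N.
  rewrite sum_conv mulr_suml -sumrB; apply: eq_bigr => i _.
  have -> : (\sum_(j < N) v j) = \sum_(j < N - i + i) v j by rewrite subnK // ltnW.
  by rewrite big_split_ord /= mulrDr -!mulr_sumr addrAC subrr add0r.
have small : tends0 (fun N => (\sum_(i < N) nf i) * (\sum_(i < N) ng i)
                             - \sum_(i < N) conv nf ng i).
  move=> e e0; have [N NP] := bounded_tail c0 cB e0; exists N => n Nn.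
  have := NP n (n + n)%N Nn (leq_addr _ _); apply: le_lt_trans.
  rewrite lerD2r sum_conv mulr_suml big_split_ord /= -[leLHS]addr0 lerD //.
    apply: ler_sum => i _; rewrite -mulr_sumr ler_wpM2l //.
    have -> : (n + n - i = n + (n - i))%N by have := ltn_ord i; lia.
    by rewrite big_split_ord lerDl sumr_ge0.
  by apply: sumr_ge0 => i _; apply: sumr_ge0 => j _; apply: mulr_ge0.
have diff : tends (fun N => \sum_(i < N) conv f g i
    - (\sum_(i < N) f i) * (\sum_(i < N) g i)) 0.
  apply: tends0_le small => N; rewrite subr0 nmB !split_sum.
  apply: le_trans (nm_sum _ _ _) _; apply: ler_sum => i _.
  apply: le_trans (nm_sum _ _ _) _; apply: ler_sum => j _; by rewrite nmM.
have := tendsD diff (tendsM fl gl); rewrite add0r; apply: tends_ext => N.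
by rewrite subrK.
Qed.

Lemma ev_conv a b x : sm a (nm x) -> sm b (nm x) -> ev (conv a b) x = ev a x * ev b x.
Proof.
move=> sa sb; apply: ev_unique.
have hs c : sm c (nm x) -> exists B, forall N, \sum_(i < N) nm (c i * x ^+ i) <= B.
  by case=> B BP; exists B => N; under eq_bigr do rewrite nmM nmX; apply: BP.
have h := @tends_conv (fun i => a i * x ^+ i) (fun i => b i * x ^+ i) _ _ (hs _ sa) (hs _ sb) (evP sa) (evP sb).
apply: (tends_ext _ h) => N; apply: eq_bigr => n _; rewrite /conv mulr_suml.
apply: eq_bigr => i _; rewrite mulrACA -exprD subnKC // -ltnS //.
Qed.

Lemma ev_scale a c x : sm a (nm x) -> ev (fun n => c * a n) x = c * ev a x.
Proof.
move=> /evP h; apply: ev_unique; apply: tends_ext (tendsMl c h) => N.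
by rewrite /psum mulr_sumr; apply: eq_bigr => i _; rewrite mulrA.
Qed.

Lemma ev_add a b x : sm a (nm x) -> sm b (nm x) -> ev (fun n => a n + b n) x = ev a x + ev b x.
Proof.
move=> /evP ha /evP hb; apply: ev_unique; apply: tends_ext (tendsD ha hb) => N.
by rewrite /psum -big_split /=; apply: eq_bigr => i _; rewrite mulrDl.
Qed.

Lemma sm_add a b r : 0 <= r -> sm a r -> sm b r -> sm (fun n => a n + b n) r.
Proof.
move=> r0 [A AP] [B BP]; exists (A + B) => N; apply: le_trans (lerD (AP N) (BP N)).
rewrite -big_split /=; apply: ler_sum => i _; rewrite -mulrDl ler_wpM2r ?nmD ?exprn_ge0 //.
Qed.

Lemma sm_scale a c r : sm a r -> sm (fun n => c * a n) r.
Proof.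
move=> [A AP]; exists (nm c * A) => N; apply: le_trans (ler_wpM2l (nm_ge0 c) (AP N)).
by rewrite mulr_sumr ler_sum // => i _; rewrite nmM mulrA.
Qed.

Lemma ev0 a : ev a 0 = a 0%N.
Proof.
apply: ev_unique => e e0; exists 1%N => [[|N]] // _.
rewrite /psum big_ord_recl expr0 mulr1 big1 ?addr0 ?subrr ?nm0 // => i _.
by rewrite expr0n mulr0.
Qed.

Lemma ev_nm_le a x r B : nm x <= r -> (forall N, \sum_(i < N) nm (a i) * r ^+ i <= B) ->
  nm (ev a x) <= B.
Proof.
move=> xr BP.
have r0 : 0 <= r by apply: le_trans xr; apply: nm_ge0.
have sa : sm a (nm x) by apply: (@sm_le _ _ r); rewrite ?nm_ge0 //; exists B.
apply: tends_le_nm (evP sa) => N; apply: le_trans (BP N); apply: le_trans (nm_sum _ _ _) _.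
apply: ler_sum => i _; rewrite nmM nmX ler_wpM2l ?nm_ge0 //.
by rewrite lerXn2r // nnegrE ?nm_ge0.
Qed.

Lemma ev_shift a x k : sm a (nm x) -> sm (fun n => a (n + k)%N) (nm x) ->
  ev a x = psum a x k + x ^+ k * ev (fun n => a (n + k)%N) x.
Proof.
move=> sa sk; apply: (tends_unique (tends_shift k (evP sa))).
apply: tends_ext (tendsD (tends_cst _) (tendsMl (x ^+ k) (evP sk))) => N.
rewrite /psum addnC big_split_ord /=; congr (_ + _).
rewrite mulr_sumr; apply: eq_bigr => i _; rewrite exprD mulrCA addnC //.
Qed.

Lemma sm_shift a r k : 0 < r -> sm a r -> sm (fun n => a (n + k)%N) r.
Proof.
move=> r0 [A AP]; exists (A / r ^+ k) => N.
rewrite ler_pdivlMr ?exprn_gt0 //; apply: le_trans (AP (k + N)%N).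
rewrite big_split_ord /= mulr_suml -[leLHS]add0r lerD //.
  by apply: sumr_ge0 => i _; rewrite mulr_ge0 ?nm_ge0 ?exprn_ge0 ?ltW.
by apply: ler_sum => i _; rewrite -mulrA -exprD [(i + k)%N]addnC.
Qed.

(** Two applications of [sm_deriv], through the intermediate radius [t], make n^2 |a_n| r^n
    summable; this bounds the sum of the quadratic remainders of the monomials uniformly in [y]. *)
Lemma ev_taylor1 a x r s : nm x <= r -> 0 < r < s -> sm a s ->
  exists D B, forall y, nm y <= r -> nm (ev a y - ev a x - (y - x) * D) <= B * nm (y - x) ^+ 2.
Proof.
move=> xr /andP[r0 rs] sa.
have [t rt ts] : exists2 t, r < t & t < s by exists ((r + s) / 2); lra.
have s1 : sm (fun n => n%:R * a n) t by apply: (@sm_deriv _ t s); rewrite // ts andbT; lra.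
have s2 : sm (fun n => n%:R * (n%:R * a n)) r by apply: (@sm_deriv _ r t); rewrite // rt andbT; lra.
have sr : sm a r by apply: (@sm_le _ _ s) => //; lra.
have [B BP] := s2.
(* The factor [r ^+ 2] on the left replaces the exponent n - 2 of the usual bound n^2 r^(n-2), which
   would need cases for small n. *)
have key y n : nm y <= r ->
    r ^+ 2 * nm (y ^+ n - x ^+ n - (y - x) * (n%:R * x ^+ n.-1)) <= nm (y - x) ^+ 2 * (n%:R ^+ 2 * r ^+ n).
  move=> yr; elim: n => [|n IH]; first by rewrite mul0r !mulr0 subrr subr0 nm0 mulr0 expr0n mul0r mulr0.
  have -> : y ^+ n.+1 - x ^+ n.+1 - (y - x) * (n.+1%:R * x ^+ n.+1.-1) =
     y * (y ^+ n - x ^+ n - (y - x) * (n%:R * x ^+ n.-1)) + (y - x) ^+ 2 * (n%:R * x ^+ n.-1).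
    case: n {IH} => [|n] /=; first by rewrite !expr0; ring.
    rewrite !exprS -!natr1; ring.
  apply: le_trans (ler_wpM2l _ (nmD _ _)) _; first by rewrite exprn_ge0 // ltW.
  have -> : nm ((y - x) ^+ 2 * (n%:R * x ^+ n.-1)) = nm (y - x) ^+ 2 * (n%:R * nm (x ^+ n.-1)).
    by rewrite nmM nmX nmM nm_nat.
  rewrite nmM.
  have h1 : nm (x ^+ n.-1) * r ^+ 2 * n%:R <= r ^+ n.+1 * n%:R.
    case: n {IH} => [|n]; first by rewrite !mulr0.
    have -> : r ^+ n.+2 = r ^+ n * r ^+ 2 by rewrite -exprD addn2.
    rewrite ler_wpM2r // nmX /= ler_wpM2r ?exprn_ge0 ?(ltW r0) //.
    by rewrite lerXn2r // nnegrE ?nm_ge0 // ltW.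
  have h2 : 0 <= nm (y - x) ^+ 2 by rewrite exprn_ge0 // nm_ge0.
  have h3 : 0 <= r ^+ n.+1 by rewrite exprn_ge0 // ltW.
  have h4 := ler_wpM2l h2 h1.
  have h5 : nm y * (r ^+ 2 * nm (y ^+ n - x ^+ n - (y - x) * (n%:R * x ^+ n.-1))) <=
     r * (nm (y - x) ^+ 2 * (n%:R ^+ 2 * r ^+ n)).
    by apply: ler_pM => //; rewrite ?nm_ge0 // mulr_ge0 ?nm_ge0 // exprn_ge0 // ltW.
  have h6 : (n%:R : R) ^+ 2 + n%:R <= n.+1%:R ^+ 2.
    by rewrite -natr1; have : 0 <= n%:R :> R := ler0n _ _; nra.
  have h7 := ler_wpM2l h2 (ler_wpM2r h3 h6).
  have e : r ^+ n.+1 = r * r ^+ n by rewrite exprS.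
  rewrite e in h4 h7 *; move: h4 h5 h7.
  move: (nm (y ^+ n - _ - _)) (nm (x ^+ _)) (nm y) (nm (y - x) ^+ 2) (n.+1%:R ^+ 2) (n%:R) (r ^+ n) (r ^+ 2).
  by move=> A X Y D N2 n' rn rr ? ? ?; lra.
exists (ev (fun n => n.+1%:R * a n.+1) x), (B / r ^+ 2) => y yr.
have r2 : 0 < r ^+ 2 by rewrite exprn_gt0.
rewrite mulrAC ler_pdivlMr // mulrC.
have sy z : nm z <= r -> sm a (nm z) by move=> zr; apply: sm_le sr; rewrite nm_ge0.
have sd : sm (fun n => n.+1%:R * a n.+1) (nm x).
  apply: (@sm_le _ _ r); first by rewrite nm_ge0.
  have := sm_shift 1 r0 (sm_le _ s1); rewrite (ltW r0) (ltW rt) => /(_ isT).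
  by apply: sm_dom; rewrite ?(ltW r0) // => n; rewrite addn1.
have T := tendsD (tendsD (tends_shift 1 (evP (sy y yr))) (tendsMl (-1) (tends_shift 1 (evP (sy x xr)))))
   (tendsMl (- (y - x)) (evP sd)).
have -> : r ^+ 2 * nm (ev a y - ev a x - (y - x) * ev (fun n => n.+1%:R * a n.+1) x) =
  nm ((r%:C) ^+ 2 * (ev a y + -1 * ev a x + - (y - x) * ev (fun n => n.+1%:R * a n.+1) x)).
  by rewrite nmM nmX nmR ger0_norm ?(ltW r0) // mulN1r mulNr.
apply: (tends_le_nm _ (tendsMl (r%:C ^+ 2) T)) => N.
rewrite addn1 (_ : _ + _ = \sum_(i < N.+1) a i * (y ^+ i - x ^+ i - (y - x) * (i%:R * x ^+ i.-1))); last first.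
  have -> : psum (fun n => n.+1%:R * a n.+1) x N = \sum_(i < N.+1) i%:R * a i * x ^+ i.-1.
    by rewrite big_ord_recl !mul0r add0r; apply: eq_bigr.
  rewrite /psum !mulr_sumr -!big_split /=; apply: eq_bigr => i _; ring.
rewrite nmM nmX nmR ger0_norm ?(ltW r0) //.
apply: le_trans (ler_wpM2l (ltW r2) (nm_sum _ _ _)) _.
apply: le_trans (ler_wpM2r _ (BP N.+1)); last by rewrite exprn_ge0 // nm_ge0.
rewrite mulr_sumr mulr_suml; apply: ler_sum => i _; rewrite !nmM !nm_nat mulrCA.
apply: le_trans (ler_wpM2l (nm_ge0 _) (key y i yr)) _.
rewrite le_eqVlt; apply/orP; left; apply/eqP; ring.
Qed.

End PowerSeries.

(** * The complex exponential *)

Section Exponential.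
Variable R : realType.
Local Notation C := R[i].
Implicit Types (x y z w : C).

Lemma cexpD z w : cexp (z + w) = cexp z * cexp w.
Proof.
case: z w => [a b] [c d]; rewrite /cexp /= expRD cosD sinD; simpc.
by apply/eqP; rewrite eq_complex /=; apply/andP; split; apply/eqP; ring.
Qed.

Lemma cexp0 : cexp 0 = 1 :> C.
Proof. by rewrite /cexp /= expR0 cos0 sin0 !mul1r. Qed.

Lemma nm_cexp z : nm (cexp z) = expR (complex.Re z).
Proof.
rewrite /nm /cexp /= !exprMn -mulrDr cos2Dsin2 mulr1 sqrtr_sqr ger0_norm //.
exact: expR_ge0.
Qed.

Lemma cexp_neq0 z : cexp z != 0.
Proof. by rewrite -nm_gt0 nm_cexp expR_gt0. Qed.

Lemma cexpMn z n : cexp (n%:R * z) = cexp z ^+ n.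
Proof.
elim: n => [|n IH]; first by rewrite mul0r cexp0.
by rewrite -natr1 mulrDl mul1r cexpD IH exprSr.
Qed.

Definition expc (n : nat) : C := (n`!%:R)^-1.

Lemma sum_exp_le (r : R) N : 0 <= r -> \sum_(i < N) r ^+ i / i`!%:R <= expR r.
Proof.
move=> r0; have := @is_cvg_series_exp_coeff R r.
move/(nondecreasing_cvgn_le (u_ := series (exp_coeff r))) => h.
have -> : \sum_(i < N) r ^+ i / i`!%:R = series (exp_coeff r) N by rewrite seriesEord.
rewrite /expR; apply: h; apply: nondecreasing_series => n _ _.
exact: exp_coeff_ge0.
Qed.

Lemma exp_term_le (r : R) n : 0 <= r -> r ^+ n / n`!%:R <= expR r.
Proof.
move=> r0; apply: le_trans (sum_exp_le n.+1 r0); rewrite big_ord_recr /= lerDr.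
by apply: sumr_ge0 => i _; rewrite divr_ge0 // exprn_ge0.
Qed.

Lemma sm_expc r : 0 <= r -> sm expc r.
Proof.
move=> r0; exists (expR r) => N; apply: le_trans (sum_exp_le N r0).
by apply: ler_sum => i _; rewrite /expc nmV nm_nat mulrC.
Qed.

(** As [cexp] is built from the real exponential, cosine and sine, its series is identified on the
    real and on the imaginary axis; the addition formula of the series joins the two. *)
Lemma ev_expc z : ev expc z = cexp z.
Proof.
have evR (r : R) : ev expc r%:C = (expR r)%:C.
  apply: ev_unique; rewrite [X in tends _ X](_ : _ = expR r +i* 0) //.
  apply: tends_Re_Im.
    rewrite (_ : (fun _ => _) = series (exp_coeff r)); first exact: is_cvg_series_exp_coeff.
    apply/funext => n; rewrite seriesEord raddf_sum /=; apply: eq_bigr => i _.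
    by rewrite /expc -(rmorph_nat (real_complex R)) -fmorphV -rmorphXn -rmorphM /= mulrC.
  rewrite (_ : (fun _ => _) = fun=> 0); first exact: cvg_cst.
  apply/funext => n; rewrite raddf_sum /= big1 // => i _.
  by rewrite /expc -(rmorph_nat (real_complex R)) -fmorphV -rmorphXn -rmorphM.
have evI (r : R) : ev expc (0 +i* r) = cos r +i* sin r.
  have s0 := sm_expc (nm_ge0 (0 +i* r)).
  (* Only partial sums of even length are used: 2n terms at an imaginary point are n terms of the
     cosine and n terms of the sine. *)
  have sP N : exists K, forall n, (K <= n)%N -> (N <= n.*2)%N by exists N => n; lia.
  apply: (tends_unique (tends_sub sP (evP s0))).
  have i2 (i : nat) : (0 +i* r : C) ^+ i.*2 = ((-1) ^+ i * r ^+ i.*2)%:C.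
    rewrite -muln2 mulnC !exprM -exprMn rmorphXn; congr (_ ^+ _).
    by apply/eqP; rewrite eq_complex /= !mul0r !mulr0 sub0r addr0 mulN1r !eqxx.
  have E n : (psum expc (0 +i* r) \o double) n =
     (\sum_(i < n) cos_coeff' r i) +i* (\sum_(i < n) sin_coeff' r i).
    rewrite /=; elim: n => [|n IH]; first by rewrite /psum !big_ord0.
    rewrite doubleS /psum !big_ord_recr /= -/(psum _ _ _) IH i2 exprSr i2.
    rewrite /expc -!(rmorph_nat (real_complex R)) -!fmorphV /cos_coeff' /sin_coeff' /=.
    rewrite -!exprnP; simpc; apply/eqP; rewrite eq_complex /= !exprS.
    by apply/andP; split; apply/eqP; ring.
  apply: (tends_ext (fun n => esym (E n))); apply: tends_Re_Im => /=.
    rewrite (_ : (fun _ => _) = series (cos_coeff' r)); first exact: cvg_cos_coeff'.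
    by apply/funext => n; rewrite seriesEord.
  rewrite (_ : (fun _ => _) = series (sin_coeff' r)); first exact: cvg_sin_coeff'.
  by apply/funext => n; rewrite seriesEord.
(* binomial theorem: exp(x+y) as a Cauchy product *)
have evD x y : ev expc (x + y) = ev expc x * ev expc y.
  have t c : tends (fun N => \sum_(i < N) (expc i * c ^+ i)) (ev expc c).
    exact: evP (sm_expc (nm_ge0 c)).
  have b c : exists B, forall N, \sum_(i < N) nm (expc i * c ^+ i) <= B.
    have [B BP] := sm_expc (nm_ge0 c).
    by exists B => N; under eq_bigr do rewrite nmM nmX; apply: BP.
  apply: ev_unique; apply: tends_ext (@tends_conv _ (fun i => expc i * x ^+ i) (fun i => expc i * y ^+ i) _ _ (b x) (b y) (t x) (t y)) => N.
  apply: eq_bigr => n _; rewrite /conv exprDn mulr_sumr.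
  rewrite (reindex_inj rev_ord_inj) /=; apply: eq_bigr => i _.
  have ni : (i <= n)%N by rewrite -ltnS.
  rewrite subSS subKn // -[X in _ = _ * X]mulr_natr.
  have h : ('C(n, i)%:R : C) * (i`!%:R * (n - i)`!%:R) = n`!%:R.
    by rewrite -!natrM bin_fact.
  have f0 k : (k`!%:R : C) != 0 by rewrite pnatr_eq0 -lt0n fact_gt0.
  have b0 : ('C(n, i)%:R : C) != 0 by rewrite pnatr_eq0 -lt0n bin_gt0.
  by rewrite /expc -h; field; rewrite ?f0 ?b0 ?andbT.
have -> : z = (complex.Re z)%:C + (0 +i* complex.Im z) by case: z => a b; simpc.
rewrite evD evR evI /cexp /=; simpc; rewrite ?expR0; simpc.
by case: z => a b /=; simpc.
Qed.

End Exponential.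

HB.lock Definition ex (R : realType) (z : R[i]) : R[i] := cexp ((pi *+ 2)%:C * 'i * z).
Arguments ex {R} z.

Section ExponentialTwoPi.
Variable R : realType.
Local Notation C := R[i].
Implicit Types (x y z w : C).

Lemma exD z w : ex (z + w) = ex z * ex w.
Proof. by rewrite ex.unlock mulrDr cexpD. Qed.
Lemma ex0 : ex 0 = 1 :> C. Proof. by rewrite ex.unlock mulr0 cexp0. Qed.
Lemma ex_neq0 z : ex z != 0. Proof. by rewrite ex.unlock cexp_neq0. Qed.
Lemma exN z : ex (- z) = (ex z)^-1.
Proof. by apply: (mulfI (ex_neq0 z)); rewrite -exD subrr ex0 divff ?ex_neq0. Qed.
Lemma exMn z n : ex (n%:R * z) = ex z ^+ n.
Proof. by rewrite ex.unlock mulrCA cexpMn. Qed.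
Lemma ex1 : ex 1 = 1 :> C.
Proof. by rewrite ex.unlock mulr1; simpc; rewrite /cexp /= expR0 cos2pi sin2pi !mul1r. Qed.
Lemma ex_int (n : int) : ex n%:~R = 1 :> C.
Proof.
have hn (k : nat) : ex k%:R = 1 :> C by rewrite -[_%:R]mulr1 exMn ex1 expr1n.
by case: n => n; rewrite ?NegzE ?mulrNz ?exN hn ?invr1.
Qed.
Lemma exDz z (n : int) : ex (z + n%:~R) = ex z.
Proof. by rewrite exD ex_int mulr1. Qed.
Lemma ex_half : ex (1 / 2) = -1 :> C.
Proof.
rewrite ex.unlock (_ : _ * _ = 0 +i* pi); first by rewrite /cexp /= expR0 cospi sinpi mulr0 mul1r; apply/eqP; rewrite eq_complex /= oppr0 !eqxx.
have -> : (1 / 2 : C) = (1 / 2 : R)%:C by rewrite fmorph_div /= rmorph1 rmorph_nat.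
by apply/eqP; rewrite eq_complex /=; apply/andP; split; apply/eqP; rewrite mulr2n; field.
Qed.

Lemma nm_ex z : nm (ex z) = expR (- (pi *+ 2 * complex.Im z)).
Proof. by case: z => a b; rewrite ex.unlock nm_cexp; congr (expR _); simpc. Qed.
Lemma nm_ex_lt1 z : (nm (ex z) < 1) = (0 < complex.Im z).
Proof.
by rewrite nm_ex expR_lt1 oppr_lt0 pmulr_rgt0 // mulrn_wgt0 // pi_gt0.
Qed.

(** The modulus forces z to be real, and an integer translation brings it to 0 <= y < 1. Then cos(2
    pi y) = 1 gives sin(pi y) = 0, impossible for 0 < y < 1. *)
Lemma ex_eq1 z : ex z = 1 -> exists n : int, z = n%:~R.
Proof.
case: z => a b h.
have b0 : b = 0.
  have : nm (ex (a +i* b)) = 1 by rewrite h nm1.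
  rewrite nm_ex /= -(@expR0 R) => /expR_inj /eqP.
  by rewrite oppr_eq0 mulf_eq0 mulrn_eq0 /= (gt_eqF (pi_gt0 R)) => /eqP.
subst b.
have [n [y [ay y1]]] : exists (n : int) (y : R), a = y + n%:~R /\ 0 <= y < 1.
  exists (Num.floor a), (a - (Num.floor a)%:~R); rewrite subrK; split=> //.
  by have /andP[] := floor_itv a; rewrite intrD; lra.
subst a.
have E : (y + n%:~R)%:C = y%:C + n%:~R :> C by rewrite rmorphD /= rmorph_int.
exists n; rewrite [LHS]E; suff -> : y = 0 by rewrite add0r.
have {}h : ex y%:C = 1 by move: h; rewrite [X in ex X]E exDz.
have hc : cos (pi * y + pi * y) = 1.
  have := congr1 (@complex.Re R) h; rewrite ex.unlock /cexp; simpc.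
  by rewrite /= expR0 mul1r mulr2n mulrDl.
rewrite cosD in hc; have := cos2Dsin2 (pi * y); rewrite -!expr2 in hc => hs.
have s0 : sin (pi * y) = 0 by apply/eqP; rewrite -sqrf_eq0; apply/eqP; lra.
case/andP: y1 => y0 y1; apply/eqP/contraT => yn.
have yp : 0 < y by rewrite lt_def yn.
have := @sin_gt0_pi R (pi * y); rewrite s0 ltxx mulr_gt0 ?pi_gt0 //=.
by rewrite gtr_pMr ?pi_gt0 // y1 => /(_ isT).
Qed.

Lemma nomeE h z : nome h z = ex (z / h%:R).
Proof. by rewrite /nome ex.unlock mulrA. Qed.

End ExponentialTwoPi.

(** * Substitution into power series, entire functions, differentiability *)

Section Substitution.
Variable R : realType.
Local Notation C := R[i].

(** The coefficients of a(X^k). *)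
Definition stretch (K : nzRingType) k (a : nat -> K) n : K := if (k %| n)%N then a (n %/ k)%N else 0.

Lemma sum_stretch (K : nzRingType) k (a : nat -> K) (F : nat -> K) N : (0 < k)%N ->
  \sum_(i < k * N) stretch k a i * F i = \sum_(i < N) a i * F (k * i)%N.
Proof.
move=> k0; elim: N => [|N IH]; first by rewrite muln0 !big_ord0.
rewrite mulnS addnC big_split_ord /= IH big_ord_recr /=; congr (_ + _).
case: k k0 {IH} => // k _; rewrite big_ord_recl /= big1 => [|i _].
  by rewrite addr0 addn0 /stretch dvdn_mulr // mulKn.
by rewrite /stretch dvdn_addr ?dvdn_mulr // gtnNdvd ?mul0r // /bump /= ltnS ltn_ord.
Qed.

Lemma sm_stretch k (a : nat -> C) r : (0 < k)%N -> 0 <= r -> sm a (r ^+ k) -> sm (stretch k a) r.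
Proof.
move=> k0 r0 [B BP]; exists B => N; apply: le_trans (BP N).
have le1 : (N <= k * N)%N by rewrite leq_pmull.
apply: (@le_trans _ _ (\sum_(i < k * N) nm (stretch k a i) * r ^+ i)).
  rewrite -(subnKC le1) big_split_ord /= lerDl sumr_ge0 // => i _.
  by rewrite mulr_ge0 ?nm_ge0 ?exprn_ge0.
have -> : \sum_(i < k * N) nm (stretch k a i) * r ^+ i =
    \sum_(i < k * N) stretch k (fun n => nm (a n)) i * r ^+ i.
  by apply: eq_bigr => i _; rewrite /stretch; case: ifP => // _; rewrite nm0.
by rewrite sum_stretch //; apply: ler_sum => i _; rewrite exprM.
Qed.

Lemma ev_stretch k (a : nat -> C) x : (0 < k)%N -> sm a (nm x ^+ k) -> ev (stretch k a) x = ev a (x ^+ k).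
Proof.
move=> k0 sa; have sx := sm_stretch k0 (nm_ge0 x) sa.
have sP N : exists K, forall n, (K <= n)%N -> (N <= k * n)%N.
  by exists N => n Nn; apply: (leq_trans Nn); rewrite leq_pmull.
apply: (tends_unique (tends_sub sP (evP sx))).
rewrite -nmX in sa; apply: tends_ext (evP sa) => N; rewrite /psum /= sum_stretch //.
by apply: eq_bigr => i _; rewrite exprM.
Qed.

(** The centre is a parameter: the uniqueness theorem needs expansions at every point, and proving
    them at each centre avoids a general theorem on re-centring power series. *)
Definition entire_at (f : C -> C) z0 := exists2 a : nat -> C,
  (forall r, 0 <= r -> sm a r) & forall u, f (z0 + u) = ev a u.

Lemma entireM f g z0 : entire_at f z0 -> entire_at g z0 -> entire_at (fun z => f z * g z) z0.
Proof.
move=> [a sa fa] [b sb gb]; exists (conv a b) => [r r0|u].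
  by apply: sm_conv; auto.
by rewrite fa gb ev_conv //; [apply: sa|apply: sb]; apply: nm_ge0.
Qed.

Lemma entireZ f c z0 : entire_at f z0 -> entire_at (fun z => c * f z) z0.
Proof.
move=> [a sa fa]; exists (fun n => c * a n) => [r r0|u]; first by apply: sm_scale; auto.
by rewrite fa ev_scale //; apply/sa/nm_ge0.
Qed.

Lemma entire_lin f c d z0 : entire_at f (c * z0 + d) -> entire_at (fun z => f (c * z + d)) z0.
Proof.
move=> [a sa fa].
have E u N : psum (fun n => a n * c ^+ n) u N = psum a (c * u) N.
  by apply: eq_bigr => i _; rewrite exprMn mulrA.
exists (fun n => a n * c ^+ n) => [r r0|u].
  have [B BP] := sa _ (mulr_ge0 (nm_ge0 c) r0); exists B => N; apply: le_trans (BP N).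
  by apply: ler_sum => i _; rewrite nmM nmX exprMn mulrA.
have -> : c * (z0 + u) + d = (c * z0 + d) + c * u by ring.
rewrite fa; apply/esym/ev_unique; apply: tends_ext (evP (sa _ (nm_ge0 (c * u)))) => N.
by rewrite E.
Qed.

Lemma entire_cexp z0 : entire_at (@cexp R) z0.
Proof.
exists (fun n => cexp z0 * expc R n) => [r r0|u]; first exact: sm_scale (sm_expc r0).
by rewrite ev_scale ?ev_expc ?cexpD //; apply/sm_expc/nm_ge0.
Qed.

(** The expansion at [z0] comes from the one at 0 by z^2 = (z - z0)^2 + 2 z0 z - z0^2. *)
Lemma entire_cexp_sqr c z0 : entire_at (fun z => cexp (c * z ^+ 2)) z0.
Proof.
have h : entire_at (fun z => cexp (c * (z ^+ 2))) 0.
  have [a sa fa] : entire_at (fun z => cexp (c * z + 0)) 0 by apply: entire_lin; apply: entire_cexp.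
  exists (stretch 2 a) => [r r0|u].
    by apply: sm_stretch => //; apply: sa; rewrite exprn_ge0.
  by rewrite ev_stretch // -?fa ?addr0 ?add0r //; apply: sa; rewrite exprn_ge0 // nm_ge0.
have h2 : entire_at (fun z => cexp (c * ((z - z0) ^+ 2))) z0.
  case: h => a sa fa; exists a => // u; rewrite -fa add0r addrC addKr //.
have h3 : entire_at (fun z => cexp (2 * c * z0 * z + - (c * z0 ^+ 2))) z0.
  by apply: entire_lin; apply: entire_cexp.
case: (entireM h2 h3) => a sa fa; exists a => // u; rewrite -fa -cexpD; congr cexp.
by ring.
Qed.

(* the double series is rearranged into powers of z - z0 *)
Lemma entire_comp_cexp (g : nat -> C) c z0 : (forall r, 0 <= r -> sm g r) ->
  entire_at (fun z => ev g (cexp (c * z))) z0.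
Proof.
move=> sg; set x0 := cexp (c * z0).
have sgj j r : 0 <= r -> sm (fun k => k%:R ^+ j * g k) r.
  elim: j r => [|j IH] r r0; first by apply: sm_dom (sg r r0) => // n; rewrite expr0 mul1r.
  have r1 : 0 <= r < r + 1 by rewrite r0 ltrDl ltr01.
  have := sm_deriv r1 (IH (r + 1) _); case/andP: r1 => _ /ltW /(le_trans r0) h /(_ h).
  by apply: sm_dom => // n; rewrite exprS mulrA.
(* The Taylor coefficients: differentiating g(e^(c z)) brings down a factor c k from each
   monomial. *)
pose b j := c ^+ j / j`!%:R * ev (fun k => k%:R ^+ j * g k) x0.
have term (t : R) : 0 <= t -> exists2 M, 0 <= M & forall j N,
    \sum_(k < N) nm (g k * x0 ^+ k) * ((k%:R * t) ^+ j / j`!%:R) <= M.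
  move=> t0; have [|M MP] := sg (nm x0 * expR t); first by rewrite mulr_ge0 ?nm_ge0 ?expR_ge0.
  exists M => [|j N]; first by apply: le_trans (MP 0%N); rewrite big_ord0.
  apply: le_trans (MP N); apply: ler_sum => k _; rewrite nmM nmX [in leRHS]exprMn -[leLHS]mulrA.
  apply: ler_wpM2l; rewrite ?nm_ge0 //; apply: ler_wpM2l; rewrite ?exprn_ge0 ?nm_ge0 //.
  have kt : 0 <= k%:R * t by rewrite mulr_ge0.
  by apply: le_trans (exp_term_le j kt) _; rewrite mulrC expRM_natr.
have bterm j u : tends (fun K => \sum_(k < K) g k * x0 ^+ k * ((k%:R * c * u) ^+ j / j`!%:R)) (b j * u ^+ j).
  have h := tendsMl (c ^+ j / j`!%:R * u ^+ j) (evP (sgj j _ (nm_ge0 x0))).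
  rewrite /b mulrAC; apply: (tends_ext _ h) => K; rewrite /psum mulr_sumr.
  by apply: eq_bigr => k _; rewrite !exprMn; ring.
have sb r : 0 <= r -> sm b r.
  move=> r0; have r1 : 0 <= r < r + 1 by rewrite r0 ltrDl ltr01.
  have r2 : 0 <= r + 1 by lra.
  apply: (sm_geom r1).
  have [M _ MP] := term _ (mulr_ge0 (nm_ge0 c) r2); exists M => j.
  have -> : nm (b j) * (r + 1) ^+ j = nm (b j * ((r + 1)%:C) ^+ j).
    by rewrite nmM nmX nmR ger0_norm.
  apply: (tends_le_nm _ (bterm j _)) => K; apply: le_trans (MP j K).
  apply: le_trans (nm_sum _ _ _) _; apply: ler_sum => k _.
  rewrite nmM; apply: ler_wpM2l; first exact: nm_ge0.
  by rewrite nmM nmV nm_nat nmX !nmM nm_nat nmR ger0_norm // mulrA.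
exists b; first exact: sb.
move=> u.
(* The bound is taken at 2 |u| instead of |u|; the spare factor 2^-j dominates the sum over j. *)
have [M M0 MP] := term (2 * nm c * nm u) (mulr_ge0 (mulr_ge0 (ler0n _ _) (nm_ge0 _)) (nm_ge0 _)).
have -> : cexp (c * (z0 + u)) = x0 * cexp (c * u) by rewrite -cexpD -mulrDr.
apply: ev_unique.
apply: (@tannery _ (fun K j => \sum_(k < K) g k * x0 ^+ k * ((k%:R * c * u) ^+ j / j`!%:R))
  (fun j => b j * u ^+ j) (fun j => M * (1 / 2) ^+ j)).
- move=> K j; apply: le_trans (nm_sum _ _ _) _.
  apply: le_trans (ler_wpM2r _ (MP j K)); last by rewrite exprn_ge0 // divr_ge0.
  rewrite mulr_suml; apply: ler_sum => k _.
  rewrite nmM -[leRHS]mulrA; apply: ler_wpM2l; first exact: nm_ge0.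
  rewrite nmM nmV nm_nat nmX !nmM nm_nat [leRHS]mulrAC -exprMn ler_wpM2r ?invr_ge0 //.
  rewrite le_eqVlt; apply/orP; left; apply/eqP; congr (_ ^+ _); by field.
- have [B BP] : sm (fun=> 1 : C) (1 / 2).
    by apply: (@sm_geom _ _ _ 1); [lra | exists 1 => n; rewrite nm1 expr1n mulr1].
  exists (M * B) => N; rewrite -mulr_sumr ler_wpM2l //; apply: le_trans (BP N).
  by apply: ler_sum => i _; rewrite nm1 [leRHS]mul1r.
- by move=> j; apply: bterm.
- move=> K.
  have h k : tends (fun N => g k * x0 ^+ k * psum (expc R) (k%:R * c * u) N)
      (g k * (x0 * cexp (c * u)) ^+ k).
    rewrite exprMn -(cexpMn (c * u)) !mulrA -(ev_expc (k%:R * c * u)).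
    apply: tendsMl; apply: evP.
    by apply/sm_expc/nm_ge0.
  apply: tends_ext (tends_sum (index_enum 'I_K) (fun k => h k)) => N.
  rewrite exchange_big /=; apply: eq_bigr => k _; rewrite mulr_sumr.
  by apply: eq_bigr => i _; rewrite /expc; congr (_ * _); rewrite mulrC.
exact: evP (sb _ (nm_ge0 u)).
Qed.

Lemma entire_ex c d z0 : entire_at (fun z => ex (c * z + d)) z0.
Proof.
rewrite ex.unlock; apply: (entire_lin (f := fun z => cexp ((pi *+ 2)%:C * 'i * z))); move: (c * z0 + d) => w.
have [a sa fa] := entire_lin (f := @cexp R) (c := (pi *+ 2)%:C * 'i) (d := 0) (entire_cexp _) (z0 := w).
by exists a; [exact: sa | move=> u; rewrite -fa addr0].
Qed.

Lemma entire_ex_sqr c z0 : entire_at (fun z => ex (c * z ^+ 2)) z0.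
Proof.
have [a sa fa] := entire_cexp_sqr ((pi *+ 2)%:C * 'i * c) z0.
by exists a; [exact: sa | move=> u; rewrite -fa ex.unlock [in LHS]mulrA].
Qed.

Definition exc c n : C := expc R n * ((pi *+ 2)%:C * 'i * c) ^+ n.

Lemma sm_exc c r : 0 <= r -> sm (exc c) r.
Proof.
move=> r0; pose w := (pi *+ 2)%:C * 'i * c; have [B BP] := sm_expc (mulr_ge0 (nm_ge0 w) r0).
exists B => N; apply: le_trans (BP N); apply: ler_sum => i _.
by rewrite /exc -/w nmM nmX exprMn mulrA.
Qed.

Lemma ev_exc c u : ev (exc c) u = ex (c * u).
Proof.
rewrite ex.unlock mulrA -ev_expc; apply: ev_unique.
apply: tends_ext (evP (sm_expc (nm_ge0 _))) => N.
by apply: eq_bigr => i _; rewrite exprMn mulrA.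
Qed.

Lemma entire_comp_ex (g : nat -> C) c d z0 : (forall r, 0 <= r -> sm g r) ->
  entire_at (fun z => ev g (ex (c * z + d))) z0.
Proof. by move=> sg; rewrite ex.unlock; apply: (entire_lin (f := fun w => ev g (cexp ((pi *+ 2)%:C * 'i * w)))); apply: entire_comp_cexp. Qed.

End Substitution.
Global Opaque nm.

Section Differentiability.
Variable R : realType.
Local Notation C := R[i].

(** A quadratic remainder in place of o(h): power series satisfy it, and it passes to compositions
    with explicit constants. *)
Definition taylor1 (f : C -> C) z := exists D B d, [/\ 0 <= B, 0 < d &
  forall h, nm h <= d -> nm (f (z + h) - f z - h * D) <= B * nm h ^+ 2].

Lemma taylor1_derivable f z : taylor1 f z -> derivable (f : R[i]^o -> R[i]^o) z 1.
Proof.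
move=> [D [B [d [B0 d0 fP]]]]; rewrite /derivable; apply/cvg_ex; exists D.
apply/cvgrPdist_lt => e; case: e => e e'; rewrite ltcE /= => /andP[/eqP -> e0].
have B1 : 0 < B + 1 by lra.
rewrite near_withinE; apply/nbhs_ballP; exists (Num.min d (e / (B + 1)))%:C => /=.
  by rewrite ltcE /= eqxx /= lt_min d0 divr_gt0.
move=> h; rewrite /ball /= sub0r normrN norm_nm ltcE => /andP[_ /= hd] h0.
rewrite norm_nm ltcE /= eqxx /=.
move: hd; rewrite lt_min => /andP[hd he].
have g := fP h (ltW hd).
rewrite nmB -[_ *: _]/(_ * _) -[h%:A]/(h * 1) mulr1 /=.
have -> : h^-1 * (f (h + z) - f z) - D = h^-1 * (f (z + h) - f z - h * D).
  by rewrite (addrC h z); field.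
rewrite nmM nmV mulrC.
have hp : 0 < nm h by rewrite nm_gt0.
rewrite ltr_pdivrMr //; apply: (le_lt_trans g).
move: he; rewrite ltr_pdivlMr // => he; nra.
Qed.

Lemma taylor1_lip (f : C -> C) (z D : C) (B d : R) : 0 <= B -> 0 < d ->
  (forall h, nm h <= d -> nm (f (z + h) - f z - h * D) <= B * nm h ^+ 2) ->
  forall h, nm h <= d -> nm (f (z + h) - f z) <= (nm D + B * d) * nm h.
Proof.
move=> B0 d0 fP h hd; have := fP h hd; have := nmBD (f (z + h) - f z) (h * D).
have hh : 0 <= B * (nm h * (d - nm h)) by rewrite !mulr_ge0 ?nm_ge0 ?subr_ge0.
by rewrite nmM expr2; lra.
Qed.

Lemma taylor1_comp f g z : taylor1 g z -> taylor1 f (g z) -> taylor1 (fun z => f (g z)) z.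
Proof.
move=> [D [B [d [B0 d0 gP]]]] [D' [B' [d' [B'0 d'0 fP]]]].
pose L := nm D + B * d.
have L0 : 0 <= L by rewrite addr_ge0 ?nm_ge0 // mulr_ge0 // ltW.
have gl := taylor1_lip B0 d0 gP.
exists (D * D'), (B' * L ^+ 2 + B * nm D'), (Num.min d (d' / (L + 1))); split.
- by rewrite addr_ge0 // mulr_ge0 ?nm_ge0 // exprn_ge0.
- by rewrite lt_min d0 divr_gt0 //; lra.
move=> h; rewrite le_min ler_pdivlMr; last lra.
move=> /andP[hd hd']; have h0 := nm_ge0 h.
have g1 := gl h hd; have g2 := gP h hd.
set k := g (z + h) - g z in g1 g2 *.
have kd : nm k <= d' by apply: (le_trans g1); rewrite -/L; nra.
have := fP k kd; have -> : g z + k = g (z + h) by rewrite /k addrC subrK.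
move=> f1.
have -> : f (g (z + h)) - f (g z) - h * (D * D') = (f (g (z + h)) - f (g z) - k * D') + (k - h * D) * D'.
  by ring.
apply: le_trans (nmD _ _) _; rewrite [nm ((k - _) * _)]nmM [leRHS]mulrDl; apply: lerD.
  apply: (le_trans f1); rewrite -mulrA ler_wpM2l // -exprMn lerXn2r // nnegrE ?nm_ge0 //.
  by rewrite mulr_ge0.
by rewrite mulrAC ler_wpM2r ?nm_ge0.
Qed.

Lemma taylor1_ev a x r : nm x < r -> sm a r -> taylor1 (ev a) x.
Proof.
move=> xr sa; pose s := (nm x + r) / 2; have x0 := nm_ge0 x.
have [xs s0 sr] : [/\ nm x <= s, 0 < s & s < r] by rewrite /s; split; lra.
have [|D [B BP]] := ev_taylor1 xs _ sa; first by rewrite s0.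
exists D, `|B|, (s - nm x); split=> //; first by rewrite /s; lra.
move=> h hd; have xh : nm (x + h) <= s by apply: le_trans (nmD _ _) _; lra.
have := BP _ xh; rewrite [x + h - x]addrC addKr => /le_trans; apply.
by rewrite ler_wpM2r ?exprn_ge0 ?nm_ge0 // ler_norm.
Qed.

Lemma taylor1_ex (z : C) : taylor1 (@ex R) z.
Proof.
have h1 : taylor1 (fun z : C => (pi *+ 2)%:C * 'i * z) z.
  exists ((pi *+ 2)%:C * 'i), 0, 1; split=> // h _.
  by rewrite (_ : _ - _ - _ = 0) ?nm0 ?mul0r //; ring.
rewrite ex.unlock; apply: (taylor1_comp (f := @cexp R) h1).
set w := _ * z; have [D [B [d [B0 d0 P]]]] : taylor1 (ev (expc R)) 0.
  by apply: (@taylor1_ev _ _ 1); rewrite ?nm0 ?ltr01 //; apply: sm_expc.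
exists (cexp w * D), (nm (cexp w) * B), d; split=> //; first by rewrite mulr_ge0 ?nm_ge0.
move=> h hd; have := P h hd; rewrite !ev_expc add0r cexp0 => e.
rewrite cexpD (_ : _ - _ - _ = cexp w * (cexp h - 1 - h * D)); last by ring.
by rewrite nmM -mulrA ler_wpM2l ?nm_ge0.
Qed.

End Differentiability.

(** * Infinite products, Euler's series and the theta function *)

Section InfiniteProducts.
Variable R : realType.
Local Notation C := R[i].

Variables (c : nat -> C) (e : nat -> nat).
Hypothesis c1 : forall i, nm (c i) <= 1.
Hypothesis e1 : forall i, (i < e i)%N.

Let P K : {poly C} := \prod_(i < K) (1 - c i *: 'X^(e i)).
(** A majorant: since the [c i] have modulus at most 1, the coefficients of [Q K] bound those of
    [P K]. *)
Let Q K : {poly R} := \prod_(i < K) (1 + 'X^(e i)).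

(** As i < e i, the factors of index at least n do not touch the coefficient of X^n, so the first n
    factors already give its final value. *)
Definition prodc n : C := (P n)`_n.

Let coefP K n : (P K.+1)`_n = (P K)`_n - c K * (if (n < e K)%N then 0 else (P K)`_(n - e K)).
Proof.
by rewrite /P big_ord_recr /= mulrBr mulr1 coefB -scalerAr coefZ coefMXn.
Qed.

Let coefQ K n : (Q K.+1)`_n = (Q K)`_n + (if (n < e K)%N then 0 else (Q K)`_(n - e K)).
Proof. by rewrite /Q big_ord_recr /= mulrDr mulr1 coefD coefMXn. Qed.

Let stable K n : (n <= K)%N -> (P K)`_n = prodc n.
Proof.
move=> nK; rewrite -(subnKC nK); elim: (K - n)%N => [|k IH]; first by rewrite addn0.
by rewrite addnS coefP ifT ?mulr0 ?subr0 // (leq_ltn_trans _ (e1 _)) // leq_addr.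
Qed.

Let Q0 K n : 0 <= (Q K)`_n.
Proof.
elim: K n => [|K IH] n; first by rewrite /Q big_ord0 coef1.
by rewrite coefQ addr_ge0 //; case: ifP.
Qed.

Let PQ K n : nm (P K)`_n <= (Q K)`_n.
Proof.
elim: K n => [|K IH] n.
  by rewrite /P /Q !big_ord0 !coef1; case: eqP => _; rewrite ?nm1 ?nm0.
rewrite coefP coefQ; apply: le_trans (nmD _ _) _; rewrite nmN nmM; apply: lerD => //.
case: ifP => _; first by rewrite nm0 mulr0.
by apply: le_trans (ler_wpM2r (nm_ge0 _) (c1 K)) _; rewrite mul1r.
Qed.

Let Qmono K L n : (K <= L)%N -> (Q K)`_n <= (Q L)`_n.
Proof.
move=> KL; rewrite -(subnKC KL); elim: (L - K)%N => [|k IH]; first by rewrite addn0.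
by rewrite addnS coefQ (le_trans IH) // lerDl; case: ifP.
Qed.

Let Qstable K n : (n <= K)%N -> (Q K)`_n = (Q n)`_n.
Proof.
move=> nK; rewrite -(subnKC nK); elim: (K - n)%N => [|k IH]; first by rewrite addn0.
by rewrite addnS coefQ ifT ?addr0 // (leq_ltn_trans _ (e1 _)) // leq_addr.
Qed.

Let d n : R := (Q n)`_n.

Let Pd K n : nm (P K)`_n <= d n.
Proof.
apply: (le_trans (PQ K n)); have [nK|/ltnW Kn] := leqP n K; first by rewrite Qstable.
exact: Qmono.
Qed.

(** The majorant at r is a product of factors 1 + r^(e i), at most the exponential of a geometric
    sum. *)
Let dsum (r : R) : 0 <= r < 1 -> exists B, forall N, \sum_(i < N) d i * r ^+ i <= B.
Proof.
move=> /andP[r0 r1]; exists (expR (1 - r)^-1) => N.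
have -> : \sum_(i < N) d i * r ^+ i = \sum_(i < N) (Q N)`_i * r ^+ i.
  by apply: eq_bigr => i _; rewrite Qstable // ltnW.
apply: (@le_trans _ _ (Q N).[r]).
  rewrite (@horner_coef_wide _ (size (Q N) + N)) ?leq_addr // addnC.
  rewrite big_split_ord /= lerDl; apply: sumr_ge0 => i _; by rewrite mulr_ge0 ?exprn_ge0.
apply: (@le_trans _ _ (expR (\sum_(i < N) r ^+ i))); last first.
  rewrite ler_expR; have := subrX1 r N; have := exprn_ge0 N r0.
  move: (_ ^+ N) (\sum_(i < N) _) => w S w0 E.
  rewrite -[leRHS]div1r ler_pdivlMr ?subr_gt0 //; lra.
elim: N => [|N IH]; first by rewrite /Q !big_ord0 hornerC expR0.
rewrite /Q big_ord_recr [X in expR X]big_ord_recr /= hornerM expRD -/(Q N).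
apply: ler_pM => //.
- by rewrite horner_coef; apply: sumr_ge0 => i _; rewrite mulr_ge0 ?exprn_ge0.
- by rewrite hornerD hornerC hornerXn addr_ge0 // exprn_ge0.
rewrite hornerD hornerC hornerXn; apply: le_trans (expR_ge1Dx _).
by rewrite lerD2l ler_wiXn2l ?(ltW r1) // ltnW.
Qed.

Lemma sm_prodc (r : R) : 0 <= r < 1 -> sm prodc r.
Proof.
move=> r01; have [B BP] := dsum r01; exists B => N; apply: le_trans (BP N).
by apply: ler_sum => i _; rewrite ler_wpM2r ?exprn_ge0 ?Pd //; case/andP: r01.
Qed.

(** Each partial product is a finite sum of powers of [x] with coefficients dominated by [d], so
    [tannery] exchanges the two limits. *)
Lemma tends_prodc x : nm x < 1 -> tends (fun K => \prod_(i < K) (1 - c i * x ^+ e i)) (ev prodc x).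
Proof.
move=> x1; have x01 : 0 <= nm x < 1 by rewrite nm_ge0.
have [B BP] := dsum x01.
apply: (@tannery _ (fun K n => (P K)`_n * x ^+ n) (fun n => prodc n * x ^+ n) (fun n => d n * nm x ^+ n)).
- by move=> K n; rewrite nmM nmX ler_wpM2r ?exprn_ge0 ?nm_ge0.
- by exists B.
- move=> n ep ep0; exists n => K nK; by rewrite stable // subrr nm0.
- move=> K ep ep0; exists (size (P K)) => N sN.
  rewrite -horner_coef_wide // /P horner_prod.
  by under eq_bigr do rewrite hornerD hornerN hornerZ hornerC hornerXn; rewrite subrr nm0.
exact: evP (sm_prodc x01).
Qed.

End InfiniteProducts.

Section EulerSeries.
Variable R : realType.
Local Notation C := R[i].
Implicit Types (q x : C).

Lemma tendsV (u : nat -> C) l : l != 0 -> tends u l -> tends (fun n => (u n)^-1) l^-1.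
Proof.
move=> l0 ul e e0; have ln : 0 < nm l by rewrite nm_gt0.
have d1 : 0 < nm l / 2 by lra.
have d2 : 0 < e * (nm l ^+ 2 / 2) by rewrite mulr_gt0 // divr_gt0 // exprn_gt0.
have [N NP] := ul _ d1; have [M MP] := ul _ d2.
exists (maxn N M) => n; rewrite geq_max => /andP[/NP h1 /MP h2].
have h3 : nm l / 2 < nm (u n) by have := nmBD l (u n); rewrite (nmB l); lra.
have un : u n != 0 by rewrite -nm_gt0; lra.
have -> : (u n)^-1 - l^-1 = (l - u n) / (u n * l) by field; rewrite un l0.
rewrite nmM nmV nmM (nmB l) ltr_pdivrMr ?mulr_gt0 //; last by lra.
apply: (lt_trans h2); rewrite ltr_pM2l //; nra.
Qed.

Lemma ev_near0 (a : nat -> C) : sm a 1 ->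
  exists2 B, 0 <= B & forall x, nm x <= 1 -> nm (ev a x - a 0%N) <= B * nm x.
Proof.
move=> sa; have [B BP] := sm_shift 1 ltr01 sa.
have B0 : 0 <= B by apply: le_trans (BP 0%N); rewrite big_ord0.
exists B => // x x1.
have s1 : sm a (nm x) by apply: sm_le sa; rewrite nm_ge0.
have s2 : sm (fun n => a (n + 1)%N) (nm x) by apply: (@sm_le _ _ _ 1); [rewrite nm_ge0|exists B].
rewrite (ev_shift s1 s2) /psum big_ord1 expr0 mulr1 addrAC subrr add0r expr1 nmM mulrC.
by rewrite ler_wpM2r ?nm_ge0 // (ev_nm_le x1 BP).
Qed.

(** Euler's coefficients (-1)^k q^(k(k-1)/2) / ((1 - q)...(1 - q^k)) of the product of all 1 - q^n
    x. Starting from this series makes the product entire in x at once. *)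
Fixpoint gc q k : C := if k is j.+1 then - (q ^+ j / (1 - q ^+ j.+1)) * gc q j else 1.

Lemma nmX_lt1 q n : nm q < 1 -> nm q ^+ n.+1 <= nm q.
Proof. by move=> q1; rewrite exprS ler_piMr ?nm_ge0 // exprn_ile1 ?nm_ge0 // ltW. Qed.

Lemma sub1X_neq0 q n : nm q < 1 -> 1 - q ^+ n.+1 != 0.
Proof.
move=> q1; rewrite subr_eq0; apply/eqP => h; have := nmX_lt1 n q1.
by rewrite -nmX -h nm1 leNgt q1.
Qed.

(** The ratio of consecutive terms at s is q^k s / (1 - q^(k+1)) in modulus; it tends to 0 and is at
    most 1 from [N] on. *)
Lemma sm_gc q r : nm q < 1 -> 0 <= r -> sm (gc q) r.
Proof.
move=> q1 r0; have q0 := nm_ge0 q; pose s := r + 1; have s0 : 0 < s by rewrite /s; lra.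
apply: (@sm_geom _ _ r s); first by rewrite r0 /s ltrDl ltr01.
have d0 : 0 < (1 - nm q) / s by rewrite divr_gt0 // subr_gt0.
have q01 : 0 <= nm q < 1 by rewrite q0 q1.
have [N NP] := tends0_geom q01 d0.
pose v k := nm (gc q k) * s ^+ k.
have v0 k : 0 <= v k by rewrite mulr_ge0 ?nm_ge0 ?exprn_ge0 // ltW.
have step k : (N <= k)%N -> v k.+1 <= v k.
  move=> Nk; have h := NP k Nk; rewrite ltr_pdivlMr // in h.
  rewrite /v /= nmM nmN nmM nmV nmX [s ^+ k.+1]exprS.
  have h2 : 1 - nm q <= nm (1 - q ^+ k.+1).
    have := nmBD 1 (1 - q ^+ k.+1); rewrite nm1 subKr nmX.
    by have := nmX_lt1 k q1; lra.
  have h3 : 0 < nm (1 - q ^+ k.+1) by lra.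
  have -> : nm q ^+ k / nm (1 - q ^+ k.+1) * nm (gc q k) * (s * s ^+ k) =
     (nm q ^+ k * s / nm (1 - q ^+ k.+1)) * v k by rewrite /v; field; rewrite gt_eqF.
  by rewrite -[leRHS]mul1r ler_wpM2r // ler_pdivrMr // mul1r; lra.
exists (\sum_(k < N.+1) v k) => n; rewrite -/(v n).
have small k : (k <= N)%N -> v k <= \sum_(k < N.+1) v k.
  by move=> kN; rewrite (bigD1 (Ordinal (kN : (k < N.+1)%N))) //= lerDl sumr_ge0.
have [|/ltnW Nn] := leqP n N; first exact: small.
apply: le_trans (small N (leqnn _)); rewrite -(subnKC Nn).
elim: (n - N)%N => [|k IH]; first by rewrite addn0.
by rewrite addnS (le_trans (step _ _)) // leq_addr.
Qed.

End EulerSeries.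

(* The value of the Euler product (1 - x)(1 - qx)(1 - q^2 x)..., see [tends_G]. *)
HB.lock Definition G (R : realType) (q x : R[i]) : R[i] := ev (gc q) x.
Arguments G {R} q x.

Section EulerProduct.
Variable R : realType.
Local Notation C := R[i].
Implicit Types (q x : C).

Lemma GE q x : G q x = ev (gc q) x. Proof. by rewrite G.unlock. Qed.

(** The partial sums satisfy the equation up to one term of the series at q x, which tends to 0 as a
    difference of consecutive partial sums. *)
Lemma G_rec q x : nm q < 1 -> G q x = (1 - x) * G q (q * x).
Proof.
move=> q1.
have E N : psum (gc q) x N.+1 = (1 - x) * psum (gc q) (q * x) N + gc q N * (q * x) ^+ N.
  elim: N => [|N IH]; first by rewrite /psum big_ord0 big_ord1 !expr0 mulr0 add0r mulr1.
  rewrite /psum big_ord_recr /= -/(psum _ _ _) IH big_ord_recr /= -/(psum _ _ _).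
  by rewrite !exprMn !exprS; field; rewrite -exprS sub1X_neq0.
rewrite !GE; have t1 := evP (sm_gc q1 (nm_ge0 x)); have t2 := evP (sm_gc q1 (nm_ge0 (q * x))).
have t3 := tendsD (tends_shift 1 t2) (tendsMl (-1) t2).
have := tendsD (tendsMl (1 - x) t2) t3.
rewrite mulN1r subrr addr0 => t4; apply: (tends_unique (tends_shift 1 t1)).
apply: (tends_ext _ t4) => N; rewrite addn1 E /psum big_ord_recr /=; congr (_ + _).
by rewrite mulN1r addrAC subrr add0r.
Qed.

Lemma G_recN q x N : nm q < 1 -> G q x = \prod_(n < N) (1 - q ^+ n * x) * G q (q ^+ N * x).
Proof.
move=> q1; elim: N => [|N IH]; first by rewrite big_ord0 expr0 !mul1r.
by rewrite IH big_ord_recr /= -mulrA (G_rec (q ^+ N * x) q1) exprS -(mulrA q).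
Qed.

Lemma G_tail q x : nm q < 1 -> tends (fun N => G q (q ^+ N * x)) 1.
Proof.
move=> q1; have [B B0 BP] := ev_near0 (sm_gc q1 ler01).
have g : tends0 (fun N => (B * nm x) * nm q ^+ N).
  by apply: tends0Ml; [rewrite mulr_ge0 ?nm_ge0 | apply: tends0_geom; rewrite nm_ge0].
have g1 : tends0 (fun N => nm x * nm q ^+ N).
  by apply: tends0Ml; [rewrite nm_ge0 | apply: tends0_geom; rewrite nm_ge0].
move=> e e0; have [N NP] := g e e0; have [M MP] := g1 1 ltr01.
exists (maxn N M) => n; rewrite geq_max => /andP[/NP h1 /MP h2].
have xq : nm (q ^+ n * x) = nm x * nm q ^+ n by rewrite nmM nmX mulrC.
have := BP (q ^+ n * x); rewrite -GE xq => /(_ (ltW h2)) h3.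
by apply: le_lt_trans h1; rewrite -mulrA.
Qed.

(** By [G_recN] the partial product is [G q x] divided by a value at q^N x, which tends to 1 and is
    therefore nonzero for large N. *)
Lemma tends_G q x : nm q < 1 -> tends (fun N => \prod_(n < N) (1 - q ^+ n * x)) (G q x).
Proof.
move=> q1; have t := tendsMl (G q x) (tendsV (oner_neq0 _) (G_tail x q1)).
rewrite invr1 mulr1 in t.
have [N NP] := G_tail x q1 ltr01.
move=> e e0; have [M MP] := t e e0; exists (maxn N M) => n; rewrite geq_max => /andP[/NP h1 /MP].
rewrite {1}(G_recN x n q1) mulfK //; apply/eqP => h; move: h1; rewrite h sub0r nmN nm1.
by rewrite ltxx.
Qed.

(** The factor at q^N x is nonzero for large N, so a zero comes from one of the finitely many
    factors split off. *)
Lemma G_eq0 q x : nm q < 1 -> G q x = 0 -> exists n, q ^+ n * x = 1.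
Proof.
move=> q1 g0; have [N /(_ N (leqnn _)) NP] := G_tail x q1 ltr01.
have := G_recN x N q1; rewrite g0 => /esym/eqP; rewrite mulf_eq0 => /orP[|/eqP h]; last first.
  by move: NP; rewrite h sub0r nmN nm1 ltxx.
by move=> /prodf_eq0 [i _]; rewrite subr_eq0 => /eqP h; exists i.
Qed.

Lemma G_neq0 q x : nm q < 1 -> nm x < 1 -> G q x != 0.
Proof.
move=> q1 x1; apply/eqP => /(G_eq0 q1) [n h].
have : nm (q ^+ n * x) < 1.
  rewrite nmM nmX; apply: le_lt_trans x1; rewrite ler_piMl ?nm_ge0 // exprn_ile1 ?nm_ge0 //.
  exact: ltW.
by rewrite h nm1 ltxx.
Qed.

(* Jacobi's theta function, without the factor (q; q) *)
Definition th q x := G q x * G q (q / x).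

Lemma th_mulq q x : nm q < 1 -> q != 0 -> x != 0 -> th q (q * x) = - x^-1 * th q x.
Proof.
move=> q1 q0 x0; rewrite /th (G_rec x q1).
have -> : q / (q * x) = x^-1 by field; rewrite q0 x0.
by rewrite (G_rec x^-1 q1); move: (G q (q * x)) (G q (q / x)) => A B; field.
Qed.

Lemma th_inv q x : nm q < 1 -> x != 0 -> th q x^-1 = - x^-1 * th q x.
Proof.
move=> q1 x0; rewrite /th (G_rec x q1) invrK (G_rec x^-1 q1).
by move: (G q (q * x)) (G q (q / x)) => A B; field.
Qed.

End EulerProduct.

(** A constant multiple of Jacobi's theta_1(z; t) / eta(t)^3. Dividing by the square of the Euler
    product makes the derivative at z = 0 independent of t. *)
HB.lock Definition phi (R : realType) (t z : R[i]) : R[i] :=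
  ex (- (z / 2)) * th (ex t) (ex z) / G (ex t) (ex t) ^+ 2.
Arguments phi {R} t z.

Section ThetaFunction.
Variable R : realType.
Local Notation C := R[i].
Implicit Types (t z : C).

Lemma phiD1 t z : phi t (z + 1) = - phi t z.
Proof.
rewrite phi.unlock (exD z 1) ex1 mulr1 mulrDl opprD exD (exN (1 / 2)) ex_half invrN1.
by rewrite mulrN1 !mulNr.
Qed.

Lemma phiDt t z : 0 < complex.Im t -> phi t (z + t) = - ex (- z - t / 2) * phi t z.
Proof.
move=> t0; rewrite phi.unlock (exD z t) [ex z * _]mulrC th_mulq ?ex_neq0 ?nm_ex_lt1 //.
have -> : - ((z + t) / 2) = - (z / 2) - t / 2 by ring.
by rewrite !exD !exN; field; rewrite ?ex_neq0 ?G_neq0 ?nm_ex_lt1.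
Qed.

Lemma phiN t z : 0 < complex.Im t -> phi t (- z) = - phi t z.
Proof.
move=> t0; rewrite phi.unlock exN th_inv ?ex_neq0 ?nm_ex_lt1 // mulNr opprK.
have -> : ex (z / 2) = ex z * ex (- (z / 2)) by rewrite -exD; congr ex; field.
by field; rewrite ?ex_neq0 ?G_neq0 ?nm_ex_lt1.
Qed.

Lemma phi_tD1 t z : phi (t + 1) z = phi t z.
Proof. by rewrite phi.unlock exD ex1 mulr1. Qed.

Lemma phi_eq0 t z : 0 < complex.Im t -> phi t z = 0 ->
  exists m n : int, z = m%:~R * t + n%:~R.
Proof.
move=> t0; have q1 : nm (ex t) < 1 by rewrite nm_ex_lt1.
move/eqP; rewrite phi.unlock /th !mulf_eq0 (negbTE (ex_neq0 _)) invr_eq0 sqrf_eq0 /=.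
move=> /orP[/orP[]|/eqP h] => [/eqP h|/eqP h|]; last by have := G_neq0 q1 q1; rewrite h eqxx.
  have [n] := G_eq0 q1 h; rewrite -exMn -exD => /ex_eq1 [m {}h]; exists (- n%:Z), m.
  by rewrite -h mulrNz -[n%:~R]/(n%:R); ring.
have [n] := G_eq0 q1 h; rewrite -exMn -exN -!exD => /ex_eq1 [m {}h]; exists (n%:Z + 1), (- m).
by rewrite mulrNz -h intrD -[n%:~R]/(n%:R); ring.
Qed.

Lemma phi_entire t z0 : 0 < complex.Im t -> entire_at (phi t) z0.
Proof.
move=> t0; have q1 : nm (ex t) < 1 by rewrite nm_ex_lt1.
have e1 := @entire_ex R; have e2 c d := @entire_comp_ex R _ c d z0 (fun r => @sm_gc R _ r q1).
have e := entireZ (G (ex t) (ex t) ^+ 2)^-1 (entireM (e1 (- 2^-1) 0 z0)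
   (entireM (e2 1 0) (e2 (-1) t))).
case: e => a sa fa; exists a; first exact: sa.
move=> u; rewrite -fa -!GE; move: (z0 + u) => w.
rewrite [1 * w]mul1r !addr0 mulN1r [- w + t]addrC exD exN phi.unlock /th [LHS]mulrC.
by rewrite [- _ * w]mulNr [_ * w]mulrC.
Qed.

End ThetaFunction.

(** * A maximum principle and the uniqueness of quasi-periodic functions *)

Section MaximumModulus.
Variable R : realType.
Local Notation C := R[i].

Lemma ev_half_tends (a : nat -> C) : sm a 1 -> tends (fun n => ev a ((1 / 2) ^+ n)) (a 0%N).
Proof.
move=> sa; have [B B0 BP] := ev_near0 sa.
have h : tends0 (fun n => B * (1 / 2 : R) ^+ n) by apply: tends0Ml => //; apply: tends0_geom; lra.
have e n : nm ((1 / 2 : C) ^+ n) = (1 / 2) ^+ n by rewrite nmX nmM nm1 nmV nm_nat.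
apply: tends0_le h => n; rewrite -e; apply: BP; rewrite e exprn_ile1 //; lra.
Qed.

(** Both sides are divided by u and compared along u = 2^-n, where the quotients tend to the
    coefficients of index 1. *)
Lemma ev_coef1 (a b : nat -> C) c : (forall r, 0 <= r -> sm a r) -> (forall r, 0 <= r -> sm b r) ->
  a 0%N = 0 -> b 0%N = 0 -> (forall u, ev a u = c * ev b u) -> a 1%N = c * b 1%N.
Proof.
move=> sa sb a0 b0 ab.
have sh (d : nat -> C) r : (forall r, 0 <= r -> sm d r) -> 0 <= r -> sm (fun n => d (n + 1)%N) r.
  move=> sd r0; apply: (@sm_le _ _ r (r + 1)); first by lra.
  by apply: sm_shift; [lra | apply: sd; lra].
have E (d : nat -> C) u : (forall r, 0 <= r -> sm d r) -> d 0%N = 0 ->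
    ev d u = u * ev (fun n => d (n + 1)%N) u.
  move=> sd d0; rewrite (@ev_shift _ d u 1 (sd _ (nm_ge0 u)) (sh d _ sd (nm_ge0 u))).
  by rewrite /psum big_ord1 d0 mul0r add0r expr1.
have ta := ev_half_tends (sh a 1 sa ler01); have tb := ev_half_tends (sh b 1 sb ler01).
apply: (tends_unique ta); apply: tends_ext (tendsMl c tb) => n.
have u0 : (1 / 2 : C) ^+ n != 0 by rewrite expf_neq0 // mul1r invr_eq0 pnatr_eq0.
by apply: (mulfI u0); rewrite mulrCA -(E b _ sb b0) -(E a _ sa a0) ab.
Qed.

(* If P = c F + d_k u^k + ... with k above the order of F, then moving in the
   direction where d_k u^k / (c F) is positive makes |P| exceed |c| |F|. *)
Lemma max_modulus_coef (p f : nat -> C) c s :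
  (forall r, 0 <= r -> sm p r) -> (forall r, 0 <= r -> sm f r) -> c != 0 ->
  (forall i, (i < s)%N -> f i = 0) -> f s != 0 ->
  (forall i, (i <= s)%N -> p i = c * f i) ->
  (forall u, nm (ev p u) <= nm c * nm (ev f u)) -> forall n, p n = c * f n.
Proof.
move=> sp sf c0 fs0 fs pf PF n0; apply/eqP; apply: contraT => n0P.
have exk : exists n, p n != c * f n by exists n0.
case: (ex_minnP exk) => k kP kmin.
have sk : (s < k)%N by rewrite ltnNge; apply/negP => /pf /eqP; apply/negP.
pose j := (k - s)%N; have j0 : (0 < j)%N by rewrite subn_gt0.
pose d n := p n - c * f n.
have sd r : 0 <= r -> sm d r.
  move=> r0; have := sm_add r0 (sp r r0) (sm_scale (- c) (sf r r0)).
  by apply: sm_dom => // n; rewrite /d mulNr.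
have sh (a : nat -> C) m r : (forall r, 0 <= r -> sm a r) -> 0 <= r -> sm (fun n => a (n + m)%N) r.
  move=> sa r0; apply: (@sm_le _ _ r (r + 1)); first by lra.
  by apply: sm_shift; [lra | apply: sa; lra].
pose E1 := ev (fun n => d (n + k)%N); pose E2 := ev (fun n => f (n + s)%N).
have Ef u : ev f u = u ^+ s * E2 u.
  rewrite (@ev_shift _ f u s (sf _ (nm_ge0 u)) (sh f s _ sf (nm_ge0 u))).
  by rewrite /psum big1 ?add0r // => i _; rewrite fs0 ?mul0r.
have Ed u : ev d u = u ^+ k * E1 u.
  rewrite (@ev_shift _ d u k (sd _ (nm_ge0 u)) (sh d k _ sd (nm_ge0 u))).
  rewrite /psum big1 ?add0r // => i _; rewrite /d.
  suff -> : p i = c * f i by rewrite subrr mul0r.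
  by apply/eqP; apply: contraT => /kmin; rewrite leqNgt ltn_ord.
have Ep u : ev p u = c * ev f u + ev d u.
  rewrite -(ev_scale c (sf _ (nm_ge0 u))) -(ev_add (sm_scale c (sf _ (nm_ge0 u))) (sd _ (nm_ge0 u))).
  by congr (ev _ u); apply/funext => n; rewrite /d addrC subrK.
have ineq u : u != 0 -> nm (c * E2 u + u ^+ j * E1 u) <= nm (c * E2 u).
  move=> u0; have := PF u; rewrite Ep Ed Ef.
  have -> : c * (u ^+ s * E2 u) + u ^+ k * E1 u = u ^+ s * (c * E2 u + u ^+ j * E1 u).
    by rewrite -(subnKC (ltnW sk)) exprD -/j; ring.
  rewrite !nmM mulrCA ler_pM2l ?nmX ?exprn_gt0 ?nm_gt0 // -nmM //.
have dk : d k != 0 by rewrite subr_eq0.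
have dk0 : 0 < nm (d k) by rewrite nm_gt0.
have cf0 : 0 < nm (c * f s) by rewrite nm_gt0 mulf_neq0.
pose T := nm (d k) / nm (c * f s); have T0 : 0 < T by rewrite divr_gt0.
have [v v1 vd] : exists2 v : C, nm v = 1 & v * d k = T%:C * (c * f s).
  exists (T%:C * (c * f s) / d k); last by rewrite divfK.
  by rewrite nmM nmV nmM nmR gtr0_norm // /T divfK ?gt_eqF // divff ?gt_eqF.
pose w := j.-root v; have wj : w ^+ j = v by rewrite /w rootCK.
have w1 : nm w = 1.
  by apply/eqP; rewrite -(@pexpr_eq1 _ (nm w) j) ?nm_ge0 // -nmX wj v1.
have [B1 B10 B1P] := ev_near0 (sh d k 1 sd ler01).
have [B2 B20 B2P] := ev_near0 (sh f s 1 sf ler01).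
rewrite add0n in B1P; rewrite add0n in B2P.
(* With u = r w, the value c E2 + u^j E1 is (1 + r^j T) c E2 up to an error r^j O(r). As its modulus
   is at most |c E2|, the constant T |c f_s| is O(r), which fails for small r. *)
have key (r : R) : 0 < r <= 1 -> T * nm (c * f s) <= (B1 + 2 * T * nm c * B2) * r.
  move=> /andP[r0 r1]; pose u := r%:C * w.
  have nu : nm u = r by rewrite nmM w1 mulr1 nmR gtr0_norm.
  have u0 : u != 0 by rewrite -nm_gt0 nu.
  have h1 := B1P u; have h2 := B2P u; rewrite nu in h1 h2; have {}h1 := h1 r1; have {}h2 := h2 r1.
  have := ineq u u0.
  have -> : c * E2 u + u ^+ j * E1 u = (1 + r ^+ j * T)%:C * (c * E2 u) +
     (r ^+ j)%:C * (v * (E1 u - d k) - T%:C * c * (E2 u - f s)).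
    have -> : u ^+ j = (r ^+ j)%:C * v by rewrite /u exprMn wj rmorphXn.
    have -> : v * (E1 u - d k) = v * E1 u - T%:C * (c * f s) by rewrite mulrBr vd.
    rewrite rmorphD rmorphM rmorph1 /=; move: (E1 u) (E2 u) => X Y; ring.
  set X := (r ^+ j)%:C * _; set Y := _%:C * (c * E2 u) => h3.
  have rj : 0 < r ^+ j by rewrite exprn_gt0.
  have h4 : nm X <= r ^+ j * ((B1 + T * nm c * B2) * r).
    rewrite /X nmM nmR gtr0_norm // ler_pM2l //.
    apply: le_trans (nmD _ _) _; rewrite nmN !nmM v1 nmR gtr0_norm // mul1r.
    by have := ler_wpM2l (mulr_ge0 (ltW T0) (nm_ge0 c)) h2; lra.
  have h5 : nm Y = (1 + r ^+ j * T) * nm (c * E2 u).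
    by rewrite /Y [LHS]nmM nmR ger0_norm // addr_ge0 // mulr_ge0 // ltW.
  have h6 : nm Y <= nm (Y + X) + nm X by have := nmBD Y (Y + X); rewrite opprD addNKr nmN.
  have h7 : r ^+ j * (T * nm (c * E2 u)) <= r ^+ j * ((B1 + T * nm c * B2) * r).
    by move: h5 h6 h3 h4; rewrite mulrDl; lra.
  rewrite ler_pM2l // in h7.
  have h8 : nm (c * f s) <= nm (c * E2 u) + nm c * (B2 * r).
    have := nmBD (c * f s) (c * E2 u); rewrite -mulrBr [nm (c * (_ - _))]nmM (nmB (f s)) => /le_trans; apply.
    by rewrite lerD2l ler_wpM2l ?nm_ge0.
  have := ler_wpM2l (ltW T0) h8; lra.
have := key 1; rewrite ltr01 lexx /= mulr1 => /(_ isT).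
set Z := B1 + _; set W := T * _ => WZ.
have W0 : 0 < W by rewrite mulr_gt0.
have Z0 : 0 < Z by lra.
have r01 : 0 < W / (2 * Z) <= 1.
  apply/andP; split; first by apply: divr_gt0 => //; lra.
  by rewrite ler_pdivrMr; lra.
have := key _ r01; rewrite -/Z -/W.
have -> : Z * (W / (2 * Z)) = W / 2 by field; rewrite gt_eqF.
lra.
Qed.

End MaximumModulus.

Section QuasiPeriodic.
Variable R : realType.
Local Notation C := R[i].

Lemma int_periodic (T : Type) (f : C -> T) w : (forall z, f (z + w) = f z) ->
  forall (m : int) z, f (z + m%:~R * w) = f z.
Proof.
move=> fw; have fn (n : nat) z : f (z + n%:R * w) = f z.
  elim: n z => [|n IH] z; first by rewrite mul0r addr0.
  by rewrite -natr1 mulrDl mul1r addrA fw.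
case=> n z; first exact: fn.
by rewrite NegzE mulrNz mulNr -[_%:~R]/(n.+1%:R) -[in RHS](subrK (n.+1%:R * w) z) fn.
Qed.

Variables (t : C) (P F m2 : C -> C).
Hypothesis t0 : 0 < complex.Im t.
Hypothesis m20 : forall z, m2 z != 0.
Hypotheses (entP : forall z0, entire_at P z0) (entF : forall z0, entire_at F z0).
Hypotheses (P1 : forall z, P (z + 1) = - P z) (F1 : forall z, F (z + 1) = - F z).
Hypotheses (P2 : forall z, P (z + t) = m2 z * P z) (F2 : forall z, F (z + t) = m2 z * F z).
Hypothesis F0 : forall z, F z = 0 -> exists m n : int, z = m%:~R * t + n%:~R.
Variables (p f : nat -> C).
Hypotheses (sp : forall r, 0 <= r -> sm p r) (sf : forall r, 0 <= r -> sm f r).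
Hypotheses (Pp : forall u, P u = ev p u) (Ff : forall u, F u = ev f u).
Hypotheses (p0 : p 0%N = 0) (f0 : f 0%N = 0) (f1 : f 1%N != 0).

(** The quotient P / F. The zeros of F are lattice points and simple, since f_1 is nonzero, so p_1 /
    f_1 is the value there that makes the quotient continuous. *)
Let Q z := if F z == 0 then p 1%N / f 1%N else P z / F z.

Let Qper1 z : Q (z + 1) = Q z.
Proof. by rewrite /Q F1 P1 oppr_eq0 invrN mulrNN. Qed.

Let Qpert z : Q (z + t) = Q z.
Proof.
rewrite /Q F2 P2 mulf_eq0 (negbTE (m20 z)) /= invfM mulrACA divff ?m20 // mul1r //.
Qed.

Let Qper (m n : int) z : Q (z + (m%:~R * t + n%:~R)) = Q z.
Proof.
rewrite addrA -[n%:~R]mulr1; have := @int_periodic _ Q 1 Qper1 n; move=> ->.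
exact: (@int_periodic _ Q t Qpert m).
Qed.

Let zperP (m n : int) z : (P (z + (m%:~R * t + n%:~R)) == 0) = (P z == 0).
Proof.
rewrite addrA -[n%:~R]mulr1.
rewrite (@int_periodic _ (fun z => P z == 0) 1) => [|y]; last by rewrite P1 oppr_eq0.
by rewrite (@int_periodic _ (fun z => P z == 0) t) // => y; rewrite P2 mulf_eq0 (negbTE (m20 y)).
Qed.

(* at every point P and F have expansions with the same order s <= 1 of F *)
Let local z0 : exists z1 s (a b : nat -> C), [/\ (forall u, Q (z0 + u) = Q (z1 + u)),
  (forall r, 0 <= r -> sm a r) /\ (forall r, 0 <= r -> sm b r),
  (forall u, P (z1 + u) = ev a u) /\ (forall u, F (z1 + u) = ev b u),
  (forall i, (i < s)%N -> a i = 0 /\ b i = 0) & b s != 0 /\ Q z1 = a s / b s].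
Proof.
have [Fz|Fz] := eqVneq (F z0) 0.
  have [m [n z0E]] := F0 Fz; exists 0, 1%N, p, f; split=> //.
  - by move=> u; rewrite z0E addrC Qper add0r.
  - by split=> u; rewrite add0r.
  - by case.
  - by split=> //; rewrite /Q Ff ev0 f0 eqxx.
have [a sa fa] := entP z0; have [b sb fb] := entF z0.
exists z0, 0%N, a, b; split=> //.
have eb : b 0%N = F z0 by rewrite -(ev0 b) -fb addr0.
have ea : a 0%N = P z0 by rewrite -(ev0 a) -fa addr0.
by rewrite /Q (negbTE Fz) ea eb.
Qed.

Let ratio_cont (a b : nat -> C) : sm a 1 -> sm b 1 -> b 0%N != 0 -> forall e : R, 0 < e ->
  exists2 d : R, 0 < d & forall u, nm u < d -> ev b u != 0 /\ nm (ev a u / ev b u - a 0%N / b 0%N) < e.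
Proof.
move=> sa sb b0 e e0; have [A A0 AP] := ev_near0 sa; have [B B0 BP] := ev_near0 sb.
have nb : 0 < nm (b 0%N) by rewrite nm_gt0.
pose c := nm (b 0%N); pose X := c * A + nm (a 0%N) * B.
have X0 : 0 <= X by rewrite addr_ge0 // mulr_ge0 ?nm_ge0.
exists (Num.min 1 (Num.min (c / (2 * (B + 1))) (e * c ^+ 2 / (2 * (X + 1))))).
  by rewrite !lt_min ltr01 !divr_gt0 ?mulr_gt0 ?exprn_gt0 //; lra.
move=> u; rewrite !lt_min => /and3P[u1 u2 u3].
rewrite ltr_pdivlMr in u2; last lra. rewrite ltr_pdivlMr in u3; last lra.
have {}AP := AP u (ltW u1); have {}BP := BP u (ltW u1).
have un := nm_ge0 u.
have h1 : c / 2 < nm (ev b u).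
  by have := nmBD (b 0%N) (ev b u); rewrite (nmB (b 0%N)) -/c; nra.
have eb : ev b u != 0 by rewrite -nm_gt0; rewrite -/c in nb; lra.
split=> //.
have -> : ev a u / ev b u - a 0%N / b 0%N =
   (b 0%N * (ev a u - a 0%N) - a 0%N * (ev b u - b 0%N)) / (ev b u * b 0%N).
  by move: (ev a u) (ev b u) eb => x y yn; field; rewrite yn b0.
rewrite nmM nmV nmM ltr_pdivrMr; last by rewrite mulr_gt0 // nm_gt0.
apply: (@le_lt_trans _ _ (X * nm u)).
  apply: le_trans (nmD _ _) _; rewrite nmN !nmM -/c mulrDl -!mulrA.
  by apply: lerD; apply: ler_wpM2l; rewrite ?nm_ge0.
rewrite -/c in nb *; have h2 : e * (c / 2) * c < e * nm (ev b u) * c.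
  by rewrite ltr_pM2r // ltr_pM2l.
move: h2 u3; rewrite expr2; nra.
Qed.

Let Qcont z0 (e : R) : 0 < e -> exists2 d : R, 0 < d & forall z, nm (z - z0) < d -> nm (Q z - Q z0) < e.
Proof.
move=> e0; have [z1 [s [a [b [Qz [sa sb] [fa fb] ab [bs Qs]]]]]] := local z0.
have sh (g : nat -> C) m r : (forall r, 0 <= r -> sm g r) -> 0 <= r -> sm (fun n => g (n + m)%N) r.
  move=> sg r0; apply: (@sm_le _ _ r (r + 1)); first by lra.
  by apply: sm_shift; [lra | apply: sg; lra].
have E (g : nat -> C) u : (forall r, 0 <= r -> sm g r) -> (forall i, (i < s)%N -> g i = 0) ->
    ev g u = u ^+ s * ev (fun n => g (n + s)%N) u.
  move=> sg g0; rewrite (@ev_shift _ g u s (sg _ (nm_ge0 u)) (sh g s _ sg (nm_ge0 u))).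
  by rewrite /psum big1 ?add0r // => i _; rewrite g0 ?mul0r.
have [d d0 dP] := ratio_cont (sh a s 1 sa ler01) (sh b s 1 sb ler01) bs e0.
exists d => // z zd; have -> : z = z0 + (z - z0) by rewrite addrC subrK.
have -> : Q z0 = Q z1 by have := Qz 0; rewrite !addr0.
rewrite Qz Qs; move: (z - z0) zd => u ud; have [h1 h2] := dP u ud.
have [->|u0] := eqVneq u 0; first by rewrite addr0 Qs subrr nm0.
rewrite !add0n in h2; rewrite /Q fa fb.
rewrite (E a u sa (fun i h => (ab i h).1)) (E b u sb (fun i h => (ab i h).2)).
rewrite mulf_eq0 expf_eq0 (negbTE u0) andbF (negbTE h1) /=.
by rewrite invfM mulrACA divff ?expf_neq0 // mul1r.
Qed.

(** Having periods 1 and t, the quotient takes all its values on a closed period parallelogram,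
    parametrised by the unit square, where continuity yields a maximum. *)
Let Qmax : exists z0, forall z, nm (Q z) <= nm (Q z0).
Proof.
pose g (x : R * R) : R := nm (Q (x.1%:C + x.2%:C * t)).
have [||| [s u] _ suP] := @compact_EVT_max (R * R)%type R g (`[0, 1] `*` `[0, 1]).
- by exists (0, 0); split; rewrite /= in_itv /= lexx ler01.
- by apply: compact_setX; apply: segment_compact.
- apply: continuous_subspaceT => -[x y].
  apply/cvgrPdist_lt => e e0; have [d d0 dP] := Qcont (x%:C + y%:C * t) e0.
  have dt : 0 < d / (1 + nm t) by rewrite divr_gt0 //; have := nm_ge0 t; lra.
  exists (ball x (d / (1 + nm t)), ball y (d / (1 + nm t))).
    by split; apply: nbhsx_ballx.
  move=> [x' y'] /= []; rewrite /ball /= => hx hy; rewrite /g /=.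
  have : nm (Q (x'%:C + y'%:C * t) - Q (x%:C + y%:C * t)) < e.
    apply: dP; have -> : x'%:C + y'%:C * t - (x%:C + y%:C * t) = (x' - x)%:C + (y' - y)%:C * t.
      by rewrite !rmorphB /=; ring.
    apply: le_lt_trans (nmD _ _) _; rewrite nmM !nmR (distrC x') (distrC y').
    rewrite ltr_pdivlMr in hx; last by have := nm_ge0 t; lra.
    rewrite ltr_pdivlMr in hy; last by have := nm_ge0 t; lra.
    have := nm_ge0 t; move: hx hy (normr_ge0 (x - x')) (normr_ge0 (y - y')).
    move: (nm t) `|x - x'| `|y - y'| => T X Y; nra.
  move: (Q _) (Q _) => A B; apply: le_lt_trans.
  rewrite ler_norml; have := nmBD A B; have := nmBD B A; rewrite (nmB B A); lra.
exists (s%:C + u%:C * t) => z.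
pose y := complex.Im z / complex.Im t; pose x := complex.Re z - y * complex.Re t.
have zE : z = x%:C + y%:C * t.
  rewrite /x; have : y * complex.Im t = complex.Im z by rewrite divfK // gt_eqF.
  case: (z) (t) => [z1 z2] [t1 t2] /= h; simpc; rewrite /= h; congr (_ +i* _); ring.
have -> : z = ((x - (Num.floor x)%:~R)%:C + (y - (Num.floor y)%:~R)%:C * t)
    + ((Num.floor y)%:~R * t + (Num.floor x)%:~R).
  by rewrite {1}zE !rmorphB /= !rmorph_int; ring.
rewrite Qper; apply: (suP (_, _)); rewrite inE; split; rewrite /= in_itv.
  change (0 <= x - (Num.floor x)%:~R <= 1).
  by have /andP[] := floor_itv x; rewrite intrD; lra.
change (0 <= y - (Num.floor y)%:~R <= 1).
by have /andP[] := floor_itv y; rewrite intrD; lra.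
Qed.

(** Liouville's argument: at a point where |P / F| is maximal, with value c, P and c F have the same
    leading coefficient while |P| <= |c| |F| everywhere. Then [max_modulus_coef] equates all
    coefficients. *)
Lemma quasi_periodic_unique : exists c, forall z, P z = c * F z.
Proof.
have [z0 max0] := Qmax.
have [z1 [s [a [b [Qz [sa sb] [fa fb] ab [bs Qs]]]]]] := local z0.
have Q01 : Q z0 = Q z1 by have := Qz 0; rewrite !addr0.
exists (Q z1).
have PF z : nm (P z) <= nm (Q z1) * nm (F z).
  have [Fz|Fz] := eqVneq (F z) 0.
    have [m [n zE]] := F0 Fz.
    have : P z == 0 by rewrite zE -[_ + _]add0r zperP Pp ev0 p0.
    by move/eqP=> ->; rewrite nm0 mulr_ge0 ?nm_ge0.
  have := max0 z; rewrite Q01 {1}/Q (negbTE Fz) nmM nmV ler_pdivrMr ?nm_gt0 //.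
have [Q0|Q0] := eqVneq (Q z1) 0.
  move=> z; have := PF z; rewrite Q0 nm0 !mul0r => h; apply/eqP; rewrite -nm_eq0.
  by rewrite eq_le h nm_ge0.
have co := @max_modulus_coef R a b (Q z1) s sa sb Q0 _ bs _ _.
have {}co n : a n = Q z1 * b n.
  apply: co => [i /ab[] //|i|u]; last by rewrite -fa -fb.
  rewrite leq_eqVlt => /orP[/eqP ->|/ab[-> ->]]; last by rewrite mulr0.
  by rewrite Qs divfK.
move: (Q z1) co => c co z; have -> : z = z1 + (z - z1) by rewrite addrC subrK.
rewrite fa fb; have -> : a = (fun n => c * b n) by apply/funext => n; exact: co.
by rewrite (ev_scale _ (sb _ (nm_ge0 _))).
Qed.

End QuasiPeriodic.

(** * The inversion formula of the theta function *)

Section ThetaInversion.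
Variable R : realType.
Local Notation C := R[i].
Implicit Types (t z : C).

Lemma Im_inv t : 0 < complex.Im t -> 0 < complex.Im (- t^-1).
Proof.
case: t => a b /= b0; rewrite opprK divr_gt0 //.
by rewrite ltr_wpDl ?sqr_ge0 // exprn_gt0.
Qed.

Lemma Im_neq0 t : 0 < complex.Im t -> t != 0.
Proof. by move=> t0; apply/eqP => h; rewrite h ltxx in t0. Qed.

Lemma phiBt t z : 0 < complex.Im t -> phi t (z - t) = - ex (z - t / 2) * phi t z.
Proof.
move=> t0; have h := phiDt (z - t) t0; rewrite subrK in h.
rewrite h mulrA mulrNN -exD (_ : z - t / 2 + (- (z - t) - t / 2) = 0) ?ex0 ?mul1r //.
by field.
Qed.

(** Splitting off the factor 1 - ex u of the product leaves ex(-u/2) - ex(u/2), with the simple zero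
    and its derivative, times an even-handed quotient that is 1 at u = 0. *)
Lemma phi_expansion0 t : 0 < complex.Im t -> exists a : nat -> C,
  [/\ forall r, 0 <= r -> sm a r, forall u, phi t u = ev a u, a 0%N = 0
    & a 1%N = - ((pi *+ 2)%:C * 'i)].
Proof.
move=> t0; have q1 : nm (ex t) < 1 by rewrite nm_ex_lt1.
have Gn := G_neq0 q1 q1.
have eg c := @entire_comp_ex R _ c t 0 (fun r => @sm_gc R _ r q1).
have [h sh fh] := entireZ (G (ex t) (ex t) ^+ 2)^-1 (entireM (eg 1) (eg (-1))).
pose d n : C := exc (- 2^-1) n + - 1 * exc 2^-1 n.
have sd r : 0 <= r -> sm d r.
  by move=> r0; apply: sm_add => //; [apply: sm_exc | apply: sm_scale; apply: sm_exc].
have ed u : ev d u = ex (- 2^-1 * u) - ex (2^-1 * u).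
  have n0 := nm_ge0 u.
  rewrite (ev_add (sm_exc (- 2^-1) n0) (sm_scale (-1) (sm_exc 2^-1 n0))).
  by rewrite (ev_scale (-1) (sm_exc 2^-1 n0)) !ev_exc mulN1r.
have d0 : d 0%N = 0 by rewrite /d /exc !expr0 !mulr1 mulN1r subrr.
have d1 : d 1%N = - ((pi *+ 2)%:C * 'i).
  by rewrite /d /exc !expr1 /expc (_ : 1`! = 1%N) // invr1; field.
have h0 : h 0%N = 1.
  have := fh 0; rewrite ev0 => <-; rewrite -!GE !addr0 !mulr0 !add0r -expr2 mulVf //.
  by rewrite expf_neq0.
exists (conv d h); split.
- by move=> r r0; apply: sm_conv; auto.
- move=> u; rewrite (ev_conv (sd _ (nm_ge0 u)) (sh _ (nm_ge0 u))) ed -fh -!GE add0r.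
  have -> : ex (1 * u + t) = ex t * ex u by rewrite exD mul1r mulrC.
  have -> : ex (-1 * u + t) = ex t / ex u by rewrite exD mulN1r exN mulrC.
  rewrite phi.unlock /th (G_rec (ex u) q1).
  have -> : - 2^-1 * u = - (u / 2) by rewrite mulNr mulrC.
  have -> : 2^-1 * u = u / 2 by rewrite mulrC.
  have -> : ex (u / 2) = ex (- (u / 2)) * ex u by rewrite -exD; congr ex; field.
  move: (G (ex t) (ex t * ex u)) (G (ex t) (ex t / ex u)) => A B.
  move: (G (ex t) (ex t)) (ex u) (ex (- (u / 2))) Gn => D X Y Dn.
  by field.
- by rewrite /conv big_ord1 d0 mul0r.
- by rewrite /conv big_ord_recl big_ord1 /= d0 mul0r add0r subn1 /= h0 mulr1.
Qed.

(** Moved to one side, t phi(-1/t, z/t) times a Gaussian has the same multipliers as [phi t] under z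
    + 1 and z + t, so the two are proportional. Both have derivative -2 pi i at 0, so the constant
    is 1. *)
Lemma phi_inv t z : 0 < complex.Im t ->
  t * phi (- t^-1) (z / t) = ex (z ^+ 2 / (2 * t)) * phi t z.
Proof.
move=> t0; have t'0 := Im_inv t0; have tn := Im_neq0 t0.
pose t' := - t^-1; pose P z := t * (ex (- (2 * t)^-1 * z ^+ 2) * phi t' (t^-1 * z + 0)).
have P1 w : P (w + 1) = - P w.
  rewrite /P !addr0; have -> : t^-1 * (w + 1) = t^-1 * w - t' by rewrite /t'; ring.
  rewrite (phiBt (t^-1 * w) t'0) -/t'.
  have -> : - (2 * t)^-1 * (w + 1) ^+ 2 = - (2 * t)^-1 * w ^+ 2 - (t^-1 * w - t' / 2).
    by rewrite /t'; field.
  rewrite (exD (- (2 * t)^-1 * w ^+ 2)) (exN (t^-1 * w - t' / 2)).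
  move: (ex_neq0 (t^-1 * w - t' / 2)); move: (ex (t^-1 * w - t' / 2)) (ex (_ * w ^+ 2)) (phi t' _).
  by move=> A B D n0; field.
have P2 w : P (w + t) = - ex (- w - t / 2) * P w.
  rewrite /P !addr0; have -> : t^-1 * (w + t) = t^-1 * w + 1 by field.
  rewrite phiD1.
  have -> : - (2 * t)^-1 * (w + t) ^+ 2 = - (2 * t)^-1 * w ^+ 2 + (- w - t / 2) by field.
  by rewrite exD; ring.
have entP z0 : entire_at P z0.
  apply: entireZ; apply: entireM; first exact: entire_ex_sqr.
  by apply: entire_lin; apply: phi_entire.
have [f [sf Ff f0 f1]] := phi_expansion0 t0.
have [g [sg Fg g0 g1]] := phi_expansion0 t'0.
have [S sS fS] := entire_ex_sqr (- (2 * t)^-1) 0.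
have S0 : S 0%N = 1 by have := fS 0; rewrite ev0 => <-; rewrite addr0 expr0n mulr0 ex0.
pose g' n := g n * t^-1 ^+ n.
have sg' r : 0 <= r -> sm g' r.
  move=> r0; have [B BP] := sg _ (mulr_ge0 (nm_ge0 t^-1) r0); exists B => N; apply: le_trans (BP N).
  by apply: ler_sum => i _; rewrite nmM nmX exprMn mulrA.
have Eg' u : ev g' u = ev g (t^-1 * u).
  apply: ev_unique; apply: tends_ext (evP (sg _ (nm_ge0 (t^-1 * u)))) => N.
  by apply: eq_bigr => i _; rewrite exprMn mulrA.
pose p n := t * conv S g' n.
have sp r : 0 <= r -> sm p r by move=> r0; apply: sm_scale; apply: sm_conv; auto.
have Pp u : P u = ev p u.
  rewrite (ev_scale t (sm_conv (nm_ge0 u) (sS _ (nm_ge0 u)) (sg' _ (nm_ge0 u)))).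
  by rewrite (ev_conv (sS _ (nm_ge0 u)) (sg' _ (nm_ge0 u))) -fS Eg' -Fg /P add0r addr0.
have p0 : p 0%N = 0 by rewrite /p /conv big_ord1 /g' g0 mul0r !mulr0.
have p1 : p 1%N = - ((pi *+ 2)%:C * 'i).
  rewrite /p /conv big_ord_recl big_ord1 /= /g' g0 !subn0 S0 expr1 g1 mul0r mulr0 addr0.
  by field.
have fn : f 1%N != 0.
  rewrite f1 oppr_eq0 mulf_neq0 //.
    by rewrite -(rmorph0 (real_complex R)) (inj_eq (@complexI R)) mulrn_eq0 /= gt_eqF ?pi_gt0.
  by rewrite eq_complex /= oner_eq0 andbF.
have m0 w : - ex (- w - t / 2) != 0 by rewrite oppr_eq0 ex_neq0.
have [c cP] := @quasi_periodic_unique R t P (phi t) _ t0 m0 entP (fun z0 => phi_entire z0 t0) P1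
  (phiD1 t) P2 (fun w => phiDt w t0) (fun w => @phi_eq0 R t w t0) p f sp sf Pp Ff p0 f0 fn.
have c1 : c = 1.
  have := ev_coef1 sp sf p0 f0 (c := c); rewrite p1 -f1.
  have h u : ev p u = c * ev f u by rewrite -Pp -Ff.
  by move=> /(_ h) h2; apply: (mulIf fn); rewrite -h2 mul1r.
have e : ex (z ^+ 2 / (2 * t)) * ex (- (2 * t)^-1 * z ^+ 2) = 1.
  by rewrite -exD mulNr [_ / _]mulrC subrr ex0.
have := cP z; rewrite c1 mul1r => <-; rewrite /P addr0 [t^-1 * z]mulrC [RHS]mulrCA.
by rewrite [ex _ * (ex _ * _)]mulrA e mul1r.
Qed.

End ThetaInversion.

(** * Formal power series and partitions *)

Section FormalSeries.
Variable K : comNzRingType.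
Implicit Types (a b : nat -> K) (p q : {poly K}).

(** Identities between coefficient sequences are inherited from the polynomial ring, since each
    coefficient depends on a truncation only. *)
Definition rep n a p := forall k, (k <= n)%N -> p`_k = a k.

Definition shift_seq s a n : K := if (n < s)%N then 0 else a (n - s)%N.
Definition delta n : K := (n == 0%N)%:R.
Fixpoint cpow a k : nat -> K := if k is j.+1 then conv a (cpow a j) else delta.

Lemma rep_conv n a b p q : rep n a p -> rep n b q -> rep n (conv a b) (p * q).
Proof.
move=> ha hb k kn; rewrite coefM /conv; apply: eq_bigr => i _.
by rewrite ha ?hb //; have := ltn_ord i; lia.
Qed.

Lemma rep_shift n s a p : rep n a p -> rep n (shift_seq s a) ('X^s * p).
Proof.
move=> ha k kn; rewrite coefXnM /shift_seq; case: ifP => // _; apply: ha; lia.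
Qed.

Lemma rep_stretch n k a p : (0 < k)%N -> rep n a p -> rep n (stretch k a) (p \Po 'X^k).
Proof.
move=> k0 ha i lin; rewrite coef_comp_poly_Xn // /stretch; case: ifP => // _; apply: ha.
exact: leq_trans (leq_div _ _) lin.
Qed.

Lemma rep_delta n : rep n delta 1.
Proof. by move=> k _; rewrite coef1. Qed.

Lemma rep_pow n a p k : rep n a p -> rep n (cpow a k) (p ^+ k).
Proof.
move=> ha; elim: k => [|k IH]; first exact: rep_delta.
by rewrite exprS; apply: rep_conv.
Qed.

Lemma rep_tr n a : rep n a (\poly_(i < n.+1) a i).
Proof. by move=> k kn; rewrite coef_poly ltnS kn. Qed.

Lemma rep_eq a b : (forall n, exists2 p, rep n a p & rep n b p) -> a =1 b.
Proof. by move=> h n; have [p ha hb] := h n; rewrite -(ha n) // hb. Qed.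

Lemma rep_ext n a b p : a =1 b -> rep n a p -> rep n b p.
Proof. by move=> ab ha k kn; rewrite ha // ab. Qed.

Lemma convC a b : conv a b =1 conv b a.
Proof.
apply: rep_eq => n; have ha := @rep_tr n a; have hb := @rep_tr n b.
by eexists; [apply: rep_conv ha hb | rewrite mulrC; apply: rep_conv].
Qed.

Lemma convA a b c : conv a (conv b c) =1 conv (conv a b) c.
Proof.
apply: rep_eq => n; have ha := @rep_tr n a; have hb := @rep_tr n b; have hc := @rep_tr n c.
by eexists; [apply: rep_conv ha (rep_conv hb hc) | rewrite mulrA; apply: rep_conv => //; apply: rep_conv].
Qed.

Lemma conv_delta a : conv a delta =1 a.
Proof.
apply: rep_eq => n; have ha := @rep_tr n a.
by eexists; [apply: rep_conv ha (@rep_delta n) | rewrite mulr1].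
Qed.

Lemma eq_conv a b a' b' : a =1 a' -> b =1 b' -> conv a b =1 conv a' b'.
Proof. by move=> ha hb n; apply: eq_bigr => i _; rewrite ha hb. Qed.

Lemma conv_shift s a b : conv (shift_seq s a) b =1 shift_seq s (conv a b).
Proof.
apply: rep_eq => n; have ha := @rep_tr n a; have hb := @rep_tr n b.
by eexists; [apply: rep_conv (rep_shift s ha) hb | rewrite -mulrA; apply/rep_shift/rep_conv].
Qed.

Lemma conv_stretch k a b : (0 < k)%N -> conv (stretch k a) (stretch k b) =1 stretch k (conv a b).
Proof.
move=> k0; apply: rep_eq => n; have ha := @rep_tr n a; have hb := @rep_tr n b.
eexists; first exact: rep_conv (rep_stretch k0 ha) (rep_stretch k0 hb).
by rewrite -comp_polyM; apply/rep_stretch/rep_conv.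
Qed.

Lemma stretch_delta k : (0 < k)%N -> stretch k delta =1 delta.
Proof.
move=> k0 n; rewrite /stretch /delta; case: ifP => [kn|]; first by rewrite -{2}(divnK kn) muln_eq0 (gtn_eqF k0) orbF.
by case: n => // ; rewrite dvdn0.
Qed.

Lemma conv_cpow_inv a b k : conv a b =1 delta -> conv (cpow a k) (cpow b k) =1 delta.
Proof.
move=> ab; apply: rep_eq => n; have ha := @rep_tr n a; have hb := @rep_tr n b.
eexists; first exact: rep_conv (rep_pow k ha) (rep_pow k hb).
rewrite -exprMn; have := rep_pow k (rep_ext ab (rep_conv ha hb)); apply: rep_ext.
by move=> m; elim: k m => //= k IH m; rewrite (eq_conv (fun _ => erefl) IH) conv_delta.
Qed.

Lemma conv_cancel s w a b : (forall i, (i < s)%N -> w i = 0) -> w s = 1 ->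
  conv w a =1 conv w b -> a =1 b.
Proof.
move=> w0 w1 h n; elim/ltn_ind: n => n IH.
have E c : conv w c (s + n)%N = c n + \sum_(i < n) w (s + i.+1)%N * c (n - i.+1)%N.
  rewrite /conv -addnS big_split_ord /= big1 ?add0r => [|i _]; last by rewrite w0 ?mul0r.
  rewrite big_ord_recl /= addn0 w1 mul1r addKn; congr (_ + _); apply: eq_bigr => i _.
  by rewrite /bump /= add1n subnDl.
have := h (s + n)%N; rewrite !E => /eqP.
suff -> : \sum_(i < n) w (s + i.+1)%N * a (n - i.+1)%N = \sum_(i < n) w (s + i.+1)%N * b (n - i.+1)%N.
  by rewrite (inj_eq (addIr _)) => /eqP.
by apply: eq_bigr => i _; rewrite IH //; have := ltn_ord i; lia.
Qed.

(** The operator U_k, which keeps the coefficients of index divisible by k, is linear over series in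
    X^k. *)
Lemma conv_stretch_mul k a b n : (0 < k)%N ->
  conv (stretch k a) b (k * n)%N = conv a (fun m => b (k * m)%N) n.
Proof.
move=> k0; rewrite /conv big_ord_recr /= subnn.
rewrite (sum_stretch a (fun i => b (k * n - i)%N)) // big_ord_recr /= subnn muln0; congr (_ + _).
  by apply: eq_bigr => i _; rewrite -mulnBr.
by rewrite /stretch dvdn_mulr // mulKn.
Qed.

End FormalSeries.

Section Euler.

(** Infinite products are cut after n factors, and in [partp] the geometric series after the power
    n; neither cut affects the coefficient of X^n. *)
Definition eulp n : {poly int} := \prod_(i < n) (1 - 'X^(i.+1)).
Definition eul n : int := (eulp n)`_n.
Definition partp n : {poly int} := \prod_(i < n) \sum_(j < n.+1) 'X^(i.+1 * j).
Definition part n : int := (partp n)`_n.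

Let eqp n (p q : {poly int}) := forall k, (k <= n)%N -> p`_k = q`_k.

Let eqpM n p q p' q' : eqp n p p' -> eqp n q q' -> eqp n (p * q) (p' * q').
Proof.
move=> hp hq k kn; rewrite !coefM; apply: eq_bigr => i _.
by rewrite hp ?hq //; have := ltn_ord i; lia.
Qed.

Let eqp_prod n (I : finType) (F G : I -> {poly int}) : (forall i, eqp n (F i) (G i)) ->
  eqp n (\prod_i F i) (\prod_i G i).
Proof.
move=> h; apply: (big_ind2 (eqp n)) => [k //|p p' q q' hp hq|i _]; last exact: h.
exact: eqpM.
Qed.

Lemma rep_eulp n m : (n <= m)%N -> rep n eul (eulp m).
Proof.
move=> nm k kn; have km := leq_trans kn nm; rewrite -(subnKC km).
elim: (m - k)%N => [|d IH]; first by rewrite addn0.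
rewrite addnS /eulp big_ord_recr /= mulrBr mulr1 coefB coefMXn ifT ?subr0 //.
by rewrite ltnS leq_addr.
Qed.

Let geom n i : (i < n)%N -> eqp n ((\sum_(j < n.+1) 'X^(i.+1 * j)) * (1 - 'X^(i.+1))) 1.
Proof.
move=> _ k kn; have -> : (\sum_(j < n.+1) 'X^(i.+1 * j)) * (1 - 'X^(i.+1)) = 1 - 'X^(i.+1 * n.+1) :> {poly int}.
  have := subrX1 ('X^(i.+1) : {poly int}) n.+1; rewrite -exprM => h.
  rewrite mulrC -[LHS]opprK -mulNr opprB; under eq_bigr do rewrite exprM.
  by rewrite -h opprB.
by rewrite coefB coefXn (_ : (k == _) = false) ?subr0 //; apply/negbTE; nia.
Qed.

Lemma partp_eulp n : eqp n (partp n * eulp n) 1.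
Proof.
rewrite /partp /eulp -big_split /=.
rewrite [X in eqp n _ X](_ : _ = \prod_(i < n) 1); last by rewrite big1.
by apply: eqp_prod => i; apply: geom.
Qed.

Lemma rep_partp n m : (n <= m)%N -> rep n part (partp m).
Proof.
move=> nm k kn; rewrite /part.
have km := leq_trans kn nm.
have h1 : eqp k (partp m * (partp k * eulp k)) (partp m).
  by rewrite -[X in eqp k _ X]mulr1; apply: eqpM => //; apply: partp_eulp.
have h2 : eqp k (partp k * (partp m * eulp m)) (partp k).
  rewrite -[X in eqp k _ X]mulr1; apply: eqpM => // i ik.
  by apply: partp_eulp; apply: leq_trans km.
have h3 : eqp k (eulp k) (eulp m).
  by move=> i ik; rewrite (rep_eulp (leqnn k)) // (rep_eulp km).
rewrite -(h1 k) // -(h2 k) // mulrCA.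
have h4 : eqp k (partp m * eulp k) (partp m * eulp m) by apply: eqpM.
by rewrite (eqpM (n := k) (p' := partp k) _ h4).
Qed.

Lemma conv_part_eul : conv part eul =1 delta int.
Proof.
move=> n; have := rep_conv (rep_partp (leqnn n)) (rep_eulp (leqnn n)).
by move=> /(_ n (leqnn n)) <-; rewrite partp_eulp // coef1.
Qed.

Lemma part_ge0 n : 0 <= part n.
Proof.
suff h k : (partp n)`_k >= 0 by apply: h.
rewrite /partp; elim/big_ind: _ k => [k|p q hp hq k|i _ k].
- by rewrite coef1 ler0n.
- by rewrite coefM sumr_ge0 // => j _; rewrite mulr_ge0.
by rewrite coef_sum sumr_ge0 // => j _; rewrite coefXn ler0n.
Qed.

(** Expanding a product of truncated geometric series over all multiplicity functions counts the
    partitions; where 6 divides the part, the factor is 1. Multiplying by the Euler product leaves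
    just the factors 1 - X^(i+1) with 6 | i + 1, that is, the Euler product in X^6. *)
Lemma card_regular_partitions n :
  #|regular_partitions 6 n|%:Z = conv (stretch 6 eul) part n.
Proof.
pose P6 : {poly int} := \prod_(i < n) \sum_(j < n.+1)
   (if (6 %| i.+1)%N ==> (j == ord0) then 'X^(i.+1 * j) else 0).
have h1 : #|regular_partitions 6 n|%:Z = P6`_n.
  rewrite /P6 bigA_distr_bigA coef_sum -sum1_card -[_%:Z]natz natr_sum big_mkcond /=.
  apply: eq_bigr => f _; rewrite inE.
  have [/forallP h|/forallPn [i hi]] := boolP [forall i : 'I_n, (6 %| i.+1)%N ==> (f i == ord0)]; last first.
    by rewrite andbF (bigD1 i) //= ifN // mul0r coef0.
  have -> : \prod_(i < n) (if (6 %| i.+1)%N ==> (f i == ord0) then 'X^(i.+1 * f i) else 0) =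
      'X^(\sum_(i < n) i.+1 * f i) :> {poly int}.
    by rewrite -prodrXr; apply: eq_bigr => i _; rewrite h.
  by rewrite coefXn andbT eq_sym; case: eqP.
have h2 : eqp n (P6 * eulp n) (eulp n \Po 'X^6).
  pose S m : {poly int} := \prod_(i < m) (if (6 %| i.+1)%N then 1 - 'X^(i.+1) else 1).
  have S6 m : S (6 * m)%N = eulp m \Po 'X^6.
    rewrite /eulp rmorph_prod /=; elim: m => [|m IH]; first by rewrite /S muln0 !big_ord0.
    rewrite mulnS addnC /S big_split_ord /= -/(S (6 * m)%N) IH [RHS]big_ord_recr /=; congr (_ * _).
    rewrite big_ord_recr /= big1 ?mul1r => [|i _]; last first.
      by rewrite ifN // -addnS dvdn_addr ?dvdn_mulr // gtnNdvd //= ltnS ltn_ord.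
    rewrite -addnS (_ : (6 %| 6 * m + 6)%N); last by rewrite dvdn_addl // dvdn_mulr.
    rewrite [in RHS](rmorphB (comp_poly 'X^6)) rmorph1 /= comp_Xn_poly -exprM.
    by rewrite mulnS addnC.
  have SS m d : (n <= m)%N -> eqp n (S m) (S (m + d)%N).
    move=> nm; elim: d => [|d IH]; first by rewrite addn0.
    move=> k kn; rewrite addnS /S big_ord_recr /= -/(S _) IH //; case: ifP => _; last by rewrite mulr1.
    rewrite mulrBr mulr1 coefB coefMXn ifT ?subr0 //; lia.
  move=> k kn; rewrite -S6 (_ : (6 * n = n + 5 * n)%N); last by lia.
  rewrite -SS //; move: k kn; rewrite /P6 /eulp -big_split /=; apply: eqp_prod => i.
  case: ifP => d6; last first.
    by move=> k kn; rewrite (eq_bigr (fun j : 'I_n.+1 => 'X^(i.+1 * j))) ?geom // => j _; rewrite d6.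
  rewrite big_ord_recl /= muln0 big1 ?addr0 ?expr0 ?mul1r // => j _.
have h3 : eqp n (P6 * (partp n * eulp n)) P6.
  by rewrite -[X in eqp n _ X]mulr1; apply: eqpM => //; apply: partp_eulp.
rewrite h1 -(h3 n) // mulrCA mulrC.
have h4 : eqp n (P6 * eulp n * partp n) ((eulp n \Po 'X^6) * partp n) by apply: eqpM.
rewrite h4 //; apply: (rep_conv _ _ (leqnn n)); last exact: rep_partp.
by apply: rep_stretch => //; apply: rep_eulp.
Qed.

(* (1 - X^i)^q = 1 - X^(iq) in characteristic p for q a power of p *)
Lemma eul_frobenius p r k n : prime p -> odd p ->
  ((cpow eul (k * p ^ r) n)%:~R = (stretch (p ^ r) (cpow eul k) n)%:~R :> 'F_p).
Proof.
move=> pp po; set q := (p ^ r)%N.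
have q0 : (0 < q)%N by rewrite expn_gt0 prime_gt0.
have h1 := rep_pow (k * q) (rep_eulp (leqnn n)).
have h2 := rep_stretch q0 (rep_pow k (rep_eulp (leqnn n))).
rewrite -(h1 n) // -(h2 n) // -!(coef_map (intr : int -> 'F_p)) /=.
suff -> : map_poly (intr : int -> 'F_p) (eulp n ^+ (k * q)) =
  map_poly (intr : int -> 'F_p) (eulp n ^+ k \Po 'X^q) by [].
rewrite map_comp_poly map_polyXn !rmorphXn /= mulnC exprM; congr (_ ^+ k).
rewrite /eulp rmorph_prod /= -prodrXl (rmorph_prod (comp_poly 'X^q)) /=; apply: eq_bigr => i _.
rewrite !rmorphB !rmorph1 /= !map_polyXn comp_Xn_poly.
have pc : [pchar {poly 'F_p}].-nat q.
  rewrite pnatX; apply/orP; left; rewrite pnatE // pchar_poly; exact: pchar_Fp.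
rewrite exprDn_pchar // expr1n exprNn -signr_odd oddX po orbT expr1 mulN1r -!exprM.
by rewrite mulnC.
Qed.

End Euler.

(** * Theta values at torsion points *)

Section ProductIdentities.
Variable R : realType.
Local Notation C := R[i].
Implicit Types (q x t : C).

Lemma tends_prod (I : Type) (r : seq I) (U : I -> nat -> C) (L : I -> C) :
  (forall i, tends (U i) (L i)) ->
  tends (fun n => \prod_(i <- r) U i n) (\prod_(i <- r) L i).
Proof.
move=> h; elim: r => [|i r IH].
  by rewrite big_nil; apply: tends_ext (tends_cst 1) => n; rewrite big_nil.
rewrite big_cons; apply: tends_ext (tendsM (h i) IH) => n; rewrite big_cons //.
Qed.

Lemma nmX_lt q N : (0 < N)%N -> nm q < 1 -> nm (q ^+ N) < 1.
Proof. by move=> N0 q1; rewrite nmX exprn_ilt1 ?nm_ge0 // -lt0n. Qed.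

Lemma G_roots (N : nat) (w : C) q x : (0 < N)%N -> nm q < 1 ->
  (forall y, \prod_(j < N) (1 - w ^+ j * y) = 1 - y ^+ N) ->
  \prod_(j < N) G q (w ^+ j * x) = G (q ^+ N) (x ^+ N).
Proof.
move=> N0 q1 hw.
apply: (tends_unique (tends_prod (index_enum 'I_N) (fun j => tends_G (w ^+ j * x) q1))).
apply: tends_ext (tends_G (x ^+ N) (nmX_lt N0 q1)) => K.
rewrite exchange_big /=; apply: eq_bigr => n _.
rewrite -exprM mulnC exprM -exprMn -hw; apply: eq_bigr => j _; congr (1 - _); ring.
Qed.

Lemma G_split (N : nat) q x : (0 < N)%N -> nm q < 1 ->
  \prod_(j < N) G (q ^+ N) (q ^+ j * x) = G q x.
Proof.
move=> N0 q1.
apply: (tends_unique (tends_prod (index_enum 'I_N) (fun j => tends_G (q ^+ j * x) (nmX_lt N0 q1)))).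
have sP M : exists K, forall n, (K <= n)%N -> (M <= N * n)%N.
  by exists M => n Mn; apply: (leq_trans Mn); rewrite leq_pmull.
apply: tends_ext (tends_sub sP (tends_G x q1)) => K /=.
rewrite exchange_big /=; elim: K => [|K IH]; first by rewrite muln0 !big_ord0.
rewrite mulnS addnC big_split_ord /= IH [RHS]big_ord_recr /=; congr (_ * _).
by apply: eq_bigr => j _; rewrite exprD exprM mulrA.
Qed.

Lemma G_sqr q x : nm q < 1 -> G q x * G q (- x) = G (q ^+ 2) (x ^+ 2).
Proof.
move=> q1; rewrite -(@G_roots 2 (-1) q x) //.
  by rewrite !big_ord_recl big_ord0 /= expr0 expr1 mul1r mulN1r [_ * 1]mulr1.
by move=> y; rewrite !big_ord_recl big_ord0 /= expr0 expr1; ring.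
Qed.

Lemma G_split2 q x : nm q < 1 -> G (q ^+ 2) x * G (q ^+ 2) (q * x) = G q x.
Proof.
move=> q1; rewrite -(@G_split 2 q x) // !big_ord_recl big_ord0 /= expr0 expr1.
by rewrite mul1r [_ * 1]mulr1.
Qed.

Definition om : C := ex (1 / 3).

Lemma om3 : om ^+ 3 = 1 :> C.
Proof. by rewrite /om -exMn (_ : 3%:R * (1 / 3) = 1) ?ex1 //; field. Qed.

Lemma om_neq1 : om != 1.
Proof.
apply/eqP => /ex_eq1 [n]; move/(congr1 (fun x => x * 3)); rewrite divfK ?pnatr_eq0 // => h.
have : (1 : int)%:~R = (n * 3)%:~R :> C by rewrite intrM -h.
by move/intr_inj; lia.
Qed.

Lemma om2 : om ^+ 2 = - 1 - om.
Proof.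
have h : (om - 1) * (om ^+ 2 + om + 1) = 0 by rewrite -[RHS](subrr 1) -{3}om3; ring.
move/eqP: h; rewrite mulf_eq0 subr_eq0 (negbTE om_neq1) /= => /eqP h.
by apply/eqP; rewrite -subr_eq0 -h; apply/eqP; ring.
Qed.

Lemma G_cube q x : nm q < 1 -> G q x * (G q (om * x) * G q (om ^+ 2 * x)) = G (q ^+ 3) (x ^+ 3).
Proof.
move=> q1; rewrite -(@G_roots 3 om q x) //.
  by rewrite !big_ord_recl big_ord0 /= expr0 expr1 mul1r [_ * 1]mulr1.
move=> y; rewrite !big_ord_recl big_ord0 /= expr0 expr1 /bump /= add1n om2.
have -> : (1 - 1 * y) * ((1 - om * y) * ((1 - (-1 - om) * y) * 1)) =
   1 - y ^+ 3 + (1 + om + om ^+ 2) * (y ^+ 3 - y ^+ 2) by ring.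
by rewrite om2; ring.
Qed.

Lemma G_split3 q x : nm q < 1 ->
  G (q ^+ 3) x * (G (q ^+ 3) (q * x) * G (q ^+ 3) (q ^+ 2 * x)) = G q x.
Proof.
move=> q1; rewrite -(@G_split 3 q x) // !big_ord_recl big_ord0 /= expr0 expr1.
by rewrite mul1r [_ * 1]mulr1.
Qed.

Lemma th_root q x : nm q < 1 -> th q x = (1 - x) * (G q (q * x) * G q (q / x)).
Proof. by move=> q1; rewrite /th (G_rec x q1) mulrA. Qed.

(** With r = q^(1/2) this is the classical theta_2 theta_3 theta_4 = 2 eta^3; it rests on Euler's
    (-q; q) (q; q^2) = 1. *)
Lemma th_2torsion (r : C) : nm r < 1 -> r != 0 ->
  th (r ^+ 2) (-1) * (th (r ^+ 2) r * th (r ^+ 2) (- r)) = 2 :> C.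
Proof.
move=> r1 r0; set q := r ^+ 2; have q1 : nm q < 1 by apply: nmX_lt.
have Gq : G q q != 0 by apply: G_neq0.
have h : G q (- q) * (G q r * G q (- r)) = 1.
  apply: (mulfI Gq); rewrite [G q q * (G q (- q) * _)]mulrA (G_sqr q q1) (G_sqr r q1) -/q mulrC.
  by rewrite expr2 (G_split2 q q1) mulr1.
rewrite th_root // /th mulrN1 invrN1 mulrN1 opprK.
have -> : q / r = r by rewrite /q expr2 mulfK.
have -> : q / - r = - r by rewrite /q expr2 invrN mulrN mulfK.
transitivity (2 * (G q (- q) * (G q r * G q (- r))) ^+ 2); first by ring.
by rewrite h expr1n mulr1.
Qed.

(** Four points represent the nonzero 3-torsion up to sign. [G_cube] multiplies over third roots of
    unity, [G_split3] recombines the results, and all Euler products cancel. *)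
Lemma th_3torsion (r : C) : nm r < 1 -> r != 0 ->
  th (r ^+ 3) om * (th (r ^+ 3) r * (th (r ^+ 3) (om * r) * th (r ^+ 3) (om ^+ 2 * r))) = 1 - om.
Proof.
move=> r1 r0; set q := r ^+ 3; have q1 : nm q < 1 by apply: nmX_lt.
have q31 : nm (q ^+ 3) < 1 by apply: nmX_lt.
have Gq : G q q != 0 by apply: G_neq0.
have o0 : om != 0 by apply: ex_neq0.
have oV : om^-1 = om ^+ 2 by apply: (mulfI o0); rewrite mulfV // -exprS om3.
have o2V : (om ^+ 2)^-1 = om by rewrite -exprVn oV -exprM exprS om3 mulr1.
have h1 : G q r * (G q (om * r) * G q (om ^+ 2 * r)) = G (q ^+ 3) q by rewrite (G_cube r q1).
have h2 : G q (r ^+ 2) * (G q (om * r ^+ 2) * G q (om ^+ 2 * r ^+ 2)) = G (q ^+ 3) (q ^+ 2).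
  by rewrite (G_cube _ q1) /q -!exprM mulnC.
have h3 : G q q * (G q (om * q) * G q (om ^+ 2 * q)) = G (q ^+ 3) (q ^+ 3) by rewrite G_cube.
have h4 := G_split3 q q1.
rewrite th_root // /th.
have -> : q / r = r ^+ 2 by rewrite /q exprS mulrC mulKf.
have -> : q / (om * r) = om ^+ 2 * r ^+ 2 by rewrite invfM oV /q; field.
have -> : q / (om ^+ 2 * r) = om * r ^+ 2 by rewrite invfM o2V /q; field.
have -> : q / om = om ^+ 2 * q by rewrite oV mulrC.
rewrite [q * om]mulrC; apply: (mulfI Gq).
transitivity ((1 - om) * (G q q * (G q (om * q) * G q (om ^+ 2 * q))) *
   (G q r * (G q (om * r) * G q (om ^+ 2 * r)))
 * (G q (r ^+ 2) * (G q (om * r ^+ 2) * G q (om ^+ 2 * r ^+ 2)))).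
  move: (G q q) (G q (om * q)) (G q (om ^+ 2 * q)) (G q r) (G q (om * r)) (G q (om ^+ 2 * r)).
  move: (G q (r ^+ 2)) (G q (om * r ^+ 2)) (G q (om ^+ 2 * r ^+ 2)) => A1 A2 A3 A4 A5 A6 A7 A8 A9.
  by ring.
rewrite h1 h2 h3 mulrC -[in RHS]h4 -expr2 -exprSr.
by move: (G _ q) (G _ (q ^+ 2)) (G _ (q ^+ 3)) => A B D; ring.
Qed.

Definition ii : C := ex (1 / 4).

Lemma ii2 : ii ^+ 2 = -1.
Proof. by rewrite /ii -exMn -ex_half; congr ex; field. Qed.

(* the theta values whose product is eta(6t)/eta(t) up to eta powers *)
Lemma th_12torsion (r : C) : nm r < 1 -> r != 0 -> let q := r ^+ 2 in
  th q (- om ^+ 2) * (th q om * (th q ii * th q (ii * r))) * G q q =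
  (1 + om ^+ 2) * (1 - om) * (1 - ii) * G (q ^+ 6) (q ^+ 6).
Proof.
move=> r1 r0 q; have q1 : nm q < 1 by apply: nmX_lt.
have q21 : nm (q ^+ 2) < 1 by apply: nmX_lt.
have q31 : nm (q ^+ 3) < 1 by apply: nmX_lt.
have Gq : G q q != 0 by apply: G_neq0.
have Gq2 : G (q ^+ 2) (q ^+ 2) != 0 by apply: G_neq0.
have o0 : om != 0 by apply: ex_neq0.
have oV : om^-1 = om ^+ 2 by apply: (mulfI o0); rewrite mulfV // -exprS om3.
have o2V : (om ^+ 2)^-1 = om by rewrite -exprVn oV -exprM exprS om3 mulr1.
have i0 : ii != 0 by apply: ex_neq0.
have iV : ii^-1 = - ii by apply: (mulfI i0); rewrite mulfV // mulrN -expr2 ii2 opprK.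
have h1 : G q q * (G q (om * q) * G q (om ^+ 2 * q)) = G (q ^+ 3) (q ^+ 3) by rewrite G_cube.
have h2 : G q (- q) * (G q (- (om * q)) * G q (- (om ^+ 2 * q))) = G (q ^+ 3) (- q ^+ 3).
  by have := G_cube (- q) q1; rewrite !mulrN exprNn -signr_odd /= expr1 mulN1r.
have h3 : G (q ^+ 3) (q ^+ 3) * G (q ^+ 3) (- q ^+ 3) = G (q ^+ 6) (q ^+ 6).
  by rewrite (G_sqr _ q31) -!exprM.
have h4 : G q q * G q (- q) = G (q ^+ 2) (q ^+ 2) by rewrite G_sqr.
have h5 : G q (ii * q) * G q (- (ii * q)) = G (q ^+ 2) (- q ^+ 2).
  by rewrite (G_sqr _ q1) [(ii * q) ^+ 2]exprMn ii2 mulN1r.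
have h6 : G q (ii * r) * G q (- (ii * r)) = G (q ^+ 2) (- q).
  by rewrite (G_sqr _ q1) [(ii * r) ^+ 2]exprMn ii2 mulN1r.
have h7 : G (q ^+ 2) (- q) * G (q ^+ 2) (- q ^+ 2) = G q (- q).
  by rewrite -(G_split2 (- q) q1) mulrN -expr2.
rewrite (th_root (- om ^+ 2) q1) (th_root om q1) (th_root ii q1) /th.
have -> : q / (ii * r) = - (ii * r) by rewrite invfM iV /q; field.
rewrite iV oV invrN o2V opprK !mulrN ![q * _]mulrC.
apply: (mulfI Gq2); rewrite -{1}h4.
transitivity ((1 + om ^+ 2) * (1 - om) * (1 - ii) * (G q q * (G q (om * q) * G q (om ^+ 2 * q)))
 * (G q (- q) * (G q (- (om * q)) * G q (- (om ^+ 2 * q)))) * G q q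
 * (G q (ii * q) * G q (- (ii * q))) * (G q (ii * r) * G q (- (ii * r)))).
  by ring.
rewrite h1 h2 h5 h6 -h4 -h7 -h3.
move: (G (q ^+ 3) _) (G (q ^+ 3) _) (G q q) (G (q ^+ 2) _) (G (q ^+ 2) _) => A B D E F; ring.
Qed.

End ProductIdentities.

(** * Klein forms and powers of eta *)

Section ModularGroup.

(** Euclid's algorithm on the lower row: right translations reduce d modulo c, the inversion swaps
    the two entries, and |c| decreases. Negation of a matrix is the inversion applied twice. *)
Lemma SL2_ind (P : int -> int -> int -> int -> Prop) :
  P 1 0 0 1 ->
  (forall a b c d, a * d - b * c = 1 -> P a b c d -> P a (b + a) c (d + c)) ->
  (forall a b c d, a * d - b * c = 1 -> P a b c d -> P a (b - a) c (d - c)) ->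
  (forall a b c d, a * d - b * c = 1 -> P a b c d -> P b (- a) d (- c)) ->
  forall a b c d, a * d - b * c = 1 -> P a b c d.
Proof.
move=> P1 PT PV PS.
have PTn (n : int) a b c d : a * d - b * c = 1 -> P a b c d -> P a (b + n * a) c (d + n * c).
  have up (k : nat) : forall b d, a * d - b * c = 1 -> P a b c d -> P a (b + k%:Z * a) c (d + k%:Z * c).
    elim: k => [|k IH] b' d' h p; first by rewrite !mul0r !addr0.
    have := PT _ _ _ _ _ (IH b' d' h p); rewrite -addn1 PoszD !mulrDl !mul1r !addrA; apply.
    by rewrite -h; ring.
  have dn (k : nat) : forall b d, a * d - b * c = 1 -> P a b c d -> P a (b - k%:Z * a) c (d - k%:Z * c).
    elim: k => [|k IH] b' d' h p; first by rewrite !mul0r !subr0.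
    have := PV _ _ _ _ _ (IH b' d' h p); rewrite -addn1 PoszD !mulrDl !mul1r !opprD !addrA; apply.
    by rewrite -h; ring.
  case: n => k h p; first exact: up.
  by rewrite NegzE !mulNr; apply: dn.
have PN a b c d : a * d - b * c = 1 -> P a b c d -> P (- a) (- b) (- c) (- d).
  by move=> h p; apply: (PS b (- a) d (- c)); [rewrite -h; ring | apply: PS].
move=> a b c d; move: {2}`|c|%N (leqnn `|c|%N) => n; elim/ltn_ind: n a b c d => n IH a b c d cn h.
have [c0|c0] := eqVneq c 0.
  subst c; rewrite mulr0 subr0 in h.
  have [[a1 d1]|[a1 d1]] : (a = 1 /\ d = 1) \/ (a = -1 /\ d = -1).
    have := congr1 absz h; rewrite abszM => /eqP; rewrite muln_eq1 => /andP[/eqP ha _].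
    have a1 : a = 1 \/ a = -1 by lia.
    by case: a1 h => ->; rewrite ?mul1r ?mulN1r => h; [left|right]; split=> //; lia.
    by subst a d; have := PTn b 1 0 0 1 erefl P1; rewrite mulr1 mulr0 !add0r addr0.
  subst a d; have := PTn (- b) 1 0 0 1 erefl P1; rewrite mulr1 mulr0 !add0r addr0 => p.
  by have := PN _ _ _ _ _ p; rewrite opprK oppr0; apply; rewrite mulr0 subr0.
pose q := (d %/ c)%Z; pose r := (d %% c)%Z.
have dE : d = q * c + r := divz_eq d c.
have r0 : 0 <= r by apply: modz_ge0.
have rc : r < `|c| by apply: ltz_mod.
have h' : a * r - (b - q * a) * c = 1 by rewrite -h dE; ring.
have p : P (b - q * a) (- a) r (- c).
  by apply: (IH `|r|%N) => //; [lia | rewrite -h'; ring].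
have p2 : P a (b - q * a) c r.
  have := PN _ _ _ _ _ (PS _ _ _ _ _ p); rewrite !opprK; apply; rewrite -h'; ring.
by have := PTn q _ _ _ _ h' p2; rewrite subrK addrC -dE.
Qed.

End ModularGroup.

Section KleinForms.
Variable R : realType.
Local Notation C := R[i].
Implicit Types (t : C).

Definition mob (a b c d : int) t : C := (a%:~R * t + b%:~R) / (c%:~R * t + d%:~R).

Lemma aut_neq0 (a b c d : int) t : a * d - b * c = 1 -> 0 < complex.Im t ->
  c%:~R * t + d%:~R != 0.
Proof.
move=> h t0; apply/eqP => e.
have e1 : complex.Im (c%:~R * t + d%:~R) = c%:~R * complex.Im t.
  by case: t {t0 e} => x y; rewrite -!(rmorph_int (real_complex R)); simpc.
have c0 : c = 0.
  have : c%:~R * complex.Im t = 0 by rewrite -e1 e.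
  by move/eqP; rewrite mulf_eq0 (gt_eqF t0) orbF intr_eq0 => /eqP.
move: e; rewrite c0 mul0r add0r => /eqP; rewrite intr_eq0 => /eqP d0.
by rewrite c0 d0 !mulr0 in h.
Qed.

Lemma Im_div (z w : C) : complex.Im (z / w) * nm w ^+ 2 = complex.Im z * complex.Re w - complex.Re z * complex.Im w.
Proof.
have [->|w0] := eqVneq w 0; first by rewrite invr0 mulr0 nm0 expr0n /= !mulr0 subrr.
have : nm w ^+ 2 = complex.Re w ^+ 2 + complex.Im w ^+ 2.
  by apply: (@complexI R); rewrite rmorphXn /= -norm_nm sqr_normc; case: (w) => a b; simpc; rewrite !expr2; congr (_ +i* _); ring.
have : nm w ^+ 2 != 0 by rewrite expf_neq0 // nm_eq0.
case: z w {w0} => [a b] [c d] /= + E; rewrite E => n0; simpc; field; exact: n0.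
Qed.

Lemma Im_mob (a b c d : int) t : a * d - b * c = 1 -> 0 < complex.Im t -> 0 < complex.Im (mob a b c d t).
Proof.
move=> h t0; have w0 := aut_neq0 h t0.
have w1 : 0 < nm (c%:~R * t + d%:~R) ^+ 2 by rewrite exprn_gt0 // nm_gt0.
rewrite -(pmulr_lgt0 _ w1) Im_div.
have -> : complex.Im (a%:~R * t + b%:~R) * complex.Re (c%:~R * t + d%:~R) -
   complex.Re (a%:~R * t + b%:~R) * complex.Im (c%:~R * t + d%:~R) = (a * d - b * c)%:~R * complex.Im t.
  case: t {t0 w0 w1} => x y; rewrite -!(rmorph_int (real_complex R)); simpc => /=.
  by rewrite intrB !intrM; ring.
by rewrite h mul1r.
Qed.

Lemma mob_T (a b c d : int) t : mob a (b + a) c (d + c) t = mob a b c d (t + 1).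
Proof. by rewrite /mob !intrD; congr (_ / _); ring. Qed.

Lemma mob_V (a b c d : int) t : mob a (b - a) c (d - c) t = mob a b c d (t - 1).
Proof. by rewrite /mob !intrB; congr (_ / _); ring. Qed.

Lemma mob_S (a b c d : int) t : a * d - b * c = 1 -> 0 < complex.Im t ->
  mob b (- a) d (- c) t = mob a b c d (- t^-1).
Proof.
move=> h t0; have tn := Im_neq0 t0.
have h2 : b * (- c) - (- a) * d = 1 by rewrite -h; ring.
have w0 := aut_neq0 h2 t0; have w1 := aut_neq0 h (Im_inv t0).
rewrite /mob !intrN; rewrite intrN in w0; field.
by rewrite tn /= mulrN1 addrC w0.
Qed.

Lemma Im_addr t (r : R) : complex.Im (t + r%:C) = complex.Im t.
Proof. by case: t => x y /=; rewrite addr0. Qed.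

Lemma Im_add1 t : complex.Im (t + 1) = complex.Im t.
Proof. by case: t => x y /=; rewrite addr0. Qed.

Lemma Im_sub1 t : complex.Im (t - 1) = complex.Im t.
Proof. by case: t => x y /=; rewrite oppr0 addr0. Qed.

(** The Klein form of characteristic (x, y), of weight -1. The exponential factor makes SL_2(Z) act
    on the row vector (x, y) without any multiplier, see [kap_mob]. *)
Definition klein (x y t : C) : C := ex (x * (x * t + y) / 2) * phi t (x * t + y).
Definition kap (u v : int) t : C := klein (u%:~R / 12) (v%:~R / 12) t.

Lemma klein_T x y t : klein x y (t + 1) = klein x (x + y) t.
Proof.
rewrite /klein phi_tD1; have -> : x * (t + 1) + y = x * t + (x + y) by ring.
by [].
Qed.

Lemma klein_S x y t : 0 < complex.Im t -> t * klein x y (- t^-1) = klein y (- x) t.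
Proof.
move=> t0; have tn := Im_neq0 t0; rewrite /klein.
have -> : x * - t^-1 + y = (y * t - x) / t by field.
rewrite [LHS]mulrCA phi_inv // [LHS]mulrA -exD; congr (ex _ * _); by field.
Qed.

Lemma klein_D1 x y t : 0 < complex.Im t -> klein (x + 1) y t = ex (1 / 2 - y / 2) * klein x y t.
Proof.
move=> t0; rewrite /klein.
have -> : (x + 1) * t + y = (x * t + y) + t by ring.
rewrite phiDt // -[- ex _]mulN1r -ex_half !mulrA -!exD.
by congr (ex _ * _); field.
Qed.

Lemma klein_D2 x y t : klein x (y + 1) t = ex (1 / 2 + x / 2) * klein x y t.
Proof.
rewrite /klein addrA phiD1 -[- phi _ _]mulN1r -ex_half !mulrA -!exD.
by congr (ex _ * _); field.
Qed.

Lemma klein_N x y t : 0 < complex.Im t -> klein (- x) (- y) t = - klein x y t.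
Proof.
move=> t0; rewrite /klein; have -> : - x * t - y = - (x * t + y) by ring.
by rewrite phiN // mulrN mulrNN.
Qed.

Lemma kap_mob (a b c d : int) : a * d - b * c = 1 -> forall u v t, 0 < complex.Im t ->
  (c%:~R * t + d%:~R) * kap u v (mob a b c d t) = kap (u * a + v * c) (u * b + v * d) t.
Proof.
move: a b c d; apply: (@SL2_ind (fun a b c d => forall u v t, 0 < complex.Im t ->
  (c%:~R * t + d%:~R) * kap u v (mob a b c d t) = kap (u * a + v * c) (u * b + v * d) t)).
- by move=> u v t t0; rewrite /mob !mulr0 !mulr1 !add0r !addr0 mul0r !mul1r add0r divr1 mul1r.
- move=> a b c d h IH u v t t0; rewrite mob_T.
  have -> : c%:~R * t + (d + c)%:~R = c%:~R * (t + 1) + d%:~R :> C by rewrite intrD; ring.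
  rewrite IH ?Im_add1 // /kap klein_T; congr klein; rewrite !intrD !intrM !intrD; ring.
- move=> a b c d h IH u v t t0; rewrite mob_V.
  have -> : c%:~R * t + (d - c)%:~R = c%:~R * (t - 1) + d%:~R :> C by rewrite intrB; ring.
  rewrite IH ?Im_sub1 // /kap -[in RHS](subrK 1 t) klein_T; congr klein.
  by rewrite !intrD !intrM !intrB; ring.
move=> a b c d h IH u v t t0; rewrite mob_S //; have tn := Im_neq0 t0.
have -> : d%:~R * t + (- c)%:~R = t * (c%:~R * - t^-1 + d%:~R) :> C by rewrite intrN; field.
rewrite -mulrA IH ?Im_inv // /kap klein_S //; congr klein.
by rewrite !intrD !intrM !intrN; ring.
Qed.

Lemma kap_D1 (n u v : int) t : 0 < complex.Im t ->
  kap (u + 12 * n) v t = ex ((n * (12 - v))%:~R / 24) * kap u v t.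
Proof.
move=> t0; have step w : kap (w + 12) v t = ex ((12 - v)%:~R / 24) * kap w v t.
  rewrite /kap intrD mulrDl divff ?pnatr_eq0 // klein_D1 //; congr (ex _ * _).
  by rewrite intrB; field.
have up (k : nat) w : kap (w + 12 * k%:Z) v t = ex ((k%:Z * (12 - v))%:~R / 24) * kap w v t.
  elim: k w => [|k IH] w; first by rewrite mulr0 addr0 mul0r mul0r ex0 mul1r.
  have -> : w + 12 * k.+1%:Z = (w + 12 * k%:Z) + 12 by rewrite intS; ring.
  rewrite step IH mulrA -exD; congr (ex _ * _).
  by rewrite intS !intrM !intrD; ring.
case: n => k; first exact: up.
rewrite NegzE mulrN; have := up k.+1 (u - 12 * k.+1%:Z); rewrite subrK => ->.
by rewrite mulrA -exD -mulrDl -intrD mulNr addNr mul0r ex0 mul1r.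
Qed.

Lemma kap_D2 (n u v : int) t :
  kap u (v + 12 * n) t = ex ((n * (12 + u))%:~R / 24) * kap u v t.
Proof.
have step w : kap u (w + 12) t = ex ((12 + u)%:~R / 24) * kap u w t.
  rewrite /kap [(w + 12)%:~R]intrD mulrDl divff ?pnatr_eq0 // klein_D2; congr (ex _ * _).
  by rewrite intrD; field.
have up (k : nat) w : kap u (w + 12 * k%:Z) t = ex ((k%:Z * (12 + u))%:~R / 24) * kap u w t.
  elim: k w => [|k IH] w; first by rewrite mulr0 addr0 mul0r mul0r ex0 mul1r.
  have -> : w + 12 * k.+1%:Z = (w + 12 * k%:Z) + 12 by rewrite intS; ring.
  rewrite step IH mulrA -exD; congr (ex _ * _).
  by rewrite intS !intrM !intrD; ring.
case: n => k; first exact: up.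
rewrite NegzE mulrN; have := up k.+1 (v - 12 * k.+1%:Z); rewrite subrK => ->.
by rewrite mulrA -exD -mulrDl -intrD mulNr addNr mul0r ex0 mul1r.
Qed.

Lemma kap_N (u v : int) t : 0 < complex.Im t -> kap (- u) (- v) t = ex (12%:~R / 24) * kap u v t.
Proof.
move=> t0; rewrite /kap !intrN !mulNr klein_N //.
have -> : 12%:~R / 24 = 1 / 2 :> C by rewrite -[12%:~R]/(12%:R); field.
by rewrite ex_half mulN1r.
Qed.

End KleinForms.

Section EtaPowers.
Variable R : realType.
Local Notation C := R[i].
Implicit Types (t : C).

Definition eulG t : C := G (ex t) (ex t).

Lemma eulG_neq0 t : 0 < complex.Im t -> eulG t != 0.
Proof. by move=> t0; apply: G_neq0; rewrite nm_ex_lt1. Qed.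

(* eta(t)^4 *)
Definition W t : C := ex (t / 6) * eulG t ^+ 4.

Lemma W_neq0 t : 0 < complex.Im t -> W t != 0.
Proof. by move=> t0; rewrite mulf_neq0 ?ex_neq0 // expf_neq0 // eulG_neq0. Qed.

Lemma kap_th (u v : int) t : 0 < complex.Im t -> kap u v t =
  ex (((u%:~R / 12) - 1) * ((u%:~R / 12) * t + v%:~R / 12) / 2)
  * th (ex t) (ex ((u%:~R / 12) * t + v%:~R / 12)) / eulG t ^+ 2.
Proof.
move=> t0; rewrite /kap /klein phi.unlock -/(eulG t); move: (_ * t + _) => z.
have -> : ex ((u%:~R / 12 - 1) * z / 2) = ex (u%:~R / 12 * z / 2) * ex (- (z / 2)).
  by rewrite -exD; congr ex; field.
by rewrite !mulrA.
Qed.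

Lemma Im_divn t (n : nat) : 0 < complex.Im t -> (0 < n)%N -> 0 < complex.Im (t / n%:R).
Proof.
move=> t0 n0; rewrite -(rmorph_nat (real_complex R)) -fmorphV.
by case: t t0 => x y /= y0; rewrite mulr0 add0r mulr_gt0 // invr_gt0 ltr0n.
Qed.

Definition c2 : C := ex (- (3 / 8)) * 2.
Definition c3 : C := ex (- (1 / 6)) * (1 - om R).

(** Squared because the product is a multiple of eta^-6, which is no power of [W] = eta^4, while its
    square is. *)
Lemma kap_2torsion t : 0 < complex.Im t ->
  (kap 0 6 t * (kap 6 0 t * kap 6 6 t)) ^+ 2 = c2 ^+ 2 / W t ^+ 3.
Proof.
move=> t0; have E0 := eulG_neq0 t0.
have r1 : nm (ex (t / 2)) < 1 by rewrite nm_ex_lt1; apply: (@Im_divn _ 2).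
have h := th_2torsion r1 (ex_neq0 _).
have e1 : ex (t / 2) ^+ 2 = ex t by rewrite -exMn; congr ex; field.
rewrite e1 in h.
suff -> : kap 0 6 t * (kap 6 0 t * kap 6 6 t) = c2 * ex (- (t / 4)) / eulG t ^+ 6.
  have e2 : ex (t / 6) ^+ 3 * ex (- (t / 4)) ^+ 2 = 1.
    by rewrite -!exMn -exD (_ : _ + _ = 0) ?ex0 //; field.
  have n0 := ex_neq0 (t / 6).
  have Y2 : ex (- (t / 4)) ^+ 2 = (ex (t / 6) ^+ 3)^-1.
    by apply: (mulfI (expf_neq0 3 n0)); rewrite e2 mulfV // expf_neq0.
  transitivity (c2 ^+ 2 * ex (- (t / 4)) ^+ 2 / eulG t ^+ 12); first by field.
  by rewrite Y2 /W; field; rewrite n0 E0.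
rewrite !kap_th // mul0r mul0r add0r.
have -> : 6%:~R / 12 = 1 / 2 :> C by rewrite -[6%:~R]/(6%:R); field.
rewrite !add0r !addr0 ex_half.
have -> : 1 / 2 * t = t / 2 by field.
rewrite (exD (t / 2)) ex_half mulrN1 /c2 -[X in _ = _ * X * _ / _]h.
have -> : ex (- (3 / 8)) * (th (ex t) (-1) * (th (ex t) (ex (t / 2)) * th (ex t) (- ex (t / 2)))) * ex (- (t / 4))
   / eulG t ^+ 6 = ex (- (3 / 8) - t / 4) * th (ex t) (-1) * th (ex t) (ex (t / 2)) * th (ex t) (- ex (t / 2)) / eulG t ^+ 6.
  by rewrite exD; ring.
have -> : ex (- (3 / 8) - t / 4) = ex (-1 * (1 / 2) / 2) * ex ((1 / 2 - 1) * (t / 2) / 2)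
   * ex ((1 / 2 - 1) * (t / 2 + 1 / 2) / 2) by rewrite -!exD; congr ex; field.
move: (th (ex t) (-1)) (th (ex t) (ex (t / 2))) (th (ex t) (- ex (t / 2))) => A B D.
by move: (ex _) (ex _) (ex _) => X Y Z; field.
Qed.

Lemma kap_3torsion t : 0 < complex.Im t ->
  kap 0 4 t * (kap 4 0 t * (kap 4 4 t * kap 4 (-4) t)) = c3 / W t ^+ 2.
Proof.
move=> t0; have E0 := eulG_neq0 t0.
have r1 : nm (ex (t / 3)) < 1 by rewrite nm_ex_lt1; apply: (@Im_divn _ 3).
have h := th_3torsion r1 (ex_neq0 _).
have e1 : ex (t / 3) ^+ 3 = ex t by rewrite -exMn; congr ex; field.
rewrite e1 in h.
have e2 : ex (t / 6) ^+ 2 * ex (- (t / 3)) = 1.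
  by rewrite -!exMn -exD (_ : _ + _ = 0) ?ex0 //; field.
have -> : c3 / W t ^+ 2 = c3 * ex (- (t / 3)) / eulG t ^+ 8.
  have n0 := ex_neq0 (t / 6).
  have -> : ex (- (t / 3)) = (ex (t / 6) ^+ 2)^-1.
    by apply: (mulfI (expf_neq0 2 n0)); rewrite e2 mulfV // expf_neq0.
  by rewrite /W; field; rewrite n0 E0.
rewrite !kap_th // mul0r mul0r add0r.
have -> : 4%:~R / 12 = 1 / 3 :> C by rewrite -[4%:~R]/(4%:R); field.
have -> : (- 4)%:~R / 12 = - (1 / 3) :> C by rewrite intrN -[4%:~R]/(4%:R); field.
rewrite !add0r !addr0.
have -> : 1 / 3 * t = t / 3 by field.
have o2 : ex (- (1 / 3)) = om R ^+ 2.
  by apply: (mulfI (ex_neq0 (1 / 3))); rewrite -exD subrr ex0 -/(om R) -exprS om3.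
rewrite !(exD (t / 3)) o2 -/(om R) ![ex (t / 3) * _]mulrC /c3 -h.
have -> : ex (- (1 / 6)) * (th (ex t) (om R) * (th (ex t) (ex (t / 3)) *
     (th (ex t) (om R * ex (t / 3)) * th (ex t) (om R ^+ 2 * ex (t / 3))))) * ex (- (t / 3)) / eulG t ^+ 8
  = ex (- (1 / 6) - t / 3) * th (ex t) (om R) * th (ex t) (ex (t / 3)) *
     th (ex t) (om R * ex (t / 3)) * th (ex t) (om R ^+ 2 * ex (t / 3)) / eulG t ^+ 8.
  by rewrite exD; ring.
have -> : ex (- (1 / 6) - t / 3) = ex (-1 * (1 / 3) / 2) * ex ((1 / 3 - 1) * (t / 3) / 2)
   * ex ((1 / 3 - 1) * (t / 3 + 1 / 3) / 2) * ex ((1 / 3 - 1) * (t / 3 - 1 / 3) / 2) by rewrite -!exD; congr ex; field.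
move: (th (ex t) (om R)) (th (ex t) (ex (t / 3))) (th (ex t) (om R * _)) (th (ex t) (om R ^+ 2 * _)) => A B D E.
by move: (ex _) (ex _) (ex _) (ex _) => X Y Z U; field.
Qed.

Lemma c2_neq0 : c2 != 0. Proof. by rewrite mulf_neq0 ?ex_neq0 ?pnatr_eq0. Qed.
Lemma c3_neq0 : c3 != 0.
Proof. by rewrite mulf_neq0 ?ex_neq0 // subr_eq0 eq_sym om_neq1. Qed.

(* eta^4 = eta^16 / eta^12, the 2- and 3-torsion products being multiples of
   eta^-6 and eta^-8 *)
Lemma W_kap t : 0 < complex.Im t -> W t = (c3 / c2) ^+ 2 *
  (kap 0 6 t * (kap 6 0 t * kap 6 6 t)) ^+ 2 / (kap 0 4 t * (kap 4 0 t * (kap 4 4 t * kap 4 (-4) t))) ^+ 2.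
Proof.
move=> t0; rewrite kap_2torsion // kap_3torsion //.
move: (W_neq0 t0) c2_neq0 c3_neq0; move: (W t) c2 c3 => w a b w0 a0 b0.
by field; rewrite w0 a0 b0.
Qed.

Lemma W_T t : W (t + 1) = ex (1 / 6) * W t.
Proof. by rewrite /W /eulG exD ex1 mulr1 mulrDl exD [ex (1 / 6) * _]mulrCA mulrA. Qed.

(** The inversion permutes the 2-torsion and the 3-torsion points up to signs and periods, so each
    product in [W_kap] only gains a constant. The sign is the square of ex(1/4), the phase of the
    2-torsion product. *)
Lemma W_S t : 0 < complex.Im t -> W (- t^-1) = - (t ^+ 2 * W t).
Proof.
move=> t0; have tn := Im_neq0 t0; have t1 := Im_inv t0.
have S1 u v : t * kap u v (- t^-1) = kap v (- u) t.
  by rewrite /kap klein_S // intrN mulNr.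
have h2 : t ^+ 3 * (kap 0 6 (- t^-1) * (kap 6 0 (- t^-1) * kap 6 6 (- t^-1)))
   = ex (1 / 4) * (- (kap 0 6 t * (kap 6 0 t * kap 6 6 t))).
  have -> : t ^+ 3 * (kap 0 6 (- t^-1) * (kap 6 0 (- t^-1) * kap 6 6 (- t^-1))) =
    (t * kap 0 6 (- t^-1)) * ((t * kap 6 0 (- t^-1)) * (t * kap 6 6 (- t^-1))) by ring.
  rewrite !S1 oppr0.
  have -> : kap 0 (-6) t = - kap 0 6 t.
    by have := kap_N 0 6 t0; rewrite oppr0 => ->; rewrite -mulN1r -ex_half; congr (ex _ * _); rewrite -[12%:~R]/(12%:R); field.
  have -> : kap 6 (-6) t = ex (1 / 4) * kap 6 6 t.
    have := kap_D2 1 6 (-6) t; rewrite (_ : -6 + 12 * 1 = 6) // => ->; rewrite mulrA -exD.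
    rewrite (_ : 1 / 4 + (1 * (12 + 6))%:~R / 24 = 1) ?ex1 ?mul1r //.
    by rewrite (_ : (12 + 6)%:~R = 18%:R :> C) //; field.
  by ring.
have h3 : t ^+ 4 * (kap 0 4 (- t^-1) * (kap 4 0 (- t^-1) * (kap 4 4 (- t^-1) * kap 4 (-4) (- t^-1))))
   = kap 0 4 t * (kap 4 0 t * (kap 4 4 t * kap 4 (-4) t)).
  have -> : t ^+ 4 * (kap 0 4 (- t^-1) * (kap 4 0 (- t^-1) * (kap 4 4 (- t^-1) * kap 4 (-4) (- t^-1)))) =
    (t * kap 0 4 (- t^-1)) * ((t * kap 4 0 (- t^-1)) * ((t * kap 4 4 (- t^-1)) * (t * kap 4 (-4) (- t^-1)))) by ring.
  rewrite !S1 oppr0.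
  have Neg u v : kap (- u) (- v) t = - kap u v t.
    by rewrite kap_N // -mulN1r -ex_half; congr (ex _ * _); rewrite -[12%:~R]/(12%:R); field.
  by rewrite -{1}[0]oppr0 (Neg 0 4) (Neg 4 4); ring.
rewrite (W_kap t1) (W_kap t0).
have k3 : kap 0 4 t * (kap 4 0 t * (kap 4 4 t * kap 4 (-4) t)) != 0.
  by rewrite kap_3torsion // mulf_neq0 ?c3_neq0 // invr_eq0 expf_neq0 // W_neq0.
have i2 : ex (1 / 4) ^+ 2 = -1 :> C by rewrite -exMn -ex_half; congr ex; field.
have k3' : kap 0 4 (- t^-1) * (kap 4 0 (- t^-1) * (kap 4 4 (- t^-1) * kap 4 (-4) (- t^-1))) != 0.
  by apply/eqP => h; move: k3; rewrite -h3 h mulr0 eqxx.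
move: h2 h3 k3 k3'.
move: (kap 0 6 t * _) (kap 0 4 t * _) (kap 0 6 (- t^-1) * _) (kap 0 4 (- t^-1) * _) => A B A' B' h2 h3 B0 B'0.
have {}h2 : t ^+ 6 * A' ^+ 2 = - A ^+ 2.
  have -> : t ^+ 6 * A' ^+ 2 = (t ^+ 3 * A') ^+ 2 by rewrite exprMn -exprM.
  by rewrite h2 exprMn i2 sqrrN mulN1r.
rewrite -h3; move: c2_neq0; move: c2 c3 => a b a0.
have -> : A ^+ 2 = - (t ^+ 6 * A' ^+ 2) by rewrite h2 opprK.
by field; rewrite a0 tn B'0.
Qed.

(* the exponent of the multiplier of eta^4, in sixths *)
Definition etaX (K : pzRingType) (a b c d : K) : K :=
  (1 - c ^+ 2) * (b * d + (c - 1) *+ 3 * d + c + 1 *+ 3) + c * (a + d - 1 *+ 3).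

(** What [W_T] and [W_S] require of the exponent modulo 6. As [etaX] is a polynomial over any ring,
    this is checked on all residues modulo 2 and modulo 3. *)
Let etaX_rel (K : pzRingType) (a b c d : K) :=
  [/\ etaX a (b + a) c (d + c) = etaX a b c d + 1,
      etaX a (b - a) c (d - c) = etaX a b c d - 1
    & etaX b (- a) d (- c) = etaX a b c d + 1 *+ 3].

Let etaX_Z2 (a b c d : 'Z_2) : a * d - b * c = 1 -> etaX_rel a b c d.
Proof.
by case: a => [[|[|//]] ?]; case: b => [[|[|//]] ?]; case: c => [[|[|//]] ?]; case: d => [[|[|//]] ?] h;
  (discriminate h || (split; apply/val_inj)).
Qed.

Let etaX_Z3 (a b c d : 'Z_3) : a * d - b * c = 1 -> etaX_rel a b c d.
Proof.
by case: a => [[|[|[|//]]] ?]; case: b => [[|[|[|//]]] ?]; case: c => [[|[|[|//]]] ?]; case: d => [[|[|[|//]]] ?] h;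
  (discriminate h || (split; apply/val_inj)).
Qed.

Let etaX_intr (K : comNzRingType) (a b c d : int) :
  (etaX a b c d)%:~R = etaX (a%:~R : K) b%:~R c%:~R d%:~R.
Proof.
by rewrite /etaX; ring.
Qed.

Let Zp_int_dvd (p : nat) (n : int) : (1 < p)%N -> n%:~R = 0 :> 'Z_p -> (p%:Z %| n)%Z.
Proof.
move=> p1; suff h (k : nat) : k%:R = 0 :> 'Z_p -> (p %| k)%N.
  case: n => k; first by move/h.
  by rewrite NegzE mulrNz => /eqP; rewrite oppr_eq0 => /eqP /h; rewrite dvdzE abszN.
by move/(congr1 val); rewrite /= val_Zp_nat // => /eqP.
Qed.

Lemma etaX_mod6 (a b c d : int) : a * d - b * c = 1 ->
  [/\ (6 %| etaX a (b + a) c (d + c) - (etaX a b c d + 1))%Z,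
      (6 %| etaX a (b - a) c (d - c) - (etaX a b c d - 1))%Z
    & (6 %| etaX b (- a) d (- c) - (etaX a b c d + 3))%Z].
Proof.
move=> h.
have h6 n : n%:~R = 0 :> 'Z_2 -> n%:~R = 0 :> 'Z_3 -> (6 %| n)%Z.
  move=> /(Zp_int_dvd (isT : (1 < 2)%N)) h2 /(Zp_int_dvd (isT : (1 < 3)%N)) h3.
  by rewrite (_ : 6 = 2%:Z * 3%:Z) // Gauss_dvdz // h2 h3.
have hK (K : nzRingType) : a%:~R * d%:~R - b%:~R * c%:~R = 1 :> K.
  by rewrite -!intrM -intrB h.
have [x1 x2 x3] := etaX_Z2 (hK _); have [y1 y2 y3] := etaX_Z3 (hK _).
have sub0 (K : nzRingType) (x y : int) : x%:~R = y%:~R :> K -> (x - y)%:~R = 0 :> K.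
  by move=> e; rewrite rmorphB /= e subrr.
have e1 (K : comNzRingType) : etaX_rel (a%:~R : K) b%:~R c%:~R d%:~R -> [/\
   (etaX a (b + a) c (d + c))%:~R = (etaX a b c d + 1)%:~R :> K,
   (etaX a (b - a) c (d - c))%:~R = (etaX a b c d - 1)%:~R :> K
   & (etaX b (- a) d (- c))%:~R = (etaX a b c d + 3)%:~R :> K].
  move=> [z1 z2 z3]; split.
  - by rewrite [RHS]rmorphD /= !etaX_intr -z1; congr etaX; rewrite rmorphD.
  - by rewrite [RHS]rmorphB /= !etaX_intr -z2; congr etaX; rewrite rmorphB.
  by rewrite [RHS]rmorphD /= !etaX_intr -[3%:~R]/(1 *+ 3) -z3; congr etaX; rewrite rmorphN.
have [u1 u2 u3] := e1 _ (And3 x1 x2 x3); have [v1 v2 v3] := e1 _ (And3 y1 y2 y3).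
by split; apply: h6; apply: sub0.
Qed.

Lemma ex_dvd (m : nat) (x y : int) : (0 < m)%N -> (m%:Z %| x - y)%Z ->
  ex (x%:~R / m%:R) = ex (y%:~R / m%:R) :> C.
Proof.
move=> m0 /dvdzP [q h].
have -> : x%:~R / m%:R = y%:~R / m%:R + q%:~R :> C.
  have -> : x = y + q * m%:Z by rewrite -h addrC subrK.
  by rewrite intrD intrM mulrDl mulfK // -[m%:~R]/(m%:R) pnatr_eq0 -lt0n.
by rewrite exDz.
Qed.

Lemma W_mob (a b c d : int) : a * d - b * c = 1 -> forall t, 0 < complex.Im t ->
  W (mob a b c d t) = (c%:~R * t + d%:~R) ^+ 2 * (ex ((etaX a b c d)%:~R / 6%:R) * W t).
Proof.
move: a b c d; apply: (@SL2_ind (fun a b c d => forall t, 0 < complex.Im t ->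
  W (mob a b c d t) = (c%:~R * t + d%:~R) ^+ 2 * (ex ((etaX a b c d)%:~R / 6%:R) * W t))).
- move=> t t0; rewrite /mob !mul0r !add0r !mul1r divr1 addr0 expr1n mul1r.
  by rewrite ex0 mul1r.
- move=> a b c d h IH t t0; rewrite mob_T IH ?Im_add1 // W_T [ex _ * (ex _ * _)]mulrA -exD.
  have [e _ _] := etaX_mod6 h; rewrite (@ex_dvd 6 _ _ isT e) !intrD; congr (_ ^+ 2 * (ex _ * _)); by [ring|field].
- move=> a b c d h IH t t0; rewrite mob_V IH ?Im_sub1 // -[in RHS](subrK 1 t) W_T subrK.
  have [_ e _] := etaX_mod6 h; rewrite (@ex_dvd 6 _ _ isT e) [ex _ * (ex _ * _)]mulrA -exD !intrB; congr (_ ^+ 2 * (ex _ * _)); by [ring|field].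
move=> a b c d h IH t t0; rewrite mob_S // IH ?Im_inv // W_S //; have tn := Im_neq0 t0.
have [_ _ e] := etaX_mod6 h; rewrite (@ex_dvd 6 _ _ isT e).
have -> : ex ((etaX a b c d + 3)%:~R / 6%:R) = - ex ((etaX a b c d)%:~R / 6%:R) :> C.
  move: (etaX a b c d) => X; rewrite intrD mulrDl exD.
  rewrite (_ : 3%:~R / 6%:R = 1 / 2 :> C) ?ex_half ?mulrN1 //.
  by rewrite -[3%:~R]/(3%:R); field.
by rewrite intrN; move: (ex _) (W t) => A B; field.
Qed.

Lemma W_mob1 (a b c d : int) t : a * d - b * c = 1 -> (24 %| b)%Z -> (24 %| c)%Z ->
  0 < complex.Im t -> W (mob a b c d t) = (c%:~R * t + d%:~R) ^+ 2 * W t.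
Proof.
move=> h hb hc t0; rewrite W_mob //; congr (_ * _); rewrite -[RHS]mul1r; congr (_ * _).
rewrite -[RHS](ex0 R) -(mul0r (6%:R^-1 : C)) -[0 / _]/(0%:~R / _); apply: ex_dvd => //.
rewrite subr0; move: hb hc => /dvdzP [b' hb] /dvdzP [c' hc]; rewrite hb hc; apply/dvdzP.
(* Modulo 6 the exponent is 3 (1 - d) when 24 divides b and c, so it remains to see that d is
   odd. *)
have [k dk] : exists k, d = 2 * k + 1.
  exists (d %/ 2)%Z; have := divz_eq d 2; have := @modz_ge0 d 2 isT; have := @ltz_pmod d 2 isT.
  move: (d %/ 2)%Z (d %% 2)%Z => x y y2 y0 dxy.
  have [y1|y1] : y = 1 \/ y = 0 by lia.
    by rewrite dxy y1 mulrC.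
  have h1 := h; rewrite hb hc dxy y1 addr0 in h1.
  have : 2 * (a * x - 288 * (b' * c')) = 1 by rewrite -[RHS]h1; ring.
  by lia.
exists ((1 - (c' * 24) ^+ 2) * (b' * 4 * d + c' * 12 * d - k + c' * 4) + c' * 4 * (a + d - 3)).
by rewrite /etaX dk; ring.
Qed.

End EtaPowers.

(** * The quotient eta(6t)/eta(t) *)

Section EtaQuotient.
Variable R : realType.
Local Notation C := R[i].
Implicit Types (t : C).

(* eta(6t)/eta(t) *)
Definition hq t : C := ex (5%:R * t / 24) * (G (ex t ^+ 6) (ex t ^+ 6) / eulG t).

Definition ch : C := ex (- (3 / 8) - 1 / 16) * ((1 + om R ^+ 2) * (1 - om R) * (1 - ii R)).

Lemma ii_neq1 : ii R != 1.
Proof.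
apply/eqP => h; have := ii2 R; rewrite h expr1n => /eqP.
by rewrite -addr_eq0 -[1 + 1]/(2%:R) pnatr_eq0.
Qed.

Lemma ch_neq0 : ch != 0.
Proof.
rewrite mulf_neq0 ?ex_neq0 // !mulf_neq0 //.
- have -> : 1 + om R ^+ 2 = - om R by rewrite om2; ring.
  by rewrite oppr_eq0 ex_neq0.
- by rewrite subr_eq0 eq_sym om_neq1.
by rewrite subr_eq0 eq_sym ii_neq1.
Qed.

(** The points 1/6, 1/3, 1/4 and t/2 + 1/4. Up to constants and powers of q, the first two give
    (q^6; q^6) / (q^2; q^2) and the last two (-q; q) = (q^2; q^2) / (q; q). *)
Definition kap4 (f : int -> int -> C) : C := f 0 2 * (f 0 4 * (f 0 3 * f 6 3)).

Lemma hq_kap t : 0 < complex.Im t -> ch * hq t = kap4 (fun u v => kap u v t) * W t ^+ 2.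
Proof.
move=> t0; have E0 := eulG_neq0 t0.
have r1 : nm (ex (t / 2)) < 1 by rewrite nm_ex_lt1; apply: (@Im_divn _ _ 2).
have h := th_12torsion r1 (ex_neq0 _).
have e1 : ex (t / 2) ^+ 2 = ex t by rewrite -exMn; congr ex; field.
rewrite /= e1 -/(eulG t) in h.
have -> : ch * hq t = ex (- (3 / 8) - 1 / 16) * (ex (5%:R * t / 24) *
  (((1 + om R ^+ 2) * (1 - om R) * (1 - ii R) * G (ex t ^+ 6) (ex t ^+ 6)) / eulG t)).
  by rewrite /ch /hq; move: (ex _) (ex _) (G _ _) (eulG t)^-1 => A B D E; ring.
rewrite -h mulfK // /kap4 /= !kap_th // mul0r !mul0r !add0r.
have -> : 6%:~R / 12 = 1 / 2 :> C by rewrite -[6%:~R]/(6%:R); field.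
have -> : 2%:~R / 12 = 1 / 6 :> C by rewrite -[2%:~R]/(2%:R); field.
have -> : 4%:~R / 12 = 1 / 3 :> C by rewrite -[4%:~R]/(4%:R); field.
have -> : 3%:~R / 12 = 1 / 4 :> C by rewrite -[3%:~R]/(3%:R); field.
have -> : ex (1 / 6) = - om R ^+ 2.
  by rewrite /om -exMn -mulN1r -ex_half -exD -[RHS](exDz _ (-1)); congr ex; rewrite intrN; field.
rewrite -/(om R) -/(ii R) (exD (1 / 2 * t)) -/(ii R) [ex (1 / 2 * t) * _]mulrC.
have -> : 1 / 2 * t = t / 2 by field.
rewrite /W exprMn -exprM -[ex (t / 6) ^+ 2]exMn.
move: (th (ex t) (- om R ^+ 2)) (th (ex t) (om R)) (th (ex t) (ii R)) (th (ex t) (ii R * _)) => A B D E.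
have -> : ex (- (3 / 8) - 1 / 16) * (ex (5%:R * t / 24) * (A * (B * (D * E)))) =
   ex (- (3 / 8) - 1 / 16 + 5%:R * t / 24) * A * B * D * E.
  by rewrite (exD (- (3 / 8) - 1 / 16)); ring.
have -> : ex (- (3 / 8) - 1 / 16 + 5%:R * t / 24) = ex (-1 * (1 / 6) / 2) * ex (-1 * (1 / 3) / 2) *
   ex (-1 * (1 / 4) / 2) * ex ((1 / 2 - 1) * (t / 2 + 1 / 4) / 2) * ex (2%:R * (t / 6)).
  by rewrite -!exD; congr ex; field.
by move: (ex _) (ex _) (ex _) (ex _) (ex _) => X1 X2 X3 X4 X5; field.
Qed.

Lemma hq_mob (a b c d : int) t : a * d - b * c = 1 -> 0 < complex.Im t ->
  ch * hq (mob a b c d t) =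
  kap4 (fun u v => kap (u * a + v * c) (u * b + v * d) t) *
  (ex ((etaX a b c d)%:~R / 6%:R) * W t) ^+ 2.
Proof.
move=> h t0; rewrite hq_kap ?Im_mob // W_mob // /kap4 -!(kap_mob h) //.
by move: (kap _ _ _) (kap _ _ _) (kap _ _ _) (kap _ _ _) (ex _) (W _) => A B D E F w; ring.
Qed.

(* the character (6/d) as a function of d modulo 24 *)
Definition chi24 (d : int) : bool := (d %% 24)%Z \in [:: 1; 5; 19; 23].

(* each Klein form is translated back to a base point; the total phase is an
   integer multiple of 1/24 *)
Let phase (a b' c' d x k2 k3 k4 : int) (e2 e3 e4 : bool) t : 0 < complex.Im t ->
  a = 2 * x + 1 -> 2 * d = 12 * k2 + (if e2 then -2 else 2) ->
  3 * d = 12 * k3 + (if e3 then -3 else 3) -> 4 * d = 12 * k4 + (if e4 then -4 else 4) ->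
  kap4 (fun u v => kap (u * a + v * (c' * 144)) (u * (b' * 24) + v * d) t) =
  ex ((24 * c' * (12 - 2 * d) + 48 * c' * (12 - 4 * d) + 36 * c' * (12 - 3 * d)
      + (x + 36 * c') * (12 - (3 * d + 12 * (12 * b'))) + 12 * b' * 18
      + k2 * 12 + k4 * 12 + k3 * 12 + k3 * 18
      + (if e2 then 12 else 0) + (if e4 then 12 else 0) + (if e3 then 15 else 0))%:~R / 24%:R)
  * kap4 (fun u v => kap u v t).
Proof.
move=> t0 aE d2 d3 d4; rewrite /kap4.
have exA (m n : int) (z : C) : ex (m%:~R / 24%:R) * (ex (n%:~R / 24%:R) * z) = ex ((m + n)%:~R / 24%:R) * z.
  by rewrite mulrA -exD -mulrDl -intrD.
have neg0 (e : bool) (s : int) : kap 0 (if e then - s else s) t =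
    ex ((if e then 12 else 0)%:~R / 24%:R) * kap 0 s t.
  case: e; last by rewrite mul0r ex0 mul1r.
  by rewrite -{1}[0]oppr0 kap_N.
have neg6 (e : bool) : kap 6 (if e then -3 else 3) t = ex ((if e then 3 else 0)%:~R / 24%:R) * kap 6 3 t.
  case: e; last by rewrite mul0r ex0 mul1r.
  have := kap_D1 1 (-6) 3 t0; rewrite (_ : -6 + 12 * 1 = 6) // => ->.
  rewrite -[6 in LHS]opprK kap_N // !exA; congr (ex _ * _).
have K0 (s n k : int) (e : bool) : s * d = 12 * k + (if e then - s else s) ->
    kap (0 * a + s * (c' * 144)) (0 * (b' * 24) + s * d) t =
    ex ((s * c' * 12 * (12 - s * d) + (k * 12 + (if e then 12 else 0)))%:~R / 24%:R) * kap 0 s t.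
  move=> sd; have -> : 0 * a + s * (c' * 144) = 0 + 12 * (s * c' * 12) by ring.
  have -> : 0 * (b' * 24) + s * d = s * d by ring.
  rewrite kap_D1 //; have -> : kap 0 (s * d) t = kap 0 ((if e then - s else s) + 12 * k) t by rewrite sd addrC.
  by rewrite kap_D2 neg0 !exA; congr (ex (_%:~R / _) * _); case: (e); ring.
have K6 : kap (6 * a + 3 * (c' * 144)) (6 * (b' * 24) + 3 * d) t =
    ex (((x + 36 * c') * (12 - (3 * d + 12 * (12 * b'))) + (12 * b' * 18 + (k3 * 18 + (if e3 then 3 else 0))))%:~R / 24%:R) * kap 6 3 t.
  have -> : 6 * a + 3 * (c' * 144) = 6 + 12 * (x + 36 * c') by rewrite aE; ring.
  have -> : 6 * (b' * 24) + 3 * d = 3 * d + 12 * (12 * b') by ring.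
  rewrite kap_D1 // kap_D2; have -> : kap 6 (3 * d) t = kap 6 ((if e3 then -3 else 3) + 12 * k3) t by rewrite d3 addrC.
  by rewrite kap_D2 neg6 !exA; congr (ex (_%:~R / _) * _); case: (e3); ring.
rewrite (K0 2 0 k2 e2 d2) (K0 4 0 k4 e4 d4) (K0 3 0 k3 e3 d3) K6.
have exM (m n p q r : int) (z1 z2 z3 z4 : C) : m + n + p + q = r ->
   ex (m%:~R / 24%:R) * z1 * (ex (n%:~R / 24%:R) * z2 * (ex (p%:~R / 24%:R) * z3 * (ex (q%:~R / 24%:R) * z4)))
   = ex (r%:~R / 24%:R) * (z1 * (z2 * (z3 * z4))).
  by move=> <-; rewrite !intrD !mulrDl !exD; ring.
by apply: exM; case: e2 {d2}; case: e3 {d3 K6}; case: e4 {d4}; ring.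
Qed.

(** The eta power is invariant by [W_mob1]. The determinant forces d to be 1, 5, 7 or 11 modulo 12,
    so 2d, 3d, 4d are 2, 3, 4 up to sign modulo 12; the phase supplied by [phase] is then 0 or 12
    modulo 24, decided by the parity of [y], that is, by d modulo 24. *)
Lemma hq_mob_G (a b c d : int) t : a * d - b * c = 1 -> (24 %| b)%Z -> (144 %| c)%Z ->
  0 < complex.Im t -> hq (mob a b c d t) = (if chi24 d then 1 else -1) * hq t.
Proof.
move=> h hb hc t0; apply: (mulfI ch_neq0); rewrite [RHS]mulrCA [in RHS](hq_kap t0) hq_mob //.
have -> : ex ((etaX a b c d)%:~R / 6%:R) * W t = W t.
  have hc24 : (24 %| c)%Z by apply: dvdz_trans hc.
  have := W_mob h t0; rewrite (W_mob1 h hb hc24 t0) => e; apply/esym; apply: mulfI e.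
  by rewrite expf_neq0 // (aut_neq0 h t0).
rewrite [RHS]mulrA; congr (_ * _).
move: hb hc => /dvdzP [b' bE] /dvdzP [c' cE]; subst b c.
have [x aE] : exists x, a = 2 * x + 1.
  exists (a %/ 2)%Z; have := divz_eq a 2; have := @modz_ge0 a 2 isT; have := @ltz_pmod a 2 isT.
  move: (a %/ 2)%Z (a %% 2)%Z => x y y2 y0 axy.
  have [y1|y1] : y = 1 \/ y = 0 by lia.
    by rewrite axy y1 mulrC.
  have h1 := h; rewrite axy y1 addr0 in h1.
  have : 2 * (x * d - 1728 * (b' * c')) = 1 by rewrite -[RHS]h1; ring.
  by lia.
pose y := (d %/ 12)%Z; pose r := (d %% 12)%Z.
have dE : d = y * 12 + r := divz_eq d 12.
have r0 : 0 <= r by apply: modz_ge0.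
have r12 : r < 12 by apply: (@ltz_pmod d 12).
have r1 : [\/ r = 1, r = 5, r = 7 | r = 11].
  have h1 := h; rewrite dE in h1.
  have hp : a * r + 12 * (a * y - 288 * (b' * c')) = 1 by rewrite -[RHS]h1; ring.
  have : r \in [seq Posz i | i <- iota 0 12].
    by case: (r) r0 r12 => // n _ n12; apply/mapP; exists n => //; rewrite mem_iota.
  move: (a * y - _) hp => A; rewrite !inE => hp.
  do ![case/orP => [/eqP rr|]]; try (by constructor; rewrite rr); try (by move/eqP => rr; constructor; rewrite rr);
   rewrite rr in hp; exfalso; lia.
have ph := phase b' c' t0 aE.
have fin (N : int) : (24 %| N - (if chi24 d then 0 else 12))%Z ->
    ex (N%:~R / 24%:R) = (if chi24 d then 1 else -1) :> C.
  move=> /ex_dvd -> //; case: ifP => _; first by rewrite mul0r ex0.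
  by rewrite -ex_half; congr ex; rewrite -[12%:~R]/(12%:R); field.
have [w yw] : exists w, y = 2 * w \/ y = 2 * w + 1.
  by exists (y %/ 2)%Z; have := divz_eq y 2; have := @modz_ge0 y 2 isT; have := @ltz_pmod y 2 isT; lia.
have chiE (s : int) q : d = q * 24 + s -> 0 <= s < 24 -> chi24 d = (s \in [:: 1; 5; 19; 23]).
  by move=> -> s24; rewrite /chi24 modzMDl modz_small.
have hxy : (2 * x + 1) * (y * 12 + r) - b' * 24 * (c' * 144) = 1 by rewrite -aE -dE.
have divc (N : int) : (forall q s, N = q * 24 + s -> 0 <= s < 24 -> s = 0) -> (24 %| N)%Z.
  move=> hN; apply/dvdz_mod0P; apply: (hN _ _ (divz_eq N 24)).
  by rewrite modz_ge0 //= (@ltz_pmod N 24).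
have [r' | r' | r' | r'] := r1; rewrite r' in dE hxy.
- rewrite (ph _ (2 * y) (3 * y) (4 * y) false false false); try by rewrite dE; ring.
  congr (_ * _); apply: fin; case: yw => yw.
    by rewrite (chiE 1 w) //=; [apply: divc; rewrite yw; lia | lia].
  by rewrite (chiE 13 w) //=; [apply: divc; rewrite yw; lia | lia].
- rewrite (ph _ (2 * y + 1) (3 * y + 1) (4 * y + 2) true false true); try by rewrite dE; ring.
  congr (_ * _); apply: fin; case: yw => yw.
    by rewrite (chiE 5 w) //=; [apply: divc; rewrite yw; lia | lia].
  by rewrite (chiE 17 w) //=; [apply: divc; rewrite yw; lia | lia].
- rewrite (ph _ (2 * y + 1) (3 * y + 2) (4 * y + 2) false true false); try by rewrite dE; ring.
  congr (_ * _); apply: fin; case: yw => yw.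
    by rewrite (chiE 7 w) //=; [apply: divc; rewrite yw; lia | lia].
  by rewrite (chiE 19 w) //=; [apply: divc; rewrite yw; lia | lia].
rewrite (ph _ (2 * y + 2) (3 * y + 3) (4 * y + 4) true true true); try by rewrite dE; ring.
congr (_ * _); apply: fin; case: yw => yw.
  by rewrite (chiE 11 w) //=; [apply: divc; rewrite yw; lia | lia].
by rewrite (chiE 23 w) //=; [apply: divc; rewrite yw; lia | lia].
Qed.

End EtaQuotient.

(** * Expansions at the cusps *)

Section Expansions.
Variable R : realType.
Local Notation C := R[i].
Implicit Types (t z : C) (c d : nat -> C) (f g : C -> C) (w k s : nat).

Definition fexp w c f := (forall r, 0 <= r < 1 -> sm c r) /\
  forall t, 0 < complex.Im t -> f t = ev c (ex (t / w%:R)).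

Lemma nm_ex_divn w t : (0 < w)%N -> 0 < complex.Im t -> nm (ex (t / w%:R)) < 1.
Proof. by move=> w0 t0; rewrite nm_ex_lt1 Im_divn. Qed.

Lemma fexp_eq w c f g : (forall t, 0 < complex.Im t -> f t = g t) -> fexp w c f -> fexp w c g.
Proof. by move=> fg [sc fE]; split=> // t t0; rewrite -fg // fE. Qed.

Lemma fexpM w c d f g : (0 < w)%N -> fexp w c f -> fexp w d g -> fexp w (conv c d) (fun t => f t * g t).
Proof.
move=> w0 [sc fE] [sd gE]; split=> [r r1 | t t0].
  by apply: sm_conv; [case/andP: r1 | apply: sc | apply: sd].
by rewrite fE // gE // ev_conv //; [apply: sc | apply: sd]; rewrite nm_ge0 nm_ex_divn.
Qed.

Lemma fexpZ w c f (k : C) : (0 < w)%N -> fexp w c f -> fexp w (fun n => k * c n) (fun t => k * f t).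
Proof.
move=> w0 [sc fE]; split=> [r r1 | t t0]; first exact/sm_scale/sc.
by rewrite fE // ev_scale //; apply: sc; rewrite nm_ge0 nm_ex_divn.
Qed.

Lemma fexp_mono w s : (0 < w)%N -> fexp w (shift_seq s (@delta C)) (fun t => ex (s%:R * t / w%:R)).
Proof.
have dE n : shift_seq s (@delta C) n = (n == s)%:R.
  rewrite /shift_seq /delta; case: ltnP => h; first by rewrite ltn_eqF.
  by rewrite subn_eq0; congr (_%:R); rewrite eqn_leq h andbT.
move=> w0; split=> [r r1 | t t0].
  apply: (@sm_geom _ _ r 1) => //; exists 1 => n.
  by rewrite expr1n mulr1 dE; case: eqP => _; rewrite ?nm1 ?nm0.
rewrite -mulrA exMn; apply/esym/ev_unique => e e0; exists s.+1 => n sn.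
have -> : psum (shift_seq s (@delta C)) (ex (t / w%:R)) n = ex (t / w%:R) ^+ s.
  rewrite /psum (bigD1 (Ordinal sn)) //= dE eqxx mul1r big1 ?addr0 // => i ni.
  by rewrite dE -[(i : nat) == s]/(i == Ordinal sn) (negPf ni) mul0r.
by rewrite subrr nm0.
Qed.

Lemma fexp_shift w s c f : (0 < w)%N -> fexp w c f ->
  fexp w (shift_seq s c) (fun t => ex (s%:R * t / w%:R) * f t).
Proof.
move=> w0 /(fexpM w0 (fexp_mono s w0)); congr fexp; apply/funext => n.
rewrite conv_shift; congr shift_seq; apply/funext => m; by rewrite convC conv_delta.
Qed.

Lemma fexp1 w : (0 < w)%N -> fexp w (@delta C) (fun=> 1).
Proof.
move=> w0; have := fexp_mono 0 w0; have -> : shift_seq 0 (@delta C) = @delta C.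
  by apply/funext => n; rewrite /shift_seq ltn0 subn0.
by apply: fexp_eq => t _; rewrite mul0r mul0r ex0.
Qed.

Lemma fexpX w c f n : (0 < w)%N -> fexp w c f -> fexp w (cpow c n) (fun t => f t ^+ n).
Proof.
move=> w0 h; elim: n => [|n IH]; first exact: fexp1.
by apply: fexp_eq (fexpM w0 h IH) => t _; rewrite exprS.
Qed.

Lemma fexp_stretch w k c f : (0 < w)%N -> (0 < k)%N -> fexp w c f -> fexp (w * k) (stretch k c) f.
Proof.
move=> w0 k0 [sc fE]; split=> [r /andP[r0 r1] | t t0].
  by apply: sm_stretch => //; apply: sc; rewrite exprn_ge0 //= exprn_ilt1 // -lt0n.
have e : ex (t / (w * k)%:R) ^+ k = ex (t / w%:R).
  rewrite -exMn; congr ex; rewrite natrM; field.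
  by rewrite !pnatr_eq0 -!lt0n w0 k0.
by rewrite ev_stretch // ?e ?fE // -nmX e; apply: sc; rewrite nm_ge0 nm_ex_divn.
Qed.

Lemma nm_ex_real z : complex.Im z = 0 -> nm (ex z) = 1.
Proof. by move=> h; rewrite nm_ex h mulr0 oppr0 expR0. Qed.

Lemma nm_ex_rat (v : int) (n : nat) : nm (ex (v%:~R / n%:R : C)) = 1.
Proof.
apply: nm_ex_real.
by rewrite -(rmorph_int (real_complex R)) -(rmorph_nat (real_complex R)) -fmorphV -rmorphM.
Qed.

Lemma fexp_G (u : nat) z : nm z = 1 ->
  exists c, fexp 12 c (fun t => G (ex t) (z * ex (u%:R * t / 12%:R))).
Proof.
(* For u = 0 the first factor 1 - z has exponent 0, which violates i < e i in [tends_prodc]; it is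
   split off, and 12 replaces 0. *)
move=> z1; wlog u0 : u / (0 < u)%N.
  move=> H; case: u => [|u]; last exact: H.
  have [c hc] := H 12%N isT; exists (fun n => (1 - z) * c n).
  apply: fexp_eq (fexpZ (1 - z) _ hc) => // t t0.
  rewrite mul0r mul0r ex0 mulr1 [RHS]G_rec ?nm_ex_lt1 //; congr (_ * G _ _).
  by rewrite mulrC; congr (ex _ * _); field.
have eu i : (i < 12 * i + u)%N by lia.
exists (prodc (fun=> z) (fun i => 12 * i + u)%N); split=> [r r1 | t t0].
  by apply: sm_prodc => // i; rewrite z1.
have x1 : nm (ex (t / 12%:R)) < 1 by apply: nm_ex_divn.
have q12 : ex (t / 12%:R) ^+ 12 = ex t by rewrite -exMn; congr ex; field.
have q1 : nm (ex t) < 1 by rewrite nm_ex_lt1.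
apply: (tends_unique (tends_G _ q1)).
have hz (i : nat) : nm ((fun=> z) i) <= 1 by rewrite z1.
apply: tends_ext (tends_prodc hz eu x1) => n; apply: eq_bigr => i _.
by rewrite exprD exprM q12 -mulrA exMn [z * (_ * _)]mulrCA.
Qed.

Lemma fexp_th (u : nat) z : nm z = 1 -> (u < 12)%N ->
  exists c, fexp 12 c (fun t => th (ex t) (z * ex (u%:R * t / 12%:R))).
Proof.
move=> z1 u12; have [c hc] := fexp_G u z1.
have z2 : nm z^-1 = 1 by rewrite nmV z1 invr1.
have [d hd] := fexp_G (12 - u) z2.
exists (conv c d); apply: fexp_eq (fexpM _ hc hd) => // t t0.
rewrite /th; congr (_ * G _ _); rewrite invfM mulrCA -exN -exD; congr (_ * ex _).
by rewrite natrB 1?ltnW //; field.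
Qed.

Lemma fexp_eulG : fexp 1 (fun n => (eul n)%:~R) (@eulG R).
Proof.
have eE : (fun n => (eul n)%:~R) = prodc (fun=> 1 : C) succn.
  apply/funext => n; transitivity ((map_poly (intr : int -> C) (eulp n))`_n).
    by rewrite coef_map.
  rewrite -[RHS]/((\prod_(i < n) (1 - (1 : C) *: 'X^(i.+1)))`_n).
  suff -> : map_poly (intr : int -> C) (eulp n) = \prod_(i < n) (1 - (1 : C) *: 'X^(i.+1)) by [].
  rewrite /eulp rmorph_prod; apply: eq_bigr => i _.
  by rewrite rmorphB /= rmorph1 map_polyXn scale1r.
have hz (i : nat) : nm ((fun=> 1 : C) i) <= 1 by rewrite nm1.
split=> [r r1 | t t0]; rewrite eE; first exact: sm_prodc.
rewrite divr1 /eulG; have q1 : nm (ex t) < 1 by rewrite nm_ex_lt1.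
apply: (tends_unique (tends_G _ q1)).
apply: tends_ext (tends_prodc hz (fun i => ltnSn i) q1) => n; apply: eq_bigr => i _.
by rewrite mul1r exprSr.
Qed.

Definition res12 (x : int) : nat := `|(x %% 12)%Z|%N.

(** Once u is reduced to r in 0..11, both arguments of the theta product are nonnegative powers of
    q^(1/12). Only the prefactor has a negative exponent, (r/12)(r/12 - 1)/2 = -r(12 - r)/288. *)
Lemma kap_exp (u v : int) :
  exists K c g, fexp 12 c g /\ forall t, 0 < complex.Im t ->
    kap u v t = K * ex (- ((res12 u * (12 - res12 u))%:R * t / 288%:R)) * g t / eulG t ^+ 2.
Proof.
set r := res12 u.
have rE : (u %% 12)%Z = r%:Z by rewrite /r /res12 gez0_abs // modz_ge0.
have r12 : (r < 12)%N by have := @ltz_pmod u 12 isT; rewrite rE ltz_nat.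
have z1 := nm_ex_rat v 12.
have [c hc] := fexp_th z1 r12.
pose ph : C := ex (((u %/ 12)%Z * (12 - v))%:~R / 24).
exists (ph * ex ((r%:~R / 12 - 1) * (v%:~R / 12) / 2)), c; eexists; split; first exact: hc.
move=> t t0; rewrite {1}(divz_eq u 12) [_ * 12]mulrC addrC kap_D1 // -/ph rE kap_th //.
have -> : ex (r%:~R / 12 * t + v%:~R / 12) = ex (v%:~R / 12%:R) * ex (r%:R * t / 12%:R).
  by rewrite -exD; congr ex; rewrite -[r%:~R]/(r%:R); field.
have -> : ex ((r%:~R / 12 - 1) * (r%:~R / 12 * t + v%:~R / 12) / 2) =
    ex ((r%:~R / 12 - 1) * (v%:~R / 12) / 2) * ex (- ((r * (12 - r))%:R * t / 288%:R)).
  by rewrite -exD; congr ex; rewrite natrM natrB 1?ltnW // -[r%:~R]/(r%:R); field.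
by move: ph (ex (_ / 2)) (ex (- _)) (th _ _) (eulG t ^+ 2)^-1 => A B D E I; ring.
Qed.

Definition F0 (M : nat) t : C := hq t * W t ^+ M.

(** The moved points of [kap4] have first coordinates 2c, 4c, 3c and 6a + 3c, so the sum depends on
    c modulo 12 and a modulo 2. With the contribution 48 of [W] squared, the orders of
    eta(6t)/eta(t) in q^(1/144) are 48 minus half the sum: 30, -5, -2, 3. *)
Lemma exponents_mod12 (a c : int) : ~~ ((2 %| a)%Z && (2 %| c)%Z) ->
  (res12 (2 * c)%R * (12 - res12 (2 * c)%R) + res12 (4 * c)%R * (12 - res12 (4 * c)%R)
   + res12 (3 * c)%R * (12 - res12 (3 * c)%R)
   + res12 (6 * a + 3 * c)%R * (12 - res12 (6 * a + 3 * c)%R))%N \in [:: 36; 106; 100; 90]%N.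
Proof.
move=> h.
have rD x y : (12 %| x - y)%Z -> res12 x = res12 y by move=> xy; rewrite /res12; congr absz; apply/eqP; rewrite eqz_mod_dvd.
pose i := `|(c %% 12)%Z|%N; pose e := `|(a %% 2)%Z|%N.
have iE : (c %% 12)%Z = i%:Z by rewrite /i gez0_abs // modz_ge0.
have eE : (a %% 2)%Z = e%:Z by rewrite /e gez0_abs // modz_ge0.
have i12 : (i < 12)%N by have := @ltz_pmod c 12 isT; rewrite iE ltz_nat.
have e2 : (e < 2)%N by have := @ltz_pmod a 2 isT; rewrite eE ltz_nat.
have cE : c = (c %/ 12)%Z * 12 + i%:Z by rewrite -iE -divz_eq.
have aE : a = (a %/ 2)%Z * 2 + e%:Z by rewrite -eE -divz_eq.
have hr (s : int) : res12 (s * c) = res12 (s * i%:Z).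
  by apply: rD; apply/dvdzP; exists (s * (c %/ 12)%Z); rewrite {1}cE; ring.
have hr6 : res12 (6 * a + 3 * c) = res12 (6 * e%:Z + 3 * i%:Z).
  by apply: rD; apply/dvdzP; exists ((a %/ 2)%Z + 3 * (c %/ 12)%Z); rewrite {1}cE {1}aE; ring.
rewrite hr6 !hr.
have : ~~ ((e == 0)%N && ~~ odd i).
  apply: contra h => /andP[/eqP e0 oi]; apply/andP; split.
    by rewrite aE e0 addr0 dvdz_mull.
  by apply/dvdzP; exists ((c %/ 12)%Z * 6 + (i./2)%:Z); rewrite {1}cE; lia.
move: e e2 i i12 {hr hr6 iE eE cE aE}.
by case=> [|[|//]] _; do 12![case=> [_ //|]].
Qed.

Lemma F0_slash (M : nat) (a b c d : int) : (0 < M)%N -> a * d - b * c = 1 ->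
  exists2 co, fexp 144 co (fun t => (c%:~R * t + d%:~R) ^- (2 * M) * F0 M (mob a b c d t)) &
    forall n, co n != 0 -> (24 * M <= n + 5)%N && (n != 24 * M)%N.
Proof.
move=> M0 h.
have hac : ~~ ((2 %| a)%Z && (2 %| c)%Z).
  apply/negP => /andP[/dvdzP[x ax] /dvdzP[y cy]].
  have : 2 * (x * d - b * y) = 1 by rewrite -[RHS]h ax cy; ring.
  by lia.
have := exponents_mod12 hac.
have [K1 [c1 [g1 [e1 k1]]]] := kap_exp (0 * a + 2 * c) (0 * b + 2 * d).
have [K2 [c2 [g2 [e2 k2]]]] := kap_exp (0 * a + 4 * c) (0 * b + 4 * d).
have [K3 [c3 [g3 [e3 k3]]]] := kap_exp (0 * a + 3 * c) (0 * b + 3 * d).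
have [K4 [c4 [g4 [e4 k4]]]] := kap_exp (6 * a + 3 * c) (6 * b + 3 * d).
move: k1 k2 k3 k4; rewrite !mul0r !add0r.
move: (res12 (2 * c) * _)%N (res12 (4 * c) * _)%N (res12 (3 * c) * _)%N (res12 (6 * a + 3 * c) * _)%N => D1 D2 D3 D4 k1 k2 k3 k4 hD.
(* So s is 24M + 30, 24M - 5, 24M - 2 or 24M + 3; none of these differs from 24M by a multiple of
   12. *)
have [s hs sP] : exists2 s, (2 * s + (D1 + D2 + D3 + D4) = 48 * M + 96)%N &
   forall j, (24 * M <= (s + 12 * j) + 5)%N && ((s + 12 * j) != 24 * M)%N.
  exists ((48 * M + 96 - (D1 + D2 + D3 + D4)) %/ 2)%N.
    by move: hD; rewrite !inE => /or4P[]/eqP ->; lia.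
  by move=> j; move: hD; rewrite !inE => /or4P[]/eqP ->; lia.
set E := ex ((etaX a b c d)%:~R / 6%:R) : C.
set L := (ch R)^-1 * E ^+ (2 + M) * (K1 * K2 * K3 * K4).
pose co0 := conv (conv (conv c1 c2) (conv c3 c4)) (cpow (stretch 12 (fun n => (eul n)%:~R : C)) (4 * M)).
have e0 : fexp 12 co0 (fun t => g1 t * g2 t * (g3 t * g4 t) * eulG t ^+ (4 * M)).
  apply: fexpM => //; first by apply: fexpM => //; apply: fexpM.
  by apply: fexpX => //; apply: (@fexp_stretch 1) => //; apply: fexp_eulG.
exists (shift_seq s (stretch 12 (fun n => L * co0 n))); last first.
  move=> n; rewrite /shift_seq /stretch; case: ltnP => sn; first by rewrite eqxx.
  case: ifP => [/dvdnP[j jE] _ | _]; last by rewrite eqxx.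
  by have := sP j; rewrite [(12 * j)%N]mulnC -jE subnKC.
have i12 : (0 < 12)%N by [].
have := fexp_shift s (isT : (0 < 12 * 12)%N) (fexp_stretch i12 i12 (fexpZ L i12 e0)).
rewrite (_ : (12 * 12)%N = 144%N) //.
apply: fexp_eq => t t0.
have w0 := aut_neq0 h t0; have E0 := eulG_neq0 t0.
rewrite /F0 W_mob // -/E.
have -> : hq (mob a b c d t) = (ch R)^-1 * (ch R * hq (mob a b c d t)) by rewrite mulKf // ch_neq0.
rewrite hq_mob // /kap4 !mul0r !add0r k1 // k2 // k3 // k4 // -/E.
have -> : ex (s%:R * t / 144%:R) = ex (- (D1%:R * t / 288%:R)) * ex (- (D2%:R * t / 288%:R)) *
   ex (- (D3%:R * t / 288%:R)) * ex (- (D4%:R * t / 288%:R)) * ex (t / 6) ^+ (2 + M).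
  rewrite -exMn -!exD; congr ex; have := congr1 (fun n => n%:R : C) hs.
  move=> hs'; have -> : s%:R = ((2 * s + (D1 + D2 + D3 + D4))%N%:R - (D1%:R + D2%:R + D3%:R + D4%:R)) / 2 :> C by field.
  by rewrite hs'; field.
rewrite /L /W {L}.
have -> : ((c%:~R * t + d%:~R) ^+ 2 * (E * (ex (t / 6) * eulG t ^+ 4))) ^+ M =
  (c%:~R * t + d%:~R) ^+ (2 * M) * (E ^+ M * (ex (t / 6) ^+ M * (eulG t ^+ 4) ^+ M)).
  by rewrite exprM -!exprMn.
rewrite !(exprD _ 2 M); move: (E ^+ M) (ex (t / 6) ^+ M) => EM XM.
have : (c%:~R * t + d%:~R) ^+ (2 * M) != 0 by rewrite expf_neq0.
rewrite -[(eulG t ^+ 4) ^+ M]exprM.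
move: ((c%:~R * t + d%:~R) ^+ (2 * M)) (eulG t ^+ (4 * M)) (ch R)^-1 (ex (t / 6)) => A P H X A0.
move: (ex (- (D1%:R * _ / _))) (ex (- (D2%:R * _ / _))) (ex (- (D3%:R * _ / _))) (ex (- (D4%:R * _ / _))) => X1 X2 X3 X4.
move: (g1 t) (g2 t) (g3 t) (g4 t) (eulG t) E0 E => G1 G2 G3 G4 e e_0 E1.
by field; rewrite A0 e_0.
Qed.

End Expansions.

(** * Hecke operators at level 144 *)

Section Slash.
Variables (R : realType) (k : nat).
Local Notation C := R[i].
Implicit Types (t z : C) (f g : C -> C) (a b c d : int).

Definition sl f a b c d t : C := (c%:~R * t + d%:~R) ^- k * f (mob a b c d t).

Lemma aut_comp c d a' b' c' d' t : a' * d' - b' * c' = 1 -> 0 < complex.Im t ->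
  (c%:~R * mob a' b' c' d' t + d%:~R) * (c'%:~R * t + d'%:~R) =
  (c * a' + d * c')%:~R * t + (c * b' + d * d')%:~R.
Proof.
move=> h t0; have w0 := aut_neq0 h t0; rewrite /mob !intrD !intrM.
by rewrite mulrDl -[c%:~R * _ * _]mulrA divfK //; ring.
Qed.

Lemma mob_comp a b c d a' b' c' d' t : a * d - b * c = 1 -> a' * d' - b' * c' = 1 ->
  0 < complex.Im t -> mob a b c d (mob a' b' c' d' t) =
  mob (a * a' + b * c') (a * b' + b * d') (c * a' + d * c') (c * b' + d * d') t.
Proof.
move=> h h' t0; have w0 := aut_neq0 h' t0; have w1 := aut_neq0 h (Im_mob h' t0).
rewrite [RHS]/mob -(aut_comp c d h' t0) -(aut_comp a b h' t0) {1}/mob.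
by rewrite invfM mulrACA mulfV // mulr1.
Qed.

Lemma sl_comp f a b c d a' b' c' d' t : a * d - b * c = 1 -> a' * d' - b' * c' = 1 ->
  0 < complex.Im t -> sl (sl f a b c d) a' b' c' d' t =
  sl f (a * a' + b * c') (a * b' + b * d') (c * a' + d * c') (c * b' + d * d') t.
Proof.
move=> h h' t0; rewrite /sl mob_comp // mulrA; congr (_ * _).
by rewrite -(aut_comp c d h' t0) [in RHS]mulrC exprMn invfM.
Qed.

Lemma eq_sl f g a b c d t : a * d - b * c = 1 -> 0 < complex.Im t ->
  (forall t, 0 < complex.Im t -> f t = g t) -> sl f a b c d t = sl g a b c d t.
Proof. by move=> h t0 fg; rewrite /sl fg // Im_mob. Qed.

Lemma sl1 f t : sl f 1 0 0 1 t = f t.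
Proof. by rewrite /sl /mob !mul0r !add0r !mul1r divr1 addr0 expr1n invr1 mul1r. Qed.

Lemma sl_trans f (n : int) t : sl f 1 n 0 1 t = f (t + n%:~R).
Proof. by rewrite /sl /mob !mul0r !add0r !mul1r divr1 expr1n invr1 mul1r. Qed.

Definition inv144 f := forall a b c d, a * d - b * c = 1 ->
  (144 %| a - 1)%Z -> (144 %| b)%Z -> (144 %| c)%Z -> (144 %| d - 1)%Z ->
  forall t, 0 < complex.Im t -> sl f a b c d t = f t.

(** The quotient of two matrices congruent modulo 144 lies in the principal congruence group, under
    which [f] is invariant. *)
Lemma sl_congr f a b c d a' b' c' d' t : inv144 f ->
  a * d - b * c = 1 -> a' * d' - b' * c' = 1 ->
  (144 %| a - a')%Z -> (144 %| b - b')%Z -> (144 %| c - c')%Z -> (144 %| d - d')%Z ->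
  0 < complex.Im t -> sl f a b c d t = sl f a' b' c' d' t.
Proof.
move=> fi h h' /dvdzP[x1 e1] /dvdzP[x2 e2] /dvdzP[x3 e3] /dvdzP[x4 e4] t0.
have hd : (a * d' - b * c') * (- c * b' + d * a') - (- a * b' + b * a') * (c * d' - d * c') = 1.
  by rewrite -[RHS]mulr1 -{1}h -h'; ring.
have -> : sl f a b c d t = sl (sl f (a * d' - b * c') (- a * b' + b * a') (c * d' - d * c') (- c * b' + d * a')) a' b' c' d' t.
  rewrite sl_comp //; congr sl.
  - by rewrite -[LHS]mulr1 -h'; ring.
  - by rewrite -[LHS]mulr1 -h'; ring.
  - by rewrite -[LHS]mulr1 -h'; ring.
  by rewrite -[LHS]mulr1 -h'; ring.
apply: eq_sl => // z z0; apply: fi => //; apply/dvdzP.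
- exists (x1 * d' - x2 * c').
  have -> : a = x1 * 144 + a' by rewrite -e1 subrK.
  have -> : b = x2 * 144 + b' by rewrite -e2 subrK.
  by rewrite -[X in _ - X]h'; ring.
- exists (- x1 * b' + x2 * a').
  have -> : a = x1 * 144 + a' by rewrite -e1 subrK.
  have -> : b = x2 * 144 + b' by rewrite -e2 subrK.
  by ring.
- exists (x3 * d' - x4 * c').
  have -> : c = x3 * 144 + c' by rewrite -e3 subrK.
  have -> : d = x4 * 144 + d' by rewrite -e4 subrK.
  by ring.
exists (- x3 * b' + x4 * a').
have -> : c = x3 * 144 + c' by rewrite -e3 subrK.
have -> : d = x4 * 144 + d' by rewrite -e4 subrK.
by rewrite -[X in _ - X]h'; ring.
Qed.

(** This is where normality of the principal congruence group enters. *)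
Lemma inv144_sl f a b c d : inv144 f -> a * d - b * c = 1 -> inv144 (sl f a b c d).
Proof.
move=> fi h a' b' c' d' h' /dvdzP[x1 e1] /dvdzP[x2 e2] /dvdzP[x3 e3] /dvdzP[x4 e4] t t0.
rewrite sl_comp //; apply: sl_congr => //; try (apply/dvdzP).
- by rewrite -[RHS]mulr1 -{1}h -h'; ring.
- by exists (a * x1 + b * x3); rewrite mulrDl -!mulrA -e1 -e3; ring.
- by exists (a * x2 + b * x4); rewrite mulrDl -!mulrA -e2 -e4; ring.
- by exists (c * x1 + d * x3); rewrite mulrDl -!mulrA -e1 -e3; ring.
by exists (c * x2 + d * x4); rewrite mulrDl -!mulrA -e2 -e4; ring.
Qed.

End Slash.

Section FpSums.
Variable p : nat.
Hypothesis pp : prime p.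

Lemma Fp_dvd (n : int) : n%:~R = 0 :> 'F_p -> (p %| n)%Z.
Proof.
have h (m : nat) : m%:R = 0 :> 'F_p -> (p %| m)%N.
  by move/eqP; rewrite -(dvdn_pcharf (pchar_Fp pp)).
case: n => m; first by move/h.
by rewrite NegzE mulrNz => /eqP; rewrite oppr_eq0 => /eqP /h; rewrite dvdzE abszN.
Qed.

Lemma Fp_val (x : 'F_p) : (x : nat)%:Z%:~R = x.
Proof. exact: natr_Zp. Qed.

Lemma Fp_periodic (T : Type) (H : int -> T) (n : int) (x : 'F_p) :
  (forall m, H (m + p%:Z) = H m) -> n%:~R = x -> H n = H (x : nat)%:Z.
Proof.
move=> hp nx.
have up (j : nat) m : H (m + j%:Z * p%:Z) = H m.
  elim: j => [|j IH]; first by rewrite mul0r addr0.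
  by rewrite -addn1 PoszD mulrDl mul1r addrA hp.
have : (p %| n - (x : nat)%:Z)%Z by apply: Fp_dvd; rewrite rmorphB /= Fp_val nx subrr.
case/dvdzP => -[] j e.
  by have -> : n = (x : nat)%:Z + j%:Z * p%:Z by rewrite -[j%:Z * _]e; ring.
have -> : (x : nat)%:Z = n + j.+1%:Z * p%:Z by rewrite NegzE mulNr in e; rewrite -[_ * _]opprK -e; ring.
by rewrite up.
Qed.

Lemma sum_Fp (V : nmodType) (X : nat -> V) : \sum_(j : 'F_p) X j = \sum_(j < p) X j.
Proof. by rewrite -(big_mkord xpredT X) Fp_cast // big_mkord. Qed.

End FpSums.

Section Hecke.
Variables (R : realType) (k p : nat) (p' e : int).
Local Notation C := R[i].
Hypotheses (pp : prime p) (pe : p%:Z * p' = 1 + 144 * e).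
Implicit Types (t z : C) (f g : C -> C) (a b c d : int).

Local Notation slk := (sl k).
Local Notation s1 := (p' * (1 - 144 * e)).
Local Notation s2 := (- (144 * e ^+ 2)).

(* (s1, s2; 144, p) is an element of SL_2(Z) congruent to diag(1/p, p) modulo 144 *)
Definition heckeS f := slk f s1 s2 144 p%:Z.

(** The representatives are (1, 144 j; 0, p) and sigma (p, 0; 0, 1) with sigma the matrix of
    [heckeS], all congruent to diag(1, p) modulo 144. The scaling makes U_p appear with coefficient
    1. *)
Definition hecke f t : C :=
  (p%:R ^+ k * heckeS f (p%:R * t) + \sum_(j : 'F_p) f ((t + (144 * (j : nat)%:Z)%:~R) / p%:R)) / p%:R.

Let p0 : (0 < p)%N. Proof. exact: prime_gt0. Qed.
Let pN : p%:R != 0 :> C. Proof. by rewrite pnatr_eq0 -lt0n. Qed.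

Let sdet : s1 * p%:Z - s2 * 144 = 1.
Proof.
have -> : s1 * p%:Z - s2 * 144 = (p%:Z * p') * (1 - 144 * e) + (144 * e) ^+ 2 by ring.
by rewrite pe; ring.
Qed.

Lemma Im_muln t : 0 < complex.Im t -> 0 < complex.Im (p%:R * t).
Proof.
by case: t => x y /= y0; rewrite -(rmorph_nat (real_complex R)) /= mul0r addr0 mulr_gt0 ?ltr0n.
Qed.

Lemma Im_addz t (n : int) : complex.Im (t + n%:~R) = complex.Im t.
Proof. by rewrite -(rmorph_int (real_complex R)) Im_addr. Qed.

Let Imj t (n : int) : 0 < complex.Im t -> 0 < complex.Im ((t + n%:~R) / p%:R).
Proof. by move=> t0; rewrite Im_divn // Im_addz. Qed.

Lemma eq_hecke f g t : (forall t, 0 < complex.Im t -> f t = g t) -> 0 < complex.Im t ->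
  hecke f t = hecke g t.
Proof.
move=> fg t0; rewrite /hecke; congr ((_ * _ + _) / _).
  by apply: eq_sl => //; apply: Im_muln.
by apply: eq_bigr => j _; rewrite fg // Imj.
Qed.

Lemma heckeZ f (x : C) t : hecke (fun t => x * f t) t = x * hecke f t.
Proof.
rewrite /hecke /heckeS /sl -mulr_sumr.
by move: (f _) (\sum_(_ | _) _) (_ ^- k) => A B D; ring.
Qed.

Let per f t : inv144 k f -> 0 < complex.Im t -> forall m : int,
  f ((t + (144 * (m + p%:Z))%:~R) / p%:R) = f ((t + (144 * m)%:~R) / p%:R).
Proof.
move=> fi t0 m; have hd : (1 : int) * 1 - 144 * 0 = 1 by [].
have := fi 1 144 0 1 hd isT isT isT isT _ (Imj (144 * m) t0).
rewrite /sl mul0r add0r expr1n invr1 mul1r => <-; congr f.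
by rewrite /mob mul0r add0r mul1r divr1 !intrM intrD -[p%:Z%:~R]/(p%:R); field.
Qed.

(** As 1 = p p' - 144 e, the point (t + 1 + 144 (j + e)) / p is (t + 144 j) / p + p': translation by
    1 turns into translation by p', with the indices shifted modulo p. *)
Lemma hecke_T f t : inv144 k f -> 0 < complex.Im t -> hecke f (t + 1) = hecke (slk f 1 p' 0 1) t.
Proof.
move=> fi t0; rewrite /hecke; congr ((_ * _ + _) / _).
  have h1 : (1 : int) * 1 - p' * 0 = 1 by rewrite mulr0 subr0.
  have h2 : (1 : int) * 1 - p%:Z * 0 = 1 by rewrite mulr0 subr0.
  have -> : heckeS f (p%:R * (t + 1)) = slk (heckeS f) 1 p%:Z 0 1 (p%:R * t).
    by rewrite sl_trans mulrDr mulr1.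
  have pt0 := Im_muln t0; rewrite /heckeS !sl_comp //.
  apply: sl_congr => //.
  - by rewrite -[RHS]sdet; ring.
  - by rewrite -[RHS]sdet; ring.
  - by apply/dvdzP; exists (- p'); ring.
  - by apply/dvdzP; exists (- e * (p' * p%:Z)); ring.
  - by apply/dvdzP; exists 0; ring.
  by apply/dvdzP; exists (p%:Z); ring.
have t1 : 0 < complex.Im (t + 1) by rewrite Im_add1.
pose H (m : int) := f ((t + 1 + (144 * m)%:~R) / p%:R).
transitivity (\sum_(j : 'F_p) H ((j : nat)%:Z + e)).
  rewrite (reindex_inj (@addIr _ (e%:~R : 'F_p))); apply: eq_bigr => j _.
  pose je : 'F_p := (j : 'F_p) + (e%:~R : 'F_p).
  have E : H ((j : nat)%:Z + e) = H (je : nat)%:Z.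
    by apply: (Fp_periodic pp (per fi t1)); rewrite rmorphD /= Fp_val.
  exact: (esym E).
apply: eq_bigr => j _; rewrite sl_trans /H; congr f.
have h : p%:R * p'%:~R = 1 + 144 * e%:~R :> C by rewrite -[p%:R]/(p%:Z%:~R) -intrM pe; ring.
have -> : p'%:~R = (1 + 144 * e%:~R) / p%:R :> C by rewrite -h mulrC mulKf.
by rewrite !intrM intrD -[144%:~R]/(144%:R); field.
Qed.

Lemma hecke_V f t : inv144 k f -> 0 < complex.Im t -> hecke f (t - 1) = hecke (slk f 1 (- p') 0 1) t.
Proof.
move=> fi t0; have t1 : 0 < complex.Im (t - 1) by rewrite Im_sub1.
have gi : inv144 k (slk f 1 (- p') 0 1) by apply: inv144_sl => //; rewrite mulr0 subr0.
have := hecke_T gi t1; rewrite subrK => ->; apply: eq_hecke t1 => z z0.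
by rewrite !sl_trans intrN addrK.
Qed.

(** The inversion exchanges j = 0 with the representative built on sigma, and sends j to the j' with
    144^2 j j' = -1 modulo p: then (144 j, B; p, -144 j') has determinant 1 for some B and is
    congruent to the matrix on the right. *)
Lemma hecke_S f t : inv144 k f -> 0 < complex.Im t ->
  t ^- k * hecke f (- t^-1) = hecke (slk f 144 (- s1) p%:Z (144 * e ^+ 2)) t.
Proof.
move=> fi t0; have tn := Im_neq0 t0; have ti := Im_inv t0; have pt0 := Im_muln t0.
have pti := Im_muln ti.
have d0 : (144 : int) * (144 * e ^+ 2) - (- s1) * p%:Z = 1 by rewrite -[RHS]sdet; ring.
rewrite /hecke mulrA; congr (_ / _).
pose L (m : int) := t ^- k * f ((- t^-1 + (144 * m)%:~R) / p%:R).
pose S' := slk f 144 (- s1) p%:Z (144 * e ^+ 2).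
pose Q (m : int) := S' ((t + (144 * m)%:~R) / p%:R).
have LQ (n144 : int) : n144 = 144 -> forall (j j' B : int), p%:Z * B = - 1 - n144 * n144 * j * j' -> L j = Q j'.
  move=> -> j j' B.
  move=> hB; rewrite /Q /S'.
  have zj := Imj (144 * j') t0.
  have hd : 144 * j * - (144 * j') - B * p%:Z = 1.
    have -> : 144 * j * - (144 * j') - B * p%:Z = - (144 * 144 * j * j') - p%:Z * B by ring.
    by rewrite hB; ring.
  rewrite (@sl_congr _ _ f 144 (- s1) p%:Z (144 * e ^+ 2) (144 * j) B p%:Z (- (144 * j'))) //.
  - rewrite /sl /L; congr (_ ^- k * f _).
      by rewrite intrN -[p%:Z%:~R]/(p%:R) mulrC divfK //; ring.
    rewrite /mob; have -> : p%:Z%:~R * ((t + (144 * j')%:~R) / p%:R) + (- (144 * j'))%:~R = t.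
      by rewrite intrN -[p%:Z%:~R]/(p%:R) mulrC divfK //; ring.
    have hB' : p%:R * B%:~R = - 1 - 144 * 144 * j%:~R * j'%:~R :> C.
      by rewrite -[p%:R]/(p%:Z%:~R) -intrM hB; ring.
    have -> : B%:~R = (- 1 - 144 * 144 * j%:~R * j'%:~R) / p%:R :> C by rewrite -hB' mulrC mulKf.
    by rewrite !intrM -[144%:~R]/(144%:R); field; rewrite pN tn.
  - by apply/dvdzP; exists (1 - j); ring.
  - have -> : - s1 - B = p' * 144 * e - (1 + 144 * e) * B + 144 * e * B - p' by ring.
    rewrite -pe; have -> : p%:Z * p' * B = p' * (p%:Z * B) by ring.
    by rewrite hB; apply/dvdzP; exists (p' * e + p' * 144 * j * j' + e * B); ring.
  - by apply/dvdzP; exists 0; ring.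
  by apply/dvdzP; exists (e ^+ 2 + j'); ring.
have LX : t ^- k * (p%:R ^+ k * heckeS f (p%:R * - t^-1)) = Q 0.
  rewrite /Q mulr0 addr0.
  have h01 : (0 : int) * 0 - (-1) * 1 = 1 by [].
  have tp0 := Im_divn t0 p0.
  have -> : S' (t / p%:R) = slk (heckeS f) 0 (-1) 1 0 (t / p%:R).
    rewrite /S' /heckeS sl_comp //; apply: sl_congr => //.
    - by rewrite -[RHS]sdet; ring.
    - by apply/dvdzP; exists (1 + e ^+ 2); ring.
    - by apply/dvdzP; exists 0; ring.
    - by apply/dvdzP; exists 0; ring.
    by apply/dvdzP; exists (1 + e ^+ 2); ring.
  rewrite [RHS]/sl /mob !mul0r !add0r mul1r addr0 intrN mulN1r.
  rewrite exprMn exprVn invfM invrK mulrA [_ * p%:R ^+ k]mulrC [in RHS]mulrC.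
  congr (_ * heckeS f _); first by rewrite mulrC.
  by rewrite invfM invrK mulrN [t^-1 * _]mulrC.
have QX : p%:R ^+ k * heckeS S' (p%:R * t) = L 0.
  have h01 : (0 : int) * 0 - (-1) * 1 = 1 by [].
  have -> : heckeS S' (p%:R * t) = slk f 0 (-1) 1 0 (p%:R * t).
    rewrite /S' /heckeS sl_comp //; congr (slk f _ _ _ _ _).
    - by ring.
    - by apply: oppr_inj; rewrite opprK -[RHS]sdet; ring.
    - by rewrite -[RHS]sdet; ring.
    by ring.
  have m0 z : mob 0 (-1) 1 0 z = - z^-1 :> C by rewrite /mob mul0r add0r mul1r addr0 intrN mulN1r.
  rewrite /sl m0 mul1r addr0 /L (_ : (144 * 0)%:~R = 0) // addr0.
  have -> : - (p%:R * t)^-1 = - t^-1 / p%:R by rewrite invfM mulNr mulrC.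
  by rewrite exprMn invfM [LHS]mulrA mulVKf ?expf_neq0.
have EL : t ^- k * (\sum_(j : 'F_p) f ((- t^-1 + (144 * (j : nat)%:Z)%:~R) / p%:R)) =
    L 0 + \sum_(j : 'F_p | j != 0) L (j : nat)%:Z.
  by rewrite mulr_sumr (@bigD1 _ _ _ _ (0 : 'F_p) xpredT _ isT).
have EQ : \sum_(j : 'F_p) S' ((t + (144 * (j : nat)%:Z)%:~R) / p%:R) =
    Q 0 + \sum_(j : 'F_p | j != 0) Q (j : nat)%:Z.
  by rewrite (@bigD1 _ _ _ _ (0 : 'F_p) xpredT _ isT).
suff ELQ : \sum_(j : 'F_p | j != 0) L (j : nat)%:Z = \sum_(j : 'F_p | j != 0) Q (j : nat)%:Z.
  by rewrite mulrDr LX EL QX EQ ELQ addrCA.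
have [n144 nE] : exists n144 : int, n144 = 144 by exists 144.
have h144 : n144%:~R != 0 :> 'F_p.
  apply/negP => /eqP /(Fp_dvd pp) h144; have : (p%:Z %| (1 : int))%Z.
    have -> : 1 = p%:Z * p' - 144 * e by rewrite pe; ring.
    by rewrite -nE rpredB ?dvdz_mulr.
  by rewrite dvdz1 => /eqP p1; move: pp; rewrite -[p]/(`|p%:Z|%N) p1.
pose u : 'F_p := n144%:~R * n144%:~R.
have u0 : u != 0 by rewrite mulf_neq0.
have inj : injective (fun x : 'F_p => - (u * x)^-1).
  by move=> x y /oppr_inj /invr_inj /(mulfI u0).
rewrite [RHS](reindex_inj inj); apply: eq_big => [x | x x0].
  by rewrite oppr_eq0 invr_eq0 mulf_eq0 (negPf u0).
pose y : 'F_p := - (u * x)^-1.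
rewrite -[RHS]/(Q (y : nat)%:Z).
have : (p %| - 1 - n144 * n144 * (x : nat)%:Z * (y : nat)%:Z)%Z.
  apply: (Fp_dvd pp); rewrite intrB intrN !intrM !Fp_val -/u /y mulrN mulfV ?mulf_neq0 //.
  by rewrite opprK addNr.
by case/dvdzP => B hB; apply: (LQ _ nE _ _ B); rewrite hB mulrC.
Qed.

End Hecke.

Section HeckeAction.
Variables (R : realType) (k p : nat) (p' e : int).
Local Notation C := R[i].
Hypotheses (pp : prime p) (pe : p%:Z * p' = 1 + 144 * e).
Implicit Types (t z : C) (f g : C -> C) (a b c d : int).

Local Notation slk := (sl k).
Local Notation hk := (hecke k p p' e).

Let p0 : (0 < p)%N. Proof. exact: prime_gt0. Qed.

(** The new matrix is, modulo 144, the conjugate (a, b/p; p c, d). It is built along the word in the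
    generators, by [hecke_T], [hecke_V] and [hecke_S]; only its residues matter later. *)
Lemma hecke_mob a b c d : a * d - b * c = 1 -> exists a' b' c' d' : int,
  [/\ a' * d' - b' * c' = 1,
      exists x1 x2 x3 x4 : int, [/\ a' = a + 144 * x1, p%:Z * b' = b + 144 * x2,
         c' = p%:Z * c + 144 * x3 & d' = d + 144 * x4]
    & forall f, inv144 k f -> forall t, 0 < complex.Im t ->
        slk (hk f) a b c d t = hk (slk f a' b' c' d') t].
Proof.
move: a b c d; apply: SL2_ind.
- exists 1, 0, 0, 1; split=> //.
    by exists 0, 0, 0, 0; rewrite !mulr0 !addr0.
  move=> f fi t t0; rewrite sl1; apply: eq_hecke => // z z0.
  by rewrite sl1.
- move=> a b c d h [a' [b' [c' [d' [h' [x1 [x2 [x3 [x4 [e1 e2 e3 e4]]]]] IH]]]]].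
  exists a', (a' * p' + b'), c', (c' * p' + d'); split.
  + by rewrite -h'; ring.
  + exists x1, (a * e + x1 * p%:Z * p' + x2), x3, (c * e + x3 * p' + x4); split=> //.
      have -> : p%:Z * (a' * p' + b') = a' * (p%:Z * p') + p%:Z * b' by ring.
      rewrite e2 e1 pe.
      have -> : x1 * p%:Z * p' = x1 * (1 + 144 * e) by rewrite -pe; ring.
      by ring.
    have -> : c' * p' + d' = c * (p%:Z * p') + 144 * x3 * p' + d' by rewrite e3; ring.
    by rewrite pe e4; ring.
  move=> f fi t t0; have t1 : 0 < complex.Im (t + 1) by rewrite Im_add1.
  have -> : slk (hk f) a (b + a) c (d + c) t = slk (hk f) a b c d (t + 1).
    by rewrite /sl mob_T; congr (_ ^- k * _); rewrite intrD; ring.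
  rewrite IH // hecke_T //; last exact: inv144_sl.
  apply: eq_hecke => // z z0; rewrite sl_comp //.
    by congr (slk f _ _ _ _ _); ring.
  by rewrite mulr0 subr0.
- move=> a b c d h [a' [b' [c' [d' [h' [x1 [x2 [x3 [x4 [e1 e2 e3 e4]]]]] IH]]]]].
  exists a', (- a' * p' + b'), c', (- c' * p' + d'); split.
  + by rewrite -h'; ring.
  + exists x1, (- a * e - x1 * p%:Z * p' + x2), x3, (- c * e - x3 * p' + x4); split=> //.
      have -> : p%:Z * (- a' * p' + b') = - a' * (p%:Z * p') + p%:Z * b' by ring.
      rewrite e2 e1 pe.
      have -> : x1 * p%:Z * p' = x1 * (1 + 144 * e) by rewrite -pe; ring.
      by ring.
    have -> : - c' * p' + d' = - c * (p%:Z * p') - 144 * x3 * p' + d' by rewrite e3; ring.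
    by rewrite pe e4; ring.
  move=> f fi t t0; have t1 : 0 < complex.Im (t - 1) by rewrite Im_sub1.
  have -> : slk (hk f) a (b - a) c (d - c) t = slk (hk f) a b c d (t - 1).
    by rewrite /sl mob_V; congr (_ ^- k * _); rewrite intrB; ring.
  rewrite IH // hecke_V //; last exact: inv144_sl.
  apply: eq_hecke => // z z0; rewrite sl_comp //.
    by congr (slk f _ _ _ _ _); ring.
  by rewrite mulr0 subr0.
move=> a b c d h [a' [b' [c' [d' [h' [x1 [x2 [x3 [x4 [e1 e2 e3 e4]]]]] IH]]]]].
pose r := p' * (1 - 144 * e).
have rE : p%:Z * r = 1 - 144 * (144 * e ^+ 2).
  by rewrite /r mulrA pe; ring.
have rd : (144 : int) * (144 * e ^+ 2) - (- r) * p%:Z = 1.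
  have -> : (144 : int) * (144 * e ^+ 2) - (- r) * p%:Z = 144 * (144 * e ^+ 2) + p%:Z * r by ring.
  by rewrite rE; ring.
exists (a' * 144 + b' * p%:Z), (a' * - r + b' * (144 * e ^+ 2)),
   (c' * 144 + d' * p%:Z), (c' * - r + d' * (144 * e ^+ 2)); split.
+ transitivity ((a' * d' - b' * c') * (144 * (144 * e ^+ 2) - (- r) * p%:Z)); first by ring.
  by rewrite h' rd.
+ exists (a' + x2), (- x1 + a' * 144 * e ^+ 2 + p%:Z * b' * e ^+ 2), (c' + x4 * p%:Z),
    (- (c * (e - e * 144 * e - e)) - x3 * r + d' * e ^+ 2); split.
  - by rewrite [b' * _]mulrC e2; ring.
  - have -> : p%:Z * (a' * - r + b' * (144 * e ^+ 2)) = - a' * (p%:Z * r) + 144 * (p%:Z * b' * e ^+ 2) by ring.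
    by rewrite rE e1; ring.
  - by rewrite e4; ring.
  have -> : c' * - r = - c * (p%:Z * r) - 144 * x3 * r by rewrite e3; ring.
  by rewrite rE; ring.
move=> f fi t t0; have ti := Im_inv t0; have tn := Im_neq0 t0.
have -> : slk (hk f) b (- a) d (- c) t = t ^- k * slk (hk f) a b c d (- t^-1).
  rewrite /sl mob_S // mulrA -invfM -exprMn; congr (_ ^- k * _).
  by rewrite intrN; field.
rewrite IH // hecke_S //; last exact: inv144_sl.
by apply: eq_hecke => // z z0; rewrite sl_comp.
Qed.

Lemma sum_unity_root (x : C) : x ^+ p = 1 -> x != 1 -> \sum_(j < p) x ^+ j = 0.
Proof.
move=> xp x1; have := subrX1 x p; rewrite xp subrr => /esym /eqP.
by rewrite mulf_eq0 subr_eq0 (negPf x1) => /eqP.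
Qed.

(** At the p-th root s of r, still below 1, the terms in question are among those of the convergent
    series of [c]. *)
Lemma sm_multiples (c : nat -> C) r : (forall r, 0 <= r < 1 -> sm c r) -> 0 <= r < 1 ->
  sm (fun n => c (p * n)%N) r.
Proof.
move=> sc /andP[r0 r1].
wlog rp : r r0 r1 / 0 < r.
  move=> H; have [/H|] := ltP 0 r; first exact.
  move=> rle; apply: (@sm_le _ _ r (1 / 2)); last by apply: H; lra.
  by rewrite r0 /=; lra.
pose s := expR (ln r / p%:R).
have sp : s ^+ p = r.
  rewrite -expRM_natl mulrC divfK ?lnK ?posrE // pnatr_eq0 -lt0n //.
have s0 : 0 <= s by apply: expR_ge0.
have s1 : s < 1.
  rewrite ltNge; apply/negP => s1; move: r1; rewrite -sp ltNge => /negP; apply.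
  exact: exprn_ege1.
have [B hB] := sc s (introT andP (conj s0 s1)); exists B => N.
apply: le_trans (hB (p * N)%N).
have -> : \sum_(i < N) nm (c (p * i)%N) * r ^+ i = \sum_(i < p * N) stretch p (fun j => nm (c (p * j)%N)) i * s ^+ i.
  by rewrite sum_stretch //; apply: eq_bigr => i _; rewrite -sp -exprM.
apply: ler_sum => i _; rewrite /stretch; case: ifP => [/dvdnP[j ->]|_].
  by rewrite mulnK // mulnC.
by rewrite mul0r mulr_ge0 ?nm_ge0 ?exprn_ge0.
Qed.

(** Averaging over the p-th roots of unity kills the terms whose index is not divisible by p. *)
Lemma ev_multiples (c : nat -> C) (zt y : C) : (forall r, 0 <= r < 1 -> sm c r) -> nm y < 1 ->
  zt ^+ p = 1 -> (forall n, zt ^+ n = 1 -> (p %| n)%N) ->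
  (\sum_(j < p) ev c (zt ^+ j * y)) / p%:R = ev (fun n => c (p * n)%N) (y ^+ p).
Proof.
move=> sc y1 zp zn.
have nz : nm zt = 1.
  by apply/eqP; rewrite -(pexpr_eq1 p0 (nm_ge0 _)) -nmX zp nm1.
have hj (j : 'I_p) : tends (psum c (zt ^+ j * y)) (ev c (zt ^+ j * y)).
  by apply: evP; apply: sc; rewrite nm_ge0 nmM nmX nz expr1n mul1r.
have h1 := tendsMl (p%:R^-1) (tends_sum (index_enum 'I_p) hj).
have sub : forall N, exists K, forall n, (K <= n)%N -> (N <= p * n)%N.
  by move=> N; exists N => n; nia.
have := tends_sub sub h1; rewrite mulrC => h2; apply/esym/ev_unique; apply: tends_ext h2 => N /=.
have -> : \sum_(j < p) psum c (zt ^+ j * y) (p * N) =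
   \sum_(i < p * N) (stretch p (fun n => c (p * n)%N * p%:R) i) * y ^+ i.
  rewrite /psum exchange_big /=; apply: eq_bigr => i _.
  transitivity (c i * y ^+ i * \sum_(j < p) (zt ^+ i) ^+ j).
    by rewrite mulr_sumr; apply: eq_bigr => j _; rewrite exprMn -!exprM [(j * i)%N]mulnC; ring.
  rewrite /stretch; case: ifP => [pi|pi].
    have -> : zt ^+ i = 1 by case/dvdnP: pi => q ->; rewrite mulnC exprM zp expr1n.
    rewrite [(p * (i %/ p))%N]mulnC divnK // (eq_bigr (fun=> 1)) => [|j _]; last by rewrite expr1n.
    by rewrite sumr_const card_ord; ring.
  rewrite sum_unity_root ?mulr0 ?mul0r //; first by rewrite -exprM mulnC exprM zp expr1n.
  by apply/eqP => /zn; rewrite pi.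
rewrite sum_stretch // mulr_sumr /psum; apply: eq_bigr => i _.
by rewrite -exprM; field; rewrite pnatr_eq0 -lt0n.
Qed.

Lemma hecke_exp (w v : nat) (co cs : nat -> C) f : (w * v)%N = 144%N -> coprime p v ->
  fexp w co f -> fexp w cs (heckeS k p p' e f) ->
  fexp w (fun n => co (p * n)%N + p%:R ^+ k / p%:R * stretch p cs n) (hk f).
Proof.
move=> wv cpv [sc fE] [ss sE].
have w0 : (0 < w)%N by rewrite lt0n; apply/eqP => w0; rewrite w0 in wv.
have pN : p%:R != 0 :> C by rewrite pnatr_eq0 -lt0n.
have wN : w%:R != 0 :> C by rewrite pnatr_eq0 -lt0n.
split=> [r r1 | t t0].
  apply: sm_add; [by case/andP: r1 | exact: sm_multiples |].
  apply/sm_scale/sm_stretch => //; first by case/andP: r1.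
  by case/andP: r1 => r0 r1; apply: ss; rewrite exprn_ge0 //= exprn_ilt1 // -lt0n.
have q1 := nm_ex_divn w0 t0.
have qp : nm (ex (t / w%:R)) ^+ p < 1 by rewrite exprn_ilt1 ?nm_ge0 // -lt0n.
rewrite ev_add; last 2 first.
- by apply: sm_multiples; rewrite ?nm_ge0.
- by apply/sm_scale/sm_stretch; rewrite ?nm_ge0 //; apply: ss; rewrite exprn_ge0 ?nm_ge0.
rewrite ev_scale; last by apply/sm_stretch; rewrite ?nm_ge0 //; apply: ss; rewrite exprn_ge0 ?nm_ge0.
rewrite ev_stretch //; last by apply: ss; rewrite exprn_ge0 ?nm_ge0.
rewrite /hecke mulrDl [RHS]addrC; congr (_ + _).
  rewrite sE ?Im_muln // -[p%:R * t / w%:R]mulrA exMn.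
  by rewrite mulrAC.
pose y := ex (t / (p * w)%:R).
pose zt : C := ex (v%:R / p%:R).
have y1 : nm y < 1 by rewrite nm_ex_divn // muln_gt0 p0.
have yp : y ^+ p = ex (t / w%:R).
  by rewrite -exMn; congr ex; rewrite natrM; field; rewrite pN wN.
rewrite -yp -(@ev_multiples co zt y) //; last 2 first.
- by rewrite -exMn mulrC divfK // -[v%:R]/(v%:Z%:~R) ex_int.
- move=> n; rewrite -exMn => /ex_eq1 [m hm].
  have : (n * v)%:Z%:~R = (m * p%:Z)%:~R :> C.
    rewrite intrM -hm -[(p%:Z)%:~R]/(p%:R) -[LHS]/((n * v)%:R) natrM; field; exact: pN.
  move/intr_inj => hnm.
  have : (p %| n * v)%N by rewrite -(dvdzE p%:Z (n * v)%:Z) hnm dvdz_mull.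
  by rewrite Gauss_dvdl.
rewrite (sum_Fp pp (fun j => f ((t + (144 * j%:Z)%:~R) / p%:R))); congr (_ / _); apply: eq_bigr => j _.
rewrite fE; last by rewrite Im_divn // Im_addz.
congr ev; rewrite /zt /y -exMn -exD; congr ex.
have -> : (144 * (j : nat)%:Z)%:~R = (w%:R * v%:R) * (j : nat)%:R :> C.
  by rewrite -natrM wv intrM.
by rewrite natrM; field; rewrite pN wN.
Qed.

(* Q bounds the exponents of ex(t/144) that occur in the expansions at the cusps *)
Definition good (Q : pred nat) f :=
  (forall a b c d, a * d - b * c = 1 -> (24 %| b)%Z -> (144 %| c)%Z ->
     forall t, 0 < complex.Im t -> slk f a b c d t = (if chi24 d then 1 else -1) * f t) /\
  (forall a b c d, a * d - b * c = 1 ->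
     exists2 co, fexp 144 co (slk f a b c d) & forall n, co n != 0 -> Q n).

Lemma good_inv Q f : good Q f -> inv144 k f.
Proof.
move=> [fi _] a b c d h _ hb hc /dvdzP[x hd] t t0; rewrite fi //.
  have -> : chi24 d = true; last by rewrite mul1r.
  have -> : d = (x * 6) * 24 + 1 by rewrite -mulrA -[6 * 24]/(144 : int) -hd subrK.
  by rewrite /chi24 modzMDl.
by apply: dvdz_trans hb.
Qed.

Lemma hecke_coprime (v : nat) : (v %| 144)%N -> coprime p v.
Proof.
move=> v144; rewrite prime_coprime //; apply/negP => /dvdn_trans /(_ v144) h.
have : (p%:Z %| (1 : int))%Z.
  have -> : 1 = p%:Z * p' - 144 * e by rewrite pe; ring.
  by rewrite rpredB // ?dvdz_mulr.
by rewrite dvdz1 => /eqP p1; move: pp; rewrite -[p]/(`|p%:Z|%N) p1.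
Qed.

Let sdet : (p' * (1 - 144 * e)) * p%:Z - (- (144 * e ^+ 2)) * 144 = 1.
Proof.
have -> : (p' * (1 - 144 * e)) * p%:Z - (- (144 * e ^+ 2)) * 144 =
   (p%:Z * p') * (1 - 144 * e) + (144 * e) ^+ 2 by ring.
by rewrite pe; ring.
Qed.

(** The matrix sigma satisfies the divisibility conditions of [good], and its lower right entry is
    p. *)
Lemma heckeS_good Q f t : good Q f -> 0 < complex.Im t ->
  heckeS k p p' e f t = (if chi24 p%:Z then 1 else -1) * f t.
Proof.
move=> [fi _] t0; apply: fi => //.
by apply/dvdzP; exists (- (6 * e ^+ 2)); ring.
Qed.

(** The two hypotheses on the exponents match the two terms of the coefficient formula: U_p divides
    an exponent by p, the other term multiplies it by p. *)
Lemma hecke_good (Q Q' : pred nat) f : good Q f ->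
  (forall n, Q (p * n)%N -> Q' n) -> (forall n, Q n -> Q' (p * n)%N) -> good Q' (hk f).
Proof.
move=> gf h1 h2; have fi := good_inv gf; case: (gf) => fc fx; split=> a b c d h.
  move=> hb hc t t0.
  have [a' [b' [c' [d' [h' [x1 [x2 [x3 [x4 [e1 e2 e3 e4]]]]] H]]]]] := hecke_mob h.
  rewrite H // -heckeZ; apply: eq_hecke => // z z0; rewrite fc //.
  - suff -> : chi24 d' = chi24 d by []; rewrite /chi24 e4.
    have -> : d + 144 * x4 = (6 * x4) * 24 + d by ring.
    by rewrite modzMDl.
  - have : (24 %| p%:Z * b')%Z.
      by rewrite e2 rpredD // -[144]/((24 * 6)%R : int) -mulrA dvdz_mulr.
    by rewrite Gauss_dvdzr // coprimezE /= coprime_sym hecke_coprime.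
  by rewrite e3 rpredD //; [apply: dvdz_mull | apply: dvdz_mulr].
have [a' [b' [c' [d' [h' _ H]]]]] := hecke_mob h.
have [co cE cQ] := fx _ _ _ _ h'.
(* The matrix is (a', b'; c', d') times sigma: its slash is what the second Hecke term evaluates at
   p t. *)
have := fx _ _ _ _ (_ : (a' * (p' * (1 - 144 * e)) + b' * 144) * (c' * (- (144 * e ^+ 2)) + d' * p%:Z) - (a' * (- (144 * e ^+ 2)) + b' * p%:Z) * (c' * (p' * (1 - 144 * e)) + d' * 144) = 1).
case.
  transitivity ((a' * d' - b' * c') * ((p' * (1 - 144 * e)) * p%:Z - (- (144 * e ^+ 2)) * 144)); first by ring.
  by rewrite h' sdet.
move=> cs sE sQ.
have sE' : fexp 144 cs (heckeS k p p' e (slk f a' b' c' d')).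
  by apply: fexp_eq sE => t t0; rewrite /heckeS sl_comp.
exists (fun n => co (p * n)%N + p%:R ^+ k / p%:R * stretch p cs n).
  apply: fexp_eq (hecke_exp (v := 1) _ _ cE sE') => // [t t0|]; first by rewrite H.
  by rewrite coprimen1.
move=> n; have [co0|/cQ /h1 -> //] := eqVneq (co (p * n)%N) 0.
rewrite co0 add0r /stretch; case: ifP => [/dvdnP[m ->]|_]; last by rewrite mulr0 eqxx.
rewrite mulnK // mulnC; have [->|/sQ /h2 -> //] := eqVneq (cs m) 0.
by rewrite mulr0 eqxx.
Qed.

Lemma hecke_exp24 Q f co : good Q f -> fexp 24 co f -> fexp 24 (fun n => co (p * n)%N +
   p%:R ^+ k / p%:R * ((if chi24 p%:Z then 1 else -1) * stretch p co n)) (hk f).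
Proof.
move=> gf cE; have sE : fexp 24 (fun n => (if chi24 p%:Z then 1 else -1) * co n) (heckeS k p p' e f).
  by apply: fexp_eq (fexpZ _ _ cE) => // t t0; rewrite (heckeS_good gf).
have := @hecke_exp 24 6 _ _ _ erefl (hecke_coprime (isT : (6 %| 144)%N)) cE sE.
congr fexp; apply/funext => n; congr (_ + _ * _); rewrite /stretch; case: ifP => // _.
by rewrite mulr0.
Qed.

End HeckeAction.

(** * Integral expansions at infinity *)

Section IntegralExpansions.

Definition zser (K : pzRingType) (a : nat -> int) n : K := (a n)%:~R.

Lemma zser_conv (K : comNzRingType) a b : zser K (conv a b) = conv (zser K a) (zser K b).
Proof.
apply/funext => n; rewrite /zser /conv rmorph_sum /=; apply: eq_bigr => i _.
by rewrite rmorphM.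
Qed.

Lemma zser_stretch (K : comNzRingType) k a : zser K (stretch k a) = stretch k (zser K a).
Proof. by apply/funext => n; rewrite /zser /stretch; case: ifP. Qed.

Lemma zser_shift (K : comNzRingType) s a : zser K (shift_seq s a) = shift_seq s (zser K a).
Proof. by apply/funext => n; rewrite /zser /shift_seq; case: ifP. Qed.

Lemma zser_cpow (K : comNzRingType) a k : zser K (cpow a k) = cpow (zser K a) k.
Proof.
elim: k => [|k IH] /=; last by rewrite zser_conv IH.
by apply/funext => n; rewrite /zser /delta; case: eqP.
Qed.

Variable R : realType.
Local Notation C := R[i].
Implicit Types (t z : C) (f g : C -> C) (c : nat -> C).

Lemma Im_natM (n : nat) t : (0 < n)%N -> 0 < complex.Im t -> 0 < complex.Im (n%:R * t).
Proof.
move=> n0; case: t => x y /= y0; rewrite -(rmorph_nat (real_complex R)) /= mul0r addr0 mulr_gt0 ?ltr0n //.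
Qed.

Lemma fexp_muln w k c f : (0 < w)%N -> (0 < k)%N -> fexp w c f ->
  fexp w (stretch k c) (fun t => f (k%:R * t)).
Proof.
move=> w0 k0 [sc fE]; split=> [r /andP[r0 r1] | t t0].
  by apply: sm_stretch => //; apply: sc; rewrite exprn_ge0 //= exprn_ilt1 // -lt0n.
rewrite fE ?Im_natM // ev_stretch // ?exMn //; first by rewrite -exMn mulrA.
by apply: sc; rewrite exprn_ge0 ?nm_ge0 //= exprn_ilt1 ?nm_ge0 ?nm_ex_divn // -lt0n.
Qed.

(** The partial sums are at most the truncated product at r, hence at most the inverse of the
    product of the first N factors 1 - r^(i+1); these decrease to a nonzero limit. *)
Lemma sm_part (r : R) : 0 <= r < 1 -> sm (zser C part) r.
Proof.
move=> /andP[r0 r1].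
have q1 : nm (r%:C) < 1 by rewrite nmR ger0_norm.
pose P N := \prod_(i < N) (1 - r ^+ i.+1).
have f01 i : 0 < 1 - r ^+ i.+1 <= 1.
  by rewrite subr_gt0 exprn_ilt1 //= gerBl exprn_ge0.
have Pp N : 0 < P N by apply: prodr_gt0 => i _; case/andP: (f01 i).
have PC N : \prod_(n < N) (1 - r%:C ^+ n * r%:C) = (P N)%:C.
  by rewrite rmorph_prod; apply: eq_bigr => i _; rewrite -exprSr rmorphB rmorph1 rmorphXn.
have L0 := G_neq0 q1 q1.
have LP N : nm (G r%:C r%:C) <= P N.
  apply: (tends_le_nm _ (tends_shift N (tends_G r%:C q1))) => n.
  rewrite PC nmR ger0_norm ?(ltW (Pp _)) //; elim: n => [|n IH]; first by rewrite add0n.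
  rewrite addSn /P big_ord_recr /= (le_trans _ IH) // ler_piMr ?(ltW (Pp _)) //.
  by case/andP: (f01 (n + N)%N).
exists (nm (G r%:C r%:C))^-1 => N.
apply: (@le_trans _ _ (P N)^-1); last by rewrite lef_pV2 ?posrE ?nm_gt0.
pose p : {poly R} := map_poly intr (partp N).
have pge k : 0 <= p`_k.
  rewrite coef_map /= ler0z; rewrite /partp; elim/big_ind: _ k => [k|u v hu hv k|i _ k].
  - by rewrite coef1 ler0n.
  - by rewrite coefM sumr_ge0 // => j _; rewrite mulr_ge0.
  by rewrite coef_sum sumr_ge0 // => j _; rewrite coefXn ler0n.
apply: (@le_trans _ _ p.[r]).
  rewrite (@horner_coef_wide _ (N + size p)); last exact: leq_addl.
  rewrite big_split_ord /= -[X in X <= _]addr0 lerD //; last first.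
    by apply: sumr_ge0 => i _; rewrite mulr_ge0 ?exprn_ge0.
  apply: ler_sum => i _; rewrite ler_wpM2r ?exprn_ge0 //.
  rewrite coef_map /= (rep_partp (leqnn N)) 1?ltnW // /zser -(rmorph_int (real_complex R)) nmR.
  by rewrite ger0_norm // ler0z part_ge0.
have -> : p.[r] = \prod_(i < N) \sum_(j < N.+1) r ^+ (i.+1 * j).
  rewrite /p /partp rmorph_prod horner_prod; apply: eq_bigr => i _.
  rewrite rmorph_sum horner_sum; apply: eq_bigr => j _.
  by rewrite /= map_polyXn hornerXn.
rewrite /P -prodfV; apply: ler_prod => i _; apply/andP; split.
  by apply: sumr_ge0 => j _; apply: exprn_ge0.
have /andP[y1 _] := f01 i.
rewrite -[leRHS]mul1r ler_pdivlMr //.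
have := subrX1 (r ^+ i.+1) N.+1; rewrite -opprB => h.
have -> : (\sum_(j < N.+1) r ^+ (i.+1 * j)) * (1 - r ^+ i.+1) = 1 - (r ^+ i.+1) ^+ N.+1.
  apply: oppr_inj; rewrite h -mulrN opprB mulrC.
  by congr (_ * _); apply: eq_bigr => j _; rewrite exprM.
by rewrite gerBl !exprn_ge0.
Qed.

Lemma fexp_part : fexp 1 (zser C part) (fun t => (eulG t)^-1).
Proof.
split=> [r|t t0]; first exact: sm_part.
have q1 : nm (ex (t / 1%:R)) < 1 by apply: nm_ex_divn.
have [se eE] := fexp_eulG R.
apply: (mulfI (eulG_neq0 t0)); rewrite mulfV ?eulG_neq0 // [in RHS]eE //.
rewrite -ev_conv; [|by apply: se; rewrite nm_ge0|by apply: sm_part; rewrite nm_ge0].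
have -> : conv (fun n => (eul n)%:~R : C) (zser C part) = @delta C.
  rewrite -[fun n => _]/(zser C eul) -zser_conv; apply/funext => n.
  by rewrite /zser convC conv_part_eul /delta; case: eqP.
by have [_ d1] := fexp1 R (isT : (0 < 1)%N); rewrite -(d1 t t0).
Qed.

(* the coefficients of eta(6t)/eta(t) * eta(t)^(4M) in powers of ex(t/24) *)
Definition c24 M : nat -> int := shift_seq (5 + 4 * M)
  (stretch 24 (conv (conv (stretch 6 eul) part) (cpow eul (4 * M)))).

Lemma F0_exp24 M : fexp 24 (zser C (c24 M)) (@F0 R M).
Proof.
have i1 : (0 < 1)%N by []. have i24 : (0 < 24)%N by [].
have e0 : fexp 1 (zser C eul) (@eulG R) := fexp_eulG R.
have := fexpM i1 (fexpM i1 (fexp_muln i1 (isT : (0 < 6)%N) e0) fexp_part) (fexpX (4 * M) i1 e0).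
rewrite -zser_stretch -zser_cpow -!zser_conv => /(fexp_stretch i1 i24).
rewrite mul1n -zser_stretch => /(fexp_shift (5 + 4 * M) i24); rewrite -zser_shift.
apply: fexp_eq => t t0; rewrite /F0 /hq /W /eulG exMn -/(eulG t).
have -> : (5 + 4 * M)%:R * t / 24%:R = 5%:R * t / 24 + M%:R * (t / 6).
  by rewrite natrD natrM; field.
rewrite exD [ex (M%:R * _)]exMn exprMn -exprM.
by move: (ex _) (ex _ ^+ M) (G _ _) (eulG t)^-1 (eulG t ^+ _) => A B D E F; ring.
Qed.

Definition supp0 M (n : nat) : bool := (24 * M <= n + 5)%N && (n != 24 * M)%N.

Lemma F0_good M : (0 < M)%N -> good (2 * M) (supp0 M) (@F0 R M).
Proof.
move=> M0; split=> a b c d h; last exact: F0_slash.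
move=> hb hc t t0; have hc24 : (24 %| c)%Z by apply: dvdz_trans hc.
rewrite /sl /F0 (hq_mob_G h) // (W_mob1 h) // exprMn -exprM.
have := expf_neq0 (2 * M) (aut_neq0 h t0).
move: ((c%:~R * t + d%:~R) ^+ _) (if _ then _ else _) (hq t) (W t ^+ M) => A B D E A0.
by field; rewrite A0.
Qed.

End IntegralExpansions.

(** * The cusp form: transformation law and vanishing at the cusps *)

Section CuspForm.
Variable R : realType.
Local Notation C := R[i].
Implicit Types (t z : C) (f g : C -> C) (co : nat -> C).

Lemma fexp_has_qexpansion (h : nat) co f : (0 < h)%N -> fexp h co f -> has_qexpansion h f co.
Proof.
move=> h0 [sc fE] z z0; apply/tendsP; rewrite fE //.
apply: tends_ext (evP _) => [n|]; last by apply: sc; rewrite nm_ge0 nm_ex_divn.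
by rewrite /series /psum /= big_mkord; apply: eq_bigr => i _; rewrite nomeE.
Qed.

Lemma fexp_scale w co f : (0 < w)%N -> fexp w co f -> fexp 1 co (fun z => f (w%:R * z)).
Proof.
move=> w0 [sc fE]; split=> // t t0; rewrite fE ?Im_natM // divr1 mulrC mulKf //.
by rewrite pnatr_eq0 -lt0n.
Qed.

Lemma fexp_unshift w s co f : (0 < w)%N -> (forall i, (i < s)%N -> co i = 0) -> fexp w co f ->
  fexp w (fun n => co (n + s)%N) (fun t => f t / ex (s%:R * t / w%:R)).
Proof.
move=> w0 c0 [sc fE].
have sm1 r : 0 <= r < 1 -> sm (fun n => co (n + s)%N) r.
  move=> /andP[r0 r1]; have [rp|rle] := ltP 0 r; first by apply: sm_shift => //; apply: sc; rewrite r0.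
  apply: (@sm_le _ _ r (1 / 2)); last by apply: sm_shift; [lra | apply: sc; lra].
  by rewrite r0 /=; lra.
split=> // t t0; have q1 : 0 <= nm (ex (t / w%:R)) < 1 by rewrite nm_ge0 nm_ex_divn.
rewrite fE // (ev_shift (sc _ q1) (sm1 _ q1)).
rewrite /psum big1 ?add0r => [|i _]; last by rewrite c0 ?mul0r.
by rewrite -[s%:R * t / _]mulrA exMn mulrAC mulfV ?mul1r // expf_neq0 ?ex_neq0.
Qed.

Lemma conv_eq0 (K : comNzRingType) (a b : nat -> K) s n :
  (forall i, (i < s)%N -> a i = 0) -> (n < s)%N -> conv a b n = 0.
Proof.
move=> a0 ns; rewrite /conv big1 // => i _; rewrite a0 ?mul0r //.
by apply: leq_ltn_trans ns; rewrite -ltnS.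
Qed.

(** [W] has order exactly 24 in q^(1/144), and its inverse is ex(-t/6) times the fourth power of the
    partition series; exponents above 24 thus become positive. *)
Lemma fexp_divW co g : fexp 144 co g -> (forall n, co n != 0 -> (24 < n)%N) ->
  exists2 b, b 0%N = 0 & fexp 144 b (fun t => g t / W t).
Proof.
move=> cE cS; have c0 i : (i < 25)%N -> co i = 0.
  by move=> i25; apply/eqP/negPn/negP => /cS; lia.
have i1 : (0 < 1)%N by []. have i144 : (0 < 144)%N by [].
have h := fexpM i144 cE (fexp_stretch i1 i144 (fexpX 4 i1 (fexp_part R))).
have := fexp_unshift i144 _ h; move=> /(_ 24%N) H.
exists (fun n => conv co (stretch 144 (cpow (zser C part) 4)) (n + 24)%N).
  by rewrite add0n (conv_eq0 _ c0).
apply: fexp_eq (H _) => [t t0 | i i24].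
  rewrite /W invfM exprVn mulrAC -mulrA; congr (g t * (_ / _)); congr (ex _)^-1.
  by field.
by apply: (conv_eq0 _ c0); lia.
Qed.

Lemma det2 (A : 'M[int]_2) : SL2Z A -> A 0 0 * A 1 1 - A 0 1 * A 1 0 = 1.
Proof.
rewrite /SL2Z /= (expand_det_row _ 0) !big_ord_recl big_ord0 /cofactor !det_mx11 !mxE /=.
have -> : lift 0 0 = 1 :> 'I_2 by apply/val_inj.
have -> : lift 1 0 = 0 :> 'I_2 by apply/val_inj.
by rewrite expr0 expr1 mul1r mulN1r mulrN addr0.
Qed.

Variables (M : nat) (c' : nat -> int) (F : C -> C).
Hypotheses (M0 : (0 < M)%N) (Fgood : good (2 * M) (fun n => 24 < n)%N F)
  (Fexp : fexp 24 (zser C c') F) (c'0 : forall i, (i < 4)%N -> c' i = 0).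

(** Division by eta(24 z)^4, which is q^4 times the fourth power of the Euler product in q^24. *)
Definition quot_coef n : int := conv c' (stretch 24 (cpow part 4)) (n + 4)%N.

(** Given by its q-series, which makes holomorphy a property of power series; [quot_formE] recovers
    the quotient. *)
Definition quot_form z : C := ev (zser C quot_coef) (ex z).

Let quot_fexp : fexp 1 (zser C quot_coef) (fun z => F (24%:R * z) / W (24%:R * z)).
Proof.
have i1 : (0 < 1)%N by []. have i24 : (0 < 24)%N by [].
have := fexpM i1 (fexp_scale i24 Fexp) (fexp_muln i1 i24 (fexpX 4 i1 (fexp_part R))).
rewrite -zser_cpow -zser_stretch -zser_conv => h.
have := @fexp_unshift _ 4 _ _ i1 _ h.
case=> [i i4|sc fE]; first by rewrite /zser (conv_eq0 _ c'0).
split=> [r r1|t t0]; first exact: sc.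
rewrite -[zser C quot_coef]/(fun n => zser C (conv c' (stretch 24 (cpow part 4))) (n + 4)%N) -fE //.
rewrite /W; have -> : ex (24%:R * t / 6) = ex (4%:R * t / 1%:R) by congr ex; field.
by rewrite invfM exprVn mulrA mulrAC.
Qed.

Lemma quot_formE z : 0 < complex.Im z -> quot_form z = F (24%:R * z) / W (24%:R * z).
Proof. by move=> z0; have [_ ->] := quot_fexp; rewrite ?divr1. Qed.

Lemma quot_holomorphic : holomorphic_on_H quot_form.
Proof.
move=> z z0; apply: taylor1_derivable; apply: (@taylor1_comp _ (ev (zser C quot_coef)) (@ex R)).
  exact: taylor1_ex.
have q1 : nm (ex z) < 1 by rewrite nm_ex_lt1.
have q0 := nm_ge0 (ex z).
apply: (@taylor1_ev _ _ _ ((1 + nm (ex z)) / 2)); first by lra.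
by have [sc _] := quot_fexp; apply: sc; lra.
Qed.

Lemma quot_qexpansion : has_qexpansion 1 quot_form (fun n => (quot_coef n)%:~R).
Proof.
apply: fexp_has_qexpansion => //; apply: fexp_eq quot_fexp => t t0.
by rewrite quot_formE.
Qed.

Lemma mobiusE (A : 'M[int]_2) z : mobius A z = mob (A 0 0) (A 0 1) (A 1 0) (A 1 1) z.
Proof. by []. Qed.

(** With c = 3456 x, the point 24 z is moved by (a, 24 b; 144 x, d), to which the laws of [F] and
    [W] apply. *)
Lemma quot_slash (A : 'M[int]_2) z : Gamma0 3456 A -> 0 < complex.Im z ->
  slash (2 * M - 2) quot_form A z = (if chi24 (A 1 1) then 1 else -1) * quot_form z.
Proof.
move=> [/det2 + hc]; rewrite /slash mobiusE /automorphy.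
move: (A 0 0) (A 0 1) (A 1 0) (A 1 1) hc => a b c d /dvdzP[x cE] h z0.
have mz := Im_mob h z0; have w0 := aut_neq0 h z0.
rewrite !quot_formE //.
have t0 : 0 < complex.Im (24%:R * z) by apply: Im_natM.
have h' : a * d - (24 * b) * (144 * x) = 1 by rewrite -[RHS]h cE; ring.
have j' : (144 * x)%:~R * (24%:R * z) + d%:~R = c%:~R * z + d%:~R :> C.
  by rewrite cE !intrM -[144%:~R]/(144%:R) -[3456%:~R]/(3456%:R); ring.
have -> : 24%:R * mob a b c d z = mob a (24 * b) (144 * x) d (24%:R * z).
  rewrite /mob j' mulrA; congr (_ / _); rewrite intrM -[24%:~R]/(24%:R); ring.
have [fi _] := Fgood.
have hb : (24 %| 24 * b)%Z by apply: dvdz_mulr.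
have hc1 : (144 %| 144 * x)%Z by apply: dvdz_mulr.
have hc2 : (24 %| 144 * x)%Z by apply: dvdz_trans hc1.
have := fi _ _ _ _ h' hb hc1 _ t0; rewrite /sl j' (W_mob1 h' hb hc2 t0) j'.
move: (F (mob _ _ _ _ _)) => Fm e.
have -> : Fm = (c%:~R * z + d%:~R) ^+ (2 * M) * ((if chi24 d then 1 else -1) * F (24%:R * z)).
  by rewrite -e mulVKf // expf_neq0.
have -> : (2 * M = (2 * M - 2) + 2)%N by lia.
rewrite addnK exprD; move: (W_neq0 t0) (expf_neq0 (2 * M - 2) w0) (expf_neq0 2 w0).
move: (W _) (_ ^+ (2 * M - 2)) (_ ^+ 2) (F _) (if _ then _ else _) => X A1 A2 Y K X0 A10 A20.
by field; rewrite X0 A10 A20.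
Qed.

(** The matrix diag(24, 1) A factors as gamma (al, be; 0, de) with gamma in SL_2(Z) and al de = 24,
    so the slash is, up to a constant, that of F / W by gamma at w = (al z + be) / de. A series in
    ex(w/144) is one in ex(z/(144 de)) with exponents multiplied by al. *)
Lemma quot_cusp (A : 'M[int]_2) : SL2Z A -> exists h : nat, exists a : nat -> C,
  [/\ (0 < h)%N, a 0%N = 0 & has_qexpansion h (slash (2 * M - 2) quot_form A) a].
Proof.
move/det2; rewrite /slash; set sf := fun z => _.
have sfE z : sf z = (fun a b c d : int => (c%:~R * z + d%:~R) ^- (2 * M - 2) * quot_form (mob a b c d z)) (A 0 0) (A 0 1) (A 1 0) (A 1 1) by [].
move: (A 0 0) (A 0 1) (A 1 0) (A 1 1) sfE => a b c d sfE h; rewrite /= in sfE.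
have [u [v uv]] := Bezoutz (24 * a) c.
set g := gcdz (24 * a) c in uv.
have /dvdzP[A1 aE] : (g %| 24 * a)%Z by apply: dvdz_gcdl.
have /dvdzP[C1 cE] : (g %| c)%Z by apply: dvdz_gcdr.
pose dl := A1 * d - 24 * b * C1.
have gdl : g * dl = 24.
  have -> : g * dl = (A1 * g) * d - 24 * b * (C1 * g) by rewrite /dl; ring.
  by rewrite -aE -cE -[RHS]mulr1 -h; ring.
have g0 : 0 <= g by rewrite /g /gcdz.
have [al alE] : exists al : nat, g = al%:Z by exists `|g|%N; rewrite gez0_abs.
have al0 : (0 < al)%N by rewrite lt0n; apply/eqP => al0; rewrite alE al0 mul0r in gdl.
have [de deE] : exists de : nat, dl = de%:Z.
  exists `|dl|%N; rewrite gez0_abs //; rewrite -(@pmulr_rge0 _ g) ?gdl // alE ltz_nat //.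
have de0 : (0 < de)%N by rewrite lt0n; apply/eqP => de0; rewrite deE de0 mulr0 in gdl.
have uv1 : u * A1 + v * C1 = 1.
  have gN : g != 0 by rewrite alE; apply: contraTneq al0 => -[->].
  by apply: (mulIf gN); rewrite mulrDl -!mulrA -aE -cE uv mul1r.
have hg : A1 * u - (- v) * C1 = 1 by rewrite -[RHS]uv1; ring.
(* Here gamma is (A1, -v; C1, u), and [be] and [dl] form the second column of its inverse times (24
   a, 24 b; c, d). *)
pose be := u * (24 * b) + v * d.
have [co cfE cS] := Fgood.2 _ _ _ _ hg.
have [b0 b00 bE] := fexp_divW cfE cS.
set E := ex ((etaX A1 (- v) C1 u)%:~R / 6%:R) : C.
pose L := (de%:R ^- (2 * M - 2)) * E^-1.
pose ka : C := ex (be%:~R / (144 * de)%:R).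
have ka1 : nm ka = 1 by apply: nm_ex_rat.
exists (144 * de)%N, (stretch al (fun n => L * (b0 n * ka ^+ n))); split.
- by rewrite muln_gt0.
- by rewrite /stretch dvdn0 div0n b00 mul0r mulr0.
have deN : de%:R != 0 :> C by rewrite pnatr_eq0 -lt0n.
have h0 : (0 < 144 * de)%N by rewrite muln_gt0.
have [sb fb] := bE.
have sk r : 0 <= r < 1 -> sm (fun n => b0 n * ka ^+ n) r.
  move=> r1; apply: (@sm_dom _ b0); [by case/andP: r1 | | exact: sb].
  by move=> n; rewrite nmM nmX ka1 expr1n mulr1.
apply: fexp_has_qexpansion => //; split=> [r r1|z z0].
  case/andP: r1 => r0 r1; apply: sm_stretch => //; apply/sm_scale/sk.
  by rewrite exprn_ge0 //= exprn_ilt1 // -lt0n.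
pose w := (al%:R * z + be%:~R) / de%:R.
have w0 : 0 < complex.Im w by rewrite Im_divn // Im_addz Im_natM.
have gC : al%:R = g%:~R :> C by rewrite alE.
have dC : de%:R = dl%:~R :> C by rewrite deE.
have j1 : C1%:~R * w + u%:~R = (c%:~R * z + d%:~R) / de%:R.
  have cC : c%:~R = C1%:~R * g%:~R :> C by rewrite cE intrM.
  have dC' : d%:~R = C1%:~R * be%:~R + u%:~R * dl%:~R :> C.
    rewrite -!intrM -intrD; congr (_%:~R).
    by rewrite /be /dl -[LHS]mulr1 -uv1; ring.
  by apply: (mulIf deN); rewrite divfK // /w mulrDl -mulrA divfK // gC dC cC dC'; ring.
have j2 : A1%:~R * w - v%:~R = 24%:R * (a%:~R * z + b%:~R) / de%:R.
  have aC : 24%:R * a%:~R = A1%:~R * g%:~R :> C by rewrite -[24%:R]/(24%:~R) -!intrM aE.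
  have bC : 24%:R * b%:~R = A1%:~R * be%:~R - v%:~R * dl%:~R :> C.
    rewrite -[24%:R]/(24%:~R) -!intrM -intrB; congr (_%:~R).
    by rewrite /be /dl -[LHS]mulr1 -uv1; ring.
  apply: (mulIf deN); rewrite divfK // /w mulrBl -mulrA divfK // gC dC.
  by rewrite [in RHS]mulrDr [24%:R * (a%:~R * z)]mulrA aC bC; ring.
have jn := aut_neq0 h z0.
have mE : 24%:R * mob a b c d z = mob A1 (- v) C1 u w.
  by rewrite /mob intrN j2 j1; field; rewrite jn deN.
rewrite sfE quot_formE ?Im_mob // mE W_mob // -/E.
have -> : F (mob A1 (- v) C1 u w) = (C1%:~R * w + u%:~R) ^+ (2 * M) * sl (2 * M) F A1 (- v) C1 u w.
  by rewrite /sl mulVKf // expf_neq0 // (aut_neq0 hg w0).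
rewrite ev_stretch //; last first.
  apply/sm_scale/sk; rewrite exprn_ge0 ?nm_ge0 //= exprn_ilt1 ?nm_ge0 ?nm_ex_divn // -lt0n.
  exact: al0.
have xE : ex (w / 144%:R) = ka * ex (z / (144 * de)%:R) ^+ al.
  by rewrite /ka -exMn -exD; congr ex; rewrite /w natrM; field.
rewrite ev_scale; last first.
  apply: sk; rewrite nm_ge0 /= nmX exprn_ilt1 ?nm_ge0 ?nm_ex_divn // -lt0n.
  exact: al0.
have -> : ev (fun n => b0 n * ka ^+ n) (ex (z / (144 * de)%:R) ^+ al) = ev b0 (ex (w / 144%:R)).
  rewrite xE; apply: ev_unique; apply: tends_ext (evP _) => [n|].
    by apply: eq_bigr => i _; rewrite exprMn mulrA.
  apply: sb; rewrite nm_ge0 /= nmM ka1 mul1r nmX exprn_ilt1 ?nm_ge0 ?nm_ex_divn // -lt0n.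
  exact: al0.
rewrite -fb // j1 /L {L}.
have -> : (2 * M = (2 * M - 2) + 2)%N by lia.
rewrite addnK !exprMn !exprVn !(exprD _ (2 * M - 2) 2); move: (W_neq0 w0) (ex_neq0 ((etaX A1 (- v) C1 u)%:~R / 6%:R : C)) (expf_neq0 (2 * M - 2) jn) (expf_neq0 (2 * M - 2) deN).
rewrite -/E; clearbody E; move: (sl _ _ _ _ _ _ _) (W w) => S X.
move: ((c%:~R * z + d%:~R) ^+ (2 * M - 2)) (de%:R ^+ (2 * M - 2)) => P Q X0 E0 P0 Q0.
by field; rewrite X0 E0 P0 Q0 jn deN.
Qed.

End CuspForm.

(** * The Kronecker symbol (6/d) *)

Section Kronecker.

Lemma chi24_nat (n : nat) : chi24 n%:Z = ((n %% 24)%N \in [:: 1; 5; 19; 23]%N).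
Proof. by rewrite /chi24 modz_nat !inE. Qed.

Lemma chi24N (d : int) : chi24 (- d) = chi24 d.
Proof.
have -> : chi24 (- d) = chi24 (- (d %% 24)%Z) by rewrite /chi24 modzNm.
rewrite {2}/chi24; have := @modz_ge0 d 24 isT; have := @ltz_pmod d 24 isT.
case: (d %% 24)%Z => // n; rewrite ltz_nat => + _.
by do 24![case: n => [//|n]].
Qed.

Let chi24M_tab : all (fun k => all (fun l => coprime k 24 ==> coprime l 24 ==>
  ((k * l %% 24 \in [:: 1; 5; 19; 23]) == ((k \in [:: 1; 5; 19; 23]) == (l \in [:: 1; 5; 19; 23])))%N)
    (iota 0 24)) (iota 0 24).
Proof. by vm_compute. Qed.

Lemma chi24M (m n : nat) : coprime m 24 -> coprime n 24 ->
  chi24 (m * n)%N%:Z = (chi24 m%:Z == chi24 n%:Z).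
Proof.
move=> cm cn; rewrite !chi24_nat.
have im x : (x %% 24)%N \in iota 0 24 by rewrite mem_iota ltn_mod.
have /allP /(_ _ (im n)) := allP chi24M_tab _ (im m).
by rewrite !coprime_modl cm cn /= modnMml modnMmr => /eqP.
Qed.

(* sqrt 6 = x + x^5 - x^7 - x^11 for a primitive 24th root of unity x *)
Lemma legendre6 (p : nat) : prime p -> (3 < p)%N -> legendre 6 p = if chi24 p%:Z then 1 else -1.
Proof.
move=> pp p3.
have [K [f _]] := countable_algebraic_closure 'F_p.
(* A root of the 24th cyclotomic polynomial X^8 - X^4 + 1 in an algebraic closure. *)
have [x x8] := @solve_monicpoly K 8 (fun i => if i == 4 then 1 else if i == 0%N then -1 else 0) isT.
have {}x8 : x ^+ 8 = x ^+ 4 - 1.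
  by rewrite x8 !big_ord_recl big_ord0 /=; ring.
have x12 : x ^+ 12 = -1 by rewrite -[12%N]/(4 + 8)%N exprD x8; ring: x8.
pose sg (y : K) := y + y ^+ 5 - y ^+ 7 - y ^+ 11.
pose s := sg x.
have s2 : s ^+ 2 = 6%:R.
  by rewrite /s /sg; ring: x8.
have pK : p \in [pchar K] by rewrite (fmorph_pchar f) pchar_Fp.
have pn : [pchar K].-nat p by rewrite pnatE.
have po : odd p by case/even_prime: (pp) => // p2; rewrite p2 in p3.
have pd (q : nat) : prime q -> (q <= 3)%N -> (p %| q)%N = false.
  by move=> qp q3; rewrite dvdn_prime2 //; apply/negbTE; lia.
have p24 : coprime p 24.
  rewrite prime_coprime // (_ : 24 = 2 ^ 3 * 3)%N // Euclid_dvdM // Euclid_dvdX //.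
  by rewrite !pd.
have p6 : (p %| 6)%N = false by rewrite (_ : 6 = 2 * 3)%N // Euclid_dvdM // !pd.
have sp : s ^+ p = sg (x ^+ p).
  rewrite /s /sg.
  have NX (y z : K) : (y - z) ^+ p = y ^+ p - z ^+ p.
    by rewrite exprDn_pchar // exprNn -signr_odd po expr1 mulN1r.
  by rewrite !NX exprDn_pchar // -!exprM ![(_ * p)%N]mulnC.
have x24 : x ^+ 24 = 1 by rewrite -[24%N]/(12 * 2)%N exprM x12 sqrrN expr1n.
(* Frobenius replaces x by x^p, and so acts on the square root [s] of 6 through p modulo 24. *)
have sE : s ^+ p = if chi24 p%:Z then s else - s.
  rewrite sp -(expr_mod p x24) chi24_nat.
  have : coprime (p %% 24) 24 by rewrite coprime_modl.
  have : (p %% 24 < 24)%N by rewrite ltn_mod.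
  move: (p %% 24)%N => r; rewrite /s /sg.
  by do 24![case: r => [|r]; first by [|move=> _ _ /=; ring: x12]].
have six (a : 'F_p) : s = f a -> a ^+ 2 = 6%:R.
  by move=> sa; apply: (fmorph_inj f); rewrite rmorphXn rmorph_nat /= -sa.
rewrite /legendre dvdzE /= p6.
have dvdF (y : 'I_p) : ((y%:Z ^+ 2)%R == 6 %[mod p])%Z = ((y : nat)%:R ^+ 2 == 6%:R :> 'F_p).
  rewrite eqz_mod_dvd; apply/idP/eqP.
    move=> /dvdzP[q hq]; apply/eqP; rewrite -subr_eq0; apply/eqP.
    have := congr1 (fun n : int => n%:~R : 'F_p) hq.
    rewrite rmorphB rmorphXn rmorphM /= => ->.
    by rewrite -[(p : int)%:~R]/(p%:R) pchar_Fp_0 // mulr0.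
  move=> h; apply: (Fp_dvd pp); rewrite rmorphB rmorphXn /=.
  by rewrite -[((y : nat) : int)%:~R]/((y : nat)%:R) h subrr.
case: ifP sE => chi sE.
  (* A fixed point of Frobenius is a root of X^p - X, the product of all X - a, and thus lies in the
     prime field. *)
  have : \prod_(a : 'F_p) (s - f a) = 0.
    have := congr1 (fun P => (map_poly f P).[s]) (finField_genPoly 'F_p).
    rewrite rmorphB /= map_polyXn map_polyX rmorph_prod horner_prod !hornerE card_Fp // sE subrr => /esym.
    move=> <-; apply: eq_bigr => a _; by rewrite rmorphB /= map_polyX map_polyC !hornerE.
  move/eqP; rewrite prodf_seq_eq0 => /hasP[a _]; rewrite /= subr_eq0 => /eqP /six a2.
  have ap : (a < p)%N by have := ltn_ord a; rewrite {2}Fp_cast.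
  rewrite ifT //; apply/existsP; exists (Ordinal ap); rewrite dvdF /=.
  by rewrite natr_Zp a2.
(* Conversely, a square root of 6 in the prime field would be s or -s, so s would be fixed by
   Frobenius; but s^p = -s, and s is nonzero since p does not divide 12. *)
rewrite ifF //; apply/negbTE/existsPn => y; rewrite dvdF; apply/negP => /eqP.
move: ((y : nat)%:R : 'F_p) => a a2.
have ea : a ^+ p = a by have := expf_card a; rewrite card_Fp.
have fa : f a ^+ p = f a by rewrite -rmorphXn /= ea.
have : (s - f a) * (s + f a) = 0.
  have -> : (s - f a) * (s + f a) = s ^+ 2 - f a ^+ 2 by ring.
  by rewrite s2 -rmorphXn /= a2 rmorph_nat subrr.
have ss : s ^+ p = s -> False.
  rewrite sE => e.
  have : s *+ 2 = 0 by rewrite mulr2n -{1}e addNr.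
  rewrite -mulr_natr => /eqP; rewrite mulf_eq0 -(dvdn_pcharf pK) pd // orbF => /eqP s0.
  by move: s2; rewrite s0 expr0n /= => /esym/eqP; rewrite -(dvdn_pcharf pK) p6.
move/eqP; rewrite mulf_eq0 subr_eq0 addr_eq0 => /orP[/eqP sa|/eqP sa]; apply: ss; rewrite sa //.
by rewrite exprNn -signr_odd po expr1 mulN1r fa.
Qed.

(** Both sides are even in d, as 6 > 0, and multiplicative; at the prime factors of d, all larger
    than 3, this is [legendre6]. *)
Lemma kronecker6 (d : int) : ~~ (2 %| d)%Z -> ~~ (3 %| d)%Z ->
  kronecker 6 d = if chi24 d then 1 else -1.
Proof.
move=> d2 d3; have d0 : d != 0 by apply: contraNneq d2 => ->.
rewrite /kronecker (negPf d0) andbF mul1r.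
have -> : chi24 d = chi24 `|d|%N%:Z.
  by case: (d) => n //; rewrite NegzE chi24N.
have n0 : (0 < `|d|)%N by rewrite absz_gt0.
have {d2} n2 : ~~ (2 %| `|d|)%N by apply: contra d2; rewrite dvdzE.
have {d3} n3 : ~~ (3 %| `|d|)%N by apply: contra d3; rewrite dvdzE.
move: `|d|%N n0 n2 n3 => {d0} {}d n0 n2 n3.
have pE p : p \in primes d -> [/\ prime p, (3 < p)%N & coprime p 24].
  rewrite mem_primes => /and3P[pp _ pd].
  have p2 : p != 2%N by apply: contraNneq n2 => <-.
  have p3 : p != 3%N by apply: contraNneq n3 => <-.
  have p1 := prime_gt1 pp; split=> //; first by lia.
  rewrite prime_coprime // (_ : 24 = 2 ^ 3 * 3)%N // Euclid_dvdM // Euclid_dvdX //.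
  by rewrite !dvdn_prime2 // (negPf p2) (negPf p3).
rewrite (eq_big_seq (fun p => (if chi24 p%:Z then 1 else -1) ^+ logn p d)); last first.
  move=> p /pE[pp p3 _]; rewrite /kronecker_prime ifF ?legendre6 //.
  by apply/negbTE; lia.
have {3}-> : d = (\prod_(p <- primes d) p ^ logn p d)%N.
  by rewrite {1}(prod_prime_decomp n0) prime_decompE big_map.
pose Q (x : nat) (y : int) := coprime x 24 /\ y = if chi24 x%:Z then 1 else -1.
have QM x x' y y' : Q x y -> Q x' y' -> Q (x * x')%N (y * y').
  move=> [cx ->] [cx' ->]; split; first by rewrite coprimeMl cx.
  by rewrite chi24M //; case: (chi24 _); case: (chi24 _).
suff [] : Q (\prod_(p <- primes d) p ^ logn p d)%N (\prod_(p <- primes d) (if chi24 p%:Z then 1 else -1) ^+ logn p d) by [].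
rewrite big_seq [X in Q _ X]big_seq; elim/big_ind2: _ => [||p /pE[_ _ p24]]; [by [] | by move=> *; apply: QM|].
elim: (logn p d) => [|k IH]; first by [].
by rewrite expnS exprS; apply: QM.
Qed.

End Kronecker.

(** * The congruence modulo p *)

Section Congruence.

(** The right side is eta(6t)/eta(t) in powers of ex(t/24). The convention that [b6] vanishes off
    the natural numbers matches the zeros of the shift and of the stretch. *)
Lemma b6E (m : nat) : (b6 ((m%:R - 5) / 24))%:Z =
  shift_seq 5 (stretch 24 (conv (stretch 6 eul) part)) m.
Proof.
rewrite /b6 /shift_seq; case: ltnP => m5.
  rewrite ifF //; apply/negbTE/negP => /natrP[k hk].
  have : (m%:R - 5) / 24 < 0 :> rat.
    by rewrite ltr_pdivrMr ?ltr0n // mul0r subr_lt0 (ltr_nat rat m 5).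
  by rewrite hk ltNge ler0n.
have mE : m%:R - 5 = (m - 5)%:R :> rat by rewrite natrB.
rewrite mE [stretch 24 _ _]/stretch; case: (boolP (24 %| m - 5)%N) => [/dvdnP[k kE] | nk].
  rewrite kE mulnK // natrM mulfK ?pnatr_eq0 // rpred_nat natrK.
  by rewrite card_regular_partitions.
rewrite ifF //; apply/negbTE/negP => /natrP[k hk].
have : (m - 5)%:R = (k * 24)%:R :> rat by rewrite natrM -hk divfK ?pnatr_eq0.
by move/eqP; rewrite eqr_nat => /eqP e; rewrite e dvdn_mull in nk.
Qed.

Lemma stretch_comm (K : comNzRingType) k l (a : nat -> K) : (0 < k)%N -> (0 < l)%N ->
  stretch k (stretch l a) = stretch l (stretch k a).
Proof.
have E m n (b : nat -> K) : (0 < m)%N -> (0 < n)%N -> stretch m (stretch n b) =1 stretch (m * n) b.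
  move=> m0 n0 i; rewrite /stretch; case: ifP => [/dvdnP[j ->]|h].
    by rewrite mulnK // [(m * n)%N]mulnC dvdn_pmul2r // divnMr.
  by rewrite ifF //; apply/negbTE/negP => /(dvdn_trans (dvdn_mulr n (dvdnn m))); rewrite h.
by move=> k0 l0; apply/funext => i; rewrite !E // mulnC.
Qed.

Lemma shift_stretch (K : comNzRingType) k s (a : nat -> K) : (0 < k)%N ->
  shift_seq (k * s) (stretch k a) = stretch k (shift_seq s a).
Proof.
move=> k0; apply/funext => i; rewrite /shift_seq /stretch.
case: (boolP (k %| i)%N) => [/dvdnP[j ->]|h].
  by rewrite mulnK // [(j * k)%N]mulnC ltn_pmul2l // -mulnBr dvdn_mulr // mulKn.
case: ltnP => // si; rewrite ifF //; apply/negbTE; apply: contra h => h.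
by rewrite -(subnK si) dvdn_addl // dvdn_mulr.
Qed.

Lemma shift_shift (K : comNzRingType) s s' (a : nat -> K) :
  shift_seq (s + s') a = shift_seq s (shift_seq s' a).
Proof.
apply/funext => i; rewrite /shift_seq; case: ltnP => h; case: ltnP => h' //; last by rewrite subnDA ifF //; lia.
- by rewrite ifT //; lia.
- by lia.
Qed.

Lemma conv_shiftC (K : comNzRingType) s (a b : nat -> K) :
  conv (shift_seq s a) b =1 conv a (shift_seq s b).
Proof.
move=> n; rewrite conv_shift convC conv_shift; congr (shift_seq s _ n).
by apply/funext => m; rewrite convC.
Qed.

(* Modulo p the factor eta^(4 p^r) of the generating series becomes a series in
   X^(p^r), so that it can be pulled out of the subsequence of indices p^r n and
   cancels against the denominator eta^4. *)
Lemma quot_congr (p r : nat) (c' : nat -> int) : prime p -> odd p ->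
  (forall n, (c' n)%:~R = (c24 (p ^ r) (p ^ r * n))%:~R :> 'F_p) ->
  (forall i, (i < 4)%N -> c' i = 0) ->
  forall n, ((b6 (((p ^ r * n)%:R - 5) / 24))%:Z = quot_coef c' n %[mod p])%Z.
Proof.
move=> pp po hc c0 n; set N := (p ^ r)%N in hc *.
have N0 : (0 < N)%N by rewrite expn_gt0 prime_gt0.
pose Fp : comNzRingType := 'F_p.
pose be := shift_seq 5 (stretch 24 (conv (stretch 6 eul) part)).
pose E4 := stretch 24 (cpow eul 4).
(* The series of eta^4 in powers of ex(t/24); its leading coefficient 1 permits [conv_cancel] modulo
   p. *)
pose w := shift_seq 4 E4.
suff h : zser Fp (fun n => be (N * n)%N) n = zser Fp (quot_coef c') n.
  apply/eqP; rewrite b6E -/be eqz_mod_dvd; apply: (Fp_dvd pp).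
  by rewrite rmorphB /= -/(zser Fp _ n); move: h; rewrite /zser => ->; rewrite subrr.
have w0 i : (i < 4)%N -> zser Fp w i = 0 by move=> i4; rewrite /zser /w /shift_seq i4.
have eul0 : cpow eul 4 0 = 1.
  by rewrite /= /conv !big_ord1 /delta /= /eul /eulp big_ord0 coef1.
have w4 : zser Fp w 4 = 1 by rewrite /zser -[w 4]/(cpow eul 4 0) eul0.
apply: (conv_cancel w0 w4) n => n.
pose D := conv c' (stretch 24 (cpow part 4)).
have DE : D =1 shift_seq 4 (quot_coef c').
  move=> i; rewrite /shift_seq; case: ltnP => i4; first by rewrite /D (conv_eq0 _ c0).
  by rewrite /quot_coef subnK.
have wa : conv w (quot_coef c') =1 c'.
  move=> i; rewrite conv_shiftC -(eq_conv (fun _ => erefl) DE) /D convC -convA -[RHS]conv_delta.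
  apply: eq_conv => // j; rewrite conv_stretch // -(@stretch_delta _ 24) //.
  by congr stretch; apply/funext => k; apply: conv_cpow_inv; apply: conv_part_eul.
have -> : conv (zser Fp w) (zser Fp (quot_coef c')) n = zser Fp c' n.
  by rewrite -zser_conv; congr zser; apply/funext.
rewrite [in RHS]/zser hc -/(zser Fp (fun n => be (N * n)%N)).
(* Modulo p the series of eta(t)^(4N) is that of eta(N t)^4, that is, [w] in the variable X^N. *)
have cE : zser Fp (c24 N) = conv (stretch N (zser Fp w)) (zser Fp be).
  have fr : zser Fp (cpow eul (4 * N)) = stretch N (zser Fp (cpow eul 4)).
    by rewrite -zser_stretch; apply/funext => i; rewrite /zser; apply: eul_frobenius.
  rewrite /c24 zser_shift zser_stretch zser_conv fr shift_shift [(4 * N)%N]mulnC.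
  have st (x y : nat -> Fp) : stretch 24 (conv x y) = conv (stretch 24 x) (stretch 24 y).
    by apply/funext => i; rewrite conv_stretch.
  rewrite st [stretch 24 (stretch N _)]stretch_comm // -[stretch 24 (zser Fp (cpow _ _))]zser_stretch -/E4.
  apply/funext => i; rewrite /w zser_shift -shift_stretch //.
  rewrite [RHS]convC /be zser_shift conv_shift zser_stretch; congr (shift_seq 5 _ i).
  by apply/funext => j; rewrite convC conv_shift; congr (shift_seq _ _ j); apply/funext => k; rewrite convC.
by rewrite -[(c24 N (N * n))%:~R]/(zser Fp (c24 N) (N * n)%N) cE conv_stretch_mul.
Qed.

End Congruence.

Section HeckeCoefficients.
Variable R : realType.
Local Notation C := R[i].

Lemma quot_cusp_forms_mod (p M r : nat) (c' : nat -> int) (F : C -> C) : prime p -> odd p ->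
  M = (p ^ r)%N -> good (2 * M) (fun n => 24 < n)%N F -> fexp 24 (zser C c') F ->
  (forall i, (i < 4)%N -> c' i = 0) ->
  (forall n, (c' n)%:~R = (c24 M (M * n))%:~R :> 'F_p) ->
  cusp_forms_mod p (2 * M - 2) 3456 (@chi6 R) (fun n => (b6 (((M * n)%:R - 5) / 24))%:Z).
Proof.
move=> pp po ME gF eF c0 hc.
have M0 : (0 < M)%N by rewrite ME expn_gt0 prime_gt0.
exists (@quot_form R c'), (quot_coef c'); split.
- split.
  + exact: (quot_holomorphic eF c0).
  + move=> A hA z z0; rewrite (quot_slash M0 gF eF c0) //; congr (_ * _).
    rewrite /chi6; case: hA => /det2 h /dvdzP[x cE].
    rewrite kronecker6; first by case: ifP.
      by apply/negP => /dvdzP[y dE]; move: h; rewrite cE dE; lia.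
    by apply/negP => /dvdzP[y dE]; move: h; rewrite cE dE; lia.
  exact: (quot_cusp M0 gF eF c0).
- exact: (quot_qexpansion eF c0).
by rewrite {}ME in hc *; apply: quot_congr.
Qed.

(** Writing p^k / p as p^(k-1) keeps the coefficients integral for k > 0; for k > 1 the second term
    vanishes modulo p. *)
Definition heckeZ_coef (k p : nat) (c : nat -> int) n : int :=
  c (p * n)%N + p%:Z ^+ k.-1 * ((if chi24 p%:Z then 1 else -1) * stretch p c n).

Lemma heckeZ_exp24 (k p : nat) (p' e : int) Q (f : C -> C) c : prime p -> p%:Z * p' = 1 + 144 * e ->
  (0 < k)%N -> good k Q f -> fexp 24 (zser C c) f ->
  fexp 24 (zser C (heckeZ_coef k p c)) (hecke k p p' e f).
Proof.
move=> pp pe k0 gf cE; have := hecke_exp24 pp pe gf cE; congr fexp; apply/funext => n.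
rewrite -zser_stretch /zser /heckeZ_coef rmorphD rmorphM rmorphXn rmorphM /=; congr (_ + _ * (_ * _)).
  case: k k0 {gf} => // k _; rewrite exprSr mulfK // -?[p%:Z%:~R]/(p%:R) //.
  by rewrite pnatr_eq0 -lt0n prime_gt0.
by case: ifP.
Qed.

Lemma heckeZ_Fp (k p : nat) c n : prime p -> (1 < k)%N ->
  (heckeZ_coef k p c n)%:~R = (c (p * n)%N)%:~R :> 'F_p.
Proof.
move=> pp; case: k => [|[|k]] // _; rewrite /heckeZ_coef rmorphD rmorphM rmorphXn /=.
by rewrite -[p%:Z%:~R]/(p%:R) pchar_Fp_0 // exprS !mul0r addr0.
Qed.

Lemma c24_eq0 M i : (i < 5 + 4 * M)%N -> c24 M i = 0.
Proof. by rewrite /c24 /shift_seq => ->. Qed.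

Lemma heckeZ_eq0 k p c s : prime p -> (forall i, (i < s)%N -> c i = 0) ->
  forall i, (p * i < s)%N -> heckeZ_coef k p c i = 0.
Proof.
move=> pp c0 i pis; suff st : stretch p c i = 0 by rewrite /heckeZ_coef c0 // st !mulr0 addr0.
rewrite /stretch; case: ifP => // _; apply: c0; apply: leq_ltn_trans pis.
by apply: (@leq_trans i); [apply: leq_div | rewrite leq_pmull // prime_gt0].
Qed.

End HeckeCoefficients.

Theorem theorem3p2 (R : realType) :
  (forall m : nat, prime m -> (7 <= m)%N ->
     cusp_forms_mod m (2 * m - 2) 3456 (@chi6 R)
       (fun n : nat => (b6 ((m%:R * n%:R - 5) / 24))%:Z)) /\
  cusp_forms_mod 5 48 3456 (@chi6 R)
    (fun n : nat => (b6 ((25 * n%:R - 5) / 24))%:Z).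
Proof.
split=> [m mp m7|].
  have mo : odd m by case/even_prime: (mp) => // m2; rewrite m2 in m7.
  have m0 := prime_gt0 mp.
  have [p' [e pe]] : exists p' e : int, m%:Z * p' = 1 + 144 * e.
    have [u [v uv]] := Bezoutz m%:Z 144.
    have uv1 : u * m%:Z + v * 144 = 1.
      rewrite uv /gcdz /=; have /eqP -> : coprime m 144; last by [].
      rewrite prime_coprime // (_ : 144 = 2 ^ 4 * 3 ^ 2)%N // Euclid_dvdM // !Euclid_dvdX //.
      by rewrite !dvdn_prime2 //; lia.
    exists u, (- v); have -> : m%:Z * u = (u * m%:Z + v * 144) + 144 * - v by ring.
    by rewrite uv1.
  have gF := F0_good R m0.
  have k0 : (0 < 2 * m)%N by rewrite muln_gt0.
  have := @quot_cusp_forms_mod R m m 1 (heckeZ_coef (2 * m) m (c24 m)) (hecke (2 * m) m p' e (@F0 R m)) mp mo.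
  rewrite expn1 => /(_ erefl) H.
  have -> : (fun n : nat => (b6 ((m%:R * n%:R - 5) / 24))%:Z) = (fun n => (b6 (((m * n)%:R - 5) / 24))%:Z).
    by apply/funext => n; rewrite natrM.
  apply: H.
  (* From m n >= 24 m - 5 and m > 5 follows n >= 24, and n = 24 is excluded because 24 m is not an
     exponent of F. *)
  - apply: (hecke_good mp pe gF) => n; rewrite /supp0 => /andP[h1 h2].
      by have : (n != 24)%N by [apply: contraNneq h2 => ->; rewrite mulnC]; nia.
    by nia.
  - by apply: (heckeZ_exp24 mp pe k0 gF); apply: F0_exp24.
  - by move=> i i4; apply: (heckeZ_eq0 _ mp (@c24_eq0 m)); nia.
  by move=> n; rewrite heckeZ_Fp //; lia.
have p5 : prime 5 by [].
have pe : 5%:Z * 29 = 1 + 144 * 1 by [].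
have gF := F0_good R (isT : (0 < 25)%N).
(* The bounds for M = 25 divided by 5: 595 / 5 = 119 and 600 / 5 = 120. The next division gives n >=
   24, and the exclusion of 120 rules out n = 24. *)
have g1 : good 50 (fun n => (119 <= n) && (n != 120))%N (hecke 50 5 29 1 (@F0 R 25)).
  by apply: (hecke_good p5 pe gF) => n; rewrite /supp0 => /andP[]; lia.
have e1 := heckeZ_exp24 p5 pe (isT : (0 < 50)%N) gF (F0_exp24 R 25).
have := @quot_cusp_forms_mod R 5 25 2 (heckeZ_coef 50 5 (heckeZ_coef 50 5 (c24 25)))
  (hecke 50 5 29 1 (hecke 50 5 29 1 (@F0 R 25))) p5 isT erefl.
have -> : (fun n : nat => (b6 ((25 * n%:R - 5) / 24))%:Z) = (fun n => (b6 (((25 * n)%:R - 5) / 24))%:Z).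
  by apply/funext => n; rewrite natrM.
apply.
- by apply: (hecke_good p5 pe g1) => n /andP[]; lia.
- exact: (heckeZ_exp24 p5 pe (isT : (0 < 50)%N) g1 e1).
(* The series [c24 25] starts at 5 + 4 * 25 = 105; one step leaves zeros below 105 / 5 = 21, and i <
   4 gives 5 i < 21. *)
- move=> i i4; apply: (heckeZ_eq0 (s := 21) _ p5) => [j j21|]; last by lia.
  by apply: (heckeZ_eq0 (s := 105) _ p5) => [l l105|]; [apply: c24_eq0 | lia].
by move=> n; rewrite !heckeZ_Fp // mulnA.
Qed.
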